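(* Let $d\ge2$, let $a\in(0,1)$, let $Q(x)=|x|^2$, and let $\mu_a$ be the unique minimizer of $I[\mu]=\int\int K(x-y)\,d\mu(x)\,d\mu(y)+\int Q\,d\mu$ over the set $\mathcal{M}_a$ of all probability measures $\mu$ on $\mathbb{R}^d$ with $\mu(\Gamma)\ge a$. Let $U^{\mu_a}(y)=\int K(x-y)\,d\mu_a(x)$ and set $$A_\Gamma=\frac1a\int_\Gamma(2U^{\mu_a}+Q)\,d\mu_a,\qquad A_0=\frac1{1-a}\int_{\mathbb{R}^d\setminus\Gamma}(2U^{\mu_a}+Q)\,d\mu_a .$$ Then, quasi everywhere, $$2U^{\mu_a}+Q=A_\Gamma\ \text{ on }\ \Gamma\cap\operatorname{supp}\mu_a,\qquad 2U^{\mu_a}+Q\ge A_\Gamma\ \text{ on }\ \Gamma,$$ and, quasi everywhere, $$2U^{\mu_a}+Q=A_0\ \text{ on }\ \operatorname{supp}\mu_a\setminus\Gamma,\qquad 2U^{\mu_a}+Q\ge A_0\ \text{ on }\ \mathbb{R}^d\setminus(\operatorname{supp}\mu_a\setminus\Gamma).$$ Furthermore, $A_\Gamma>A_0$.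
   Context: The kernel is $K(x-y)=\log\frac{1}{|x-y|}$ if $d=2$ and $K(x-y)=\frac{1}{|x-y|^{d-2}}$ if $d\ge3$. If $d=2$, $\Gamma\subset\mathbb{R}^2$ is a regular $C^{1,\alpha}$-smooth curve without self-intersections, of locally finite length, with arc-length parametrization $\Gamma:\mathbb{R}\to\mathbb{R}^2$, $|\dot\Gamma|=1$. If $d\ge3$, $\Gamma$ is a Lyapunov surface in $\mathbb{R}^d$ (a hypersurface with Hölder continuous unit normal, i.e. of class $C^{1,\alpha}$). ''Quasi everywhere'' means outside a set of zero capacity with respect to the kernel $K$ (logarithmic capacity if $d=2$, Newtonian capacity if $d\ge3$). All measures are Borel measures. *)

(* Defs.v *)
From HB Require Import structures.
From mathcomp Require Import all_boot all_order all_algebra.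
From mathcomp Require Import all_classical all_reals all_analysis.

Set Implicit Arguments.
Unset Strict Implicit.
Unset Printing Implicit Defensive.

Import Order.TTheory GRing.Theory Num.Theory.
Import numFieldNormedType.Exports.

Local Open Scope classical_set_scope.
Local Open Scope ring_scope.
Local Open Scope ereal_scope.

(* The norm `|x| of the library on 'rV[R]_d is the sup norm.  It induces the
   same topology and the same Hölder classes as the Euclidean norm enorm, which
   is the one written |x| in the kernel, in Q and in |c'| = 1. *)
Definition enorm (R : realType) (d : nat) (x : 'rV[R]_d) : R :=
  Num.sqrt (\sum_(i < d) x ord0 i ^+ 2)%R.

Notation borelRd R d := (g_sigma_algebraType (@open 'rV[R]_d)).

Notation probRd R d := (probability (borelRd R d) R%type).

Section geometry.
Context {R : realType}.

Definition locally_holder (V W : normedModType R) (A : set V) (alpha : R)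
    (f : V -> W) : Prop :=
  forall x, A x -> exists2 N : set V, nbhs x N &
    exists C : R, forall y z, (A `&` N) y -> (A `&` N) z ->
      (`|f y - f z| <= C * `|y - z| `^ alpha)%R.

Definition grad (d : nat) (phi : 'rV[R]_d -> R) (x : 'rV[R]_d) : 'rV[R]_d :=
  \row_(i < d) ('D_(delta_mx ord0 i) phi x).

(* G is the trace of a curve c with an arc-length parametrization of class
   C^{1,alpha} over the whole line; c being parametrized by arc length,
   lebesgue_measure (c @^-1` B) is the length of the part of c inside B. *)
Definition smooth_curve (d : nat) (G : set 'rV[R]_d) : Prop :=
  exists c : R -> 'rV[R]_d, exists alpha : R,
    [/\ (0 < alpha <= 1)%R,
        (forall t, derivable c t 1%R) /\ locally_holder setT alpha (derive1 c),
        forall t, enorm (derive1 c t) = 1%R,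
        injective c /\ range c = G
      & forall B : set 'rV[R]_d, compact B ->
          lebesgue_measure (c @^-1` B) < +oo].

Definition local_equation (d : nat) (G V : set 'rV[R]_d)
    (phi : 'rV[R]_d -> R) : Prop :=
  [/\ open V,
      forall y, V y -> differentiable phi y /\ {for y, continuous (grad phi)},
      forall y, V y -> grad phi y != 0%R
    & G `&` V = [set y | V y /\ phi y = 0%R]].

(* A C^1 hypersurface without boundary, closed as a subset of the space, with
   a Hölder continuous unit normal n (the values of n off G are irrelevant).
   G need be neither bounded nor connected. *)
Definition lyapunov_surface (d : nat) (G : set 'rV[R]_d) : Prop :=
  closed G /\
  exists n : 'rV[R]_d -> 'rV[R]_d, exists alpha : R,
    [/\ (0 < alpha <= 1)%R,
        locally_holder G alpha n,
        forall x, G x -> enorm (n x) = 1%R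
      & forall x, G x -> exists V phi,
          [/\ V x, local_equation G V phi &
              forall y, (G `&` V) y -> exists k : R, grad phi y = k *: n y]].

Definition admissible_Gamma (d : nat) (G : set 'rV[R]_d) : Prop :=
  if d == 2%N then smooth_curve G else lyapunov_surface G.

End geometry.

Section potential_theory.
Context {R : realType} {d : nat}.

Definition K (x : 'rV[R]_d) : \bar R :=
  if x == 0%R then +oo
  else if d == 2%N then (ln ((enorm x)^-1))%:E
  else ((enorm x ^+ (d - 2))^-1)%:E.

Definition Q (x : 'rV[R]_d) : R := (enorm x ^+ 2)%R.

Definition U (mu : probRd R d) (y : 'rV[R]_d) : \bar R :=
  \int[mu]_x K (x - y)%R.

Definition mutual_energy (mu : probRd R d) : \bar R := \int[mu]_y U mu y.

(* The sum is the dual addition of extended reals, for which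
   -oo + +oo = +oo.  It only differs from the usual one when \int Q = +oo; then
   weighted_energy mu = +oo, as is forced by
   K (x - y) + (Q x + Q y) / 2 >= c (Q x + Q y) - C with c > 0. *)
Definition weighted_energy (mu : probRd R d) : \bar R :=
  (mutual_energy mu + \int[mu]_x (Q x)%:E)%dE.

Definition measures_with_mass (G : set 'rV[R]_d) (a : R) : set (probRd R d) :=
  [set mu : probRd R d | a%:E <= mu G].

(* A measure of the library also takes arbitrary values on non-Borel sets,
   hence uniqueness is up to equality on Borel sets. *)
Definition unique_minimizer (J : probRd R d -> \bar R) (C : set (probRd R d))
    (mu : probRd R d) : Prop :=
  [/\ C mu,
      forall nu, C nu -> J mu <= J nu
    & forall nu, C nu -> (forall la, C la -> J nu <= J la) ->
        forall A : set (borelRd R d), measurable A -> nu A = mu A].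

Definition supp (mu : probRd R d) : set 'rV[R]_d :=
  [set x | forall V : set 'rV[R]_d, open V -> V x -> 0 < mu V].

Definition robin (E : set 'rV[R]_d) : \bar R :=
  ereal_inf [set mutual_energy nu | nu in [set nu : probRd R d |
    exists F : set 'rV[R]_d, [/\ compact F, F `<=` E & nu F = 1]]].

(* Logarithmic capacity exp (- robin E) if d = 2, Newtonian capacity
   1 / robin E if d >= 3, with 1 / +oo = 0 and 1 / 0 = +oo. *)
Definition capacity (E : set 'rV[R]_d) : \bar R :=
  if d == 2%N then expeR (- robin E) else (robin E)^-1.

Definition quasi_everywhere_on (E : set 'rV[R]_d) (P : 'rV[R]_d -> Prop) :
    Prop :=
  exists N : set (borelRd R d),
    [/\ measurable N, capacity N = 0 & forall x, E x -> ~ N x -> P x].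

End potential_theory.

(* Main.v *)
Require Import Defs.
From HB Require Import structures.
From mathcomp Require Import all_boot all_order all_algebra.
From mathcomp Require Import all_classical all_reals all_analysis.
From mathcomp Require Import measurable_realfun ring lra.

(** Put [weighted_kernel x y = K (x - y) + Q x + Q y]. It is nonnegative for both
    kernels, so that all energies below are Tonelli integrals, and when the
    second moment [r] of [mu] is finite the function of the theorem is
    [2 U + Q = 2 V - 2 r - Q], where [V] is the potential of [mu] for the
    weighted kernel ([effective_potentialE]).

    Variation. Let [rho] be [mu] conditioned on a set [W] and compare [mu] with
    [mu - t rho + t nu] for small [t > 0]. Whenever these are competitors,
    [slope mu rho <= slope mu nu], where [slope mu nu] is the integral of
    [2 V - Q] against [nu] ([first_variation]). One may take [W = Gamma] and any
    [nu] carried by [Gamma], or [W = ~` Gamma] and any [nu] at all; and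
    [A_Gamma], [A_0] are the slopes of the two conditioned measures, shifted by
    [2 r] ([potential_average]). The energy of [mu] is finite because the
    minimizer is unique ([minimizer_finite_energy]).

    Quasi-everywhere inequalities. A measure carried by a compact subset of
    [W] (of the whole space if [W = ~` Gamma]) on which [2 U + Q < A_W] and with finite
      energy would have a smaller
    slope than [rho]; so that set has capacity zero ([capacity_below]) and
    [rho] does not charge it. As the mean of [2 U + Q] over [rho] is [A_W],
    equality holds [rho]-almost everywhere, and lower semicontinuity of the
    potential gives [2 U + Q <= A_W] at every point all of whose neighbourhoods
    charge [W] ([le_level]). A point of [Gamma] in the support of [mu] at which
    [mu] restricted to [Gamma] has no mass is a limit of mass outside
    [Gamma]; there [2 U + Q <= A_0], and this suffices because [A_0 < A_Gamma].

    The strict inequality. If [A_Gamma <= A_0], then [mu], being the mean of its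
    two conditioned parts, satisfies [slope mu mu <= slope mu nu] for every
    [nu]. Such a measure cannot charge [Gamma] ([admissible_null]), although
    [mu Gamma >= a > 0]. The same fact gives [mu Gamma = a], since all directions
    would be admissible if [mu Gamma > a].

    To prove it, take for [nu] the convolution of [mu] with a Gaussian of
    variance of order [S]. The kernel is superharmonic, and writing it as a time
    integral of the heat kernel makes this quantitative: averaging decreases
    [K x] by at least a constant times [S ^ (1 - d / 2)] when [|x| ^ 2 <= S]
    ([K_gaussian]). The second moment increases by at most [d S]. Hence the
    pairs at distance at most [sqrt S] have [mu \x mu]-mass of order at most
    [S ^ (d / 2)] ([pair_mass_bound]). Locally [Gamma] is covered by
    [O(n ^ (d - 1))] sets of diameter [O(1 / n)], and the Cauchy-Schwarz
    inequality gives [mu E ^ 2 = O(n ^ (d - 1) n ^ (- d))] for such a piece [E]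
    ([thin_null]). *)

Import Order.TTheory GRing.Theory Num.Theory.
Import numFieldNormedType.Exports.

Local Open Scope classical_set_scope.
Local Open Scope ring_scope.
Local Open Scope ereal_scope.

Set Implicit Arguments.
Unset Strict Implicit.
Unset Printing Implicit Defensive.

(** * Probability measures: mixtures and conditioning *)

Section measure_tools.
Context {R : realType}.

(** Stating the existence of the image keeps the measurability proof of [f] out
    of the type of the measure. *)
Lemma map_probability d1 d2 (T1 : measurableType d1) (T2 : measurableType d2)
    (P : probability T1 R) (f : T1 -> T2) :
  measurable_fun setT f ->
  exists P' : probability T2 R,
    forall g : T2 -> \bar R, (forall y, 0 <= g y) -> measurable_fun setT g ->
      \int[P']_y g y = \int[P]_x g (f x).
Proof.
move=> mf.
pose X : {mfun T1 >-> T2} := HB.pack f (isMeasurableFun.Build _ _ _ _ f mf).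
exists (distribution P X) => g g0 mg.
by rewrite ge0_integral_pushforward.
Qed.

Context d (T : measurableType d).
Implicit Types (mu nu P : probability T R) (W : set T).

(** Normalization provides the structure of a probability and does nothing to a
    measure of mass one. *)
Lemma measure_probability (m : {measure set T -> \bar R}) : m setT = 1 ->
  exists P, forall A, P A = m A.
Proof.
move=> m1.
exists (mnormalize m (dirac point)) => A.
by rewrite /= /mnormalize m1 /= onee_eq0/= invr1 mule1.
Qed.

Lemma integral_mrestr (m : {measure set T -> \bar R}) W (mW : measurable W)
    (f : T -> \bar R) : (forall y, 0 <= f y) -> measurable_fun setT f ->
  \int[mrestr m mW]_x f x = \int[m]_(x in W) f x.
Proof.
move=> f0 mf; rewrite -{1}(setUv W) ge0_integral_setU//=; last 3 first.
- exact: measurableC.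
- by rewrite setUv.
- exact/disj_setPCl.
rewrite [X in _ + X]null_set_integral ?adde0//; last 3 first.
- exact: measurableC.
- exact: measurable_funTS.
- by rewrite /= /mrestr setICl measure0.
apply: eq_measure_integral => A mA AW.
by rewrite /= /mrestr setIidl.
Qed.

(** The fraction [tau] of the mass of [mu] in [W] is moved to [nu]: these are the
    competitors of the variational argument. *)
Lemma mixture_probability mu nu W (tau : R) : measurable W ->
  (0 <= tau <= 1)%R ->
  exists P, forall f : T -> \bar R,
    (forall y, 0 <= f y) -> measurable_fun setT f ->
    \int[P]_x f x = \int[mu]_(x in ~` W) f x +
      ((1 - tau)%:E * \int[mu]_(x in W) f x +
       (tau * fine (mu W))%:E * \int[nu]_x f x).
Proof.
move=> mW /andP[t0 t1].
have mWC := measurableC mW.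
have t1' : (0 <= 1 - tau)%R by rewrite subr_ge0.
have tm : (0 <= tau * fine (mu W))%R by rewrite mulr_ge0// fine_ge0.
pose m2 := measure_add (mscale (NngNum t1') (mrestr mu mW))
   (mscale (NngNum tm) nu).
pose m := measure_add (mrestr mu mWC) m2.
have mT : m setT = 1.
  rewrite /m measure_addE (_ : (_ + _)%E = mrestr mu mWC setT +
    ((1 - tau)%:E * mrestr mu mW setT + (tau * fine (mu W))%:E * nu setT)%E).
    rewrite /mrestr !setTI probability_setT mule1.
    rewrite probability_setC// -(fineK (fin_num_measure mu W mW)).
    by rewrite -!EFinM -EFinB -!EFinD; congr EFin; rewrite /=; ring.
  by congr (_ + _); exact: measure_addE.
have [P Pm] := measure_probability mT.
exists P => f f0 mf.
rewrite (@eq_measure_integral _ _ _ _ m); last by move=> A _ _; exact: Pm.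
rewrite ge0_integral_measure_add//= ge0_integral_measure_add//=.
by rewrite !ge0_integral_mscale//= !integral_mrestr.
Qed.

Lemma conditional_probability mu W : measurable W -> (0 < mu W) ->
  exists2 P : probability T R, (forall A, P A = (fine (mu W))^-1%:E * mu (A `&` W)) &
    forall f : T -> \bar R,
    (forall y, 0 <= f y) -> measurable_fun setT f ->
    \int[P]_x f x = (fine (mu W))^-1%:E * \int[mu]_(x in W) f x.
Proof.
move=> mW W0.
have fW := fin_num_measure mu W mW.
have W0' : (0 < fine (mu W))%R by rewrite fine_gt0// W0 ltey_eq fW.
have Wi : (0 <= (fine (mu W))^-1)%R by rewrite invr_ge0 ltW.
pose m := mscale (NngNum Wi) (mrestr mu mW).
have mT : m setT = 1.
  rewrite /m /mscale /= /mrestr setTI -[X in _ * X](fineK fW) -EFinM mulVf//.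
  by rewrite gt_eqF.
have [P Pm] := measure_probability mT.
exists P => [A|f f0 mf]; first by rewrite Pm.
rewrite (@eq_measure_integral _ _ _ _ m); last by move=> A _ _; exact: Pm.
by rewrite ge0_integral_mscale//= integral_mrestr.
Qed.

End measure_tools.

(** Inversion is discontinuous at [0], but [u^-1 = u * (u ^+ 2) `^ (-1)] reduces
    it to a real power. *)
Lemma measurable_funVr {R : realType} d (T : measurableType d) (f : T -> R) :
  measurable_fun setT f -> measurable_fun setT (fun x => (f x)^-1%R).
Proof.
move=> mf.
have -> : (fun x => (f x)^-1)%R = (fun x => f x * (f x ^+ 2) `^ (-1))%R.
  apply/funext => x; rewrite powR_inv1 ?sqr_ge0//.
  have [->|f0] := eqVneq (f x) 0%R; first by rewrite invr0 mul0r.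
  by rewrite expr2 invfM mulrA divff// mul1r.
apply: measurable_funM => //.
apply: (measurableT_comp (f := @powR R ^~ (-1)%R) (g := fun x => (f x ^+ 2)%R)).
  exact: measurable_powR.
exact: measurable_funX.
Qed.

(** * Borel sets of the space and the weighted kernel *)

Section borel.
Context {R : realType} {d : nat}.
Notation T := (borelRd R d).
Implicit Types (x y : 'rV[R]_d).

Lemma ballrV x y (e : R) : (0 < e)%R ->
  ball x e y <-> (forall i, `|x ord0 i - y ord0 i| < e)%R.
Proof.
move=> e0; split=> [[_ h] i|h]; first exact: h.
by split=> // i j; rewrite (ord1 i); exact: h.
Qed.

(** A countable base of the topology. Countability is what makes the coordinates
    generate the Borel sets, and local nullity imply nullity. *)
Lemma rational_balls : exists B : nat -> 'rV[R]_d * R,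
  forall (O : set 'rV[R]_d) x, open O -> O x ->
    exists n, ball (B n).1 (B n).2 x /\ ball (B n).1 (B n).2 `<=` O.
Proof.
pose dec n : {ffun 'I_d -> rat} * rat := odflt ([ffun=> 0%R], 0%R) (unpickle n).
exists (fun n => (\row_i ratr ((dec n).1 i), ratr (dec n).2)) => O x oO Ox.
have : nbhs x O by exact: open_nbhs_nbhs.
move=> /nbhs_ballP[e /= e0 xeO].
have e40 : (e / 4 < e / 2)%R by lra.
have [r /[!in_itv]/= /andP[r1 r2]] := rat_in_itvoo e40.
have qP i : exists q : rat, (`|ratr q - x ord0 i| < e / 4)%R.
  have h : (x ord0 i < x ord0 i + e / 4)%R by lra.
  have [q /[!in_itv]/= /andP[q1 q2]] := rat_in_itvoo h.
  by exists q; rewrite ger0_norm; lra.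
pose q := [ffun i => projT1 (cid (qP i))].
have qE i : (`|ratr (q i) - x ord0 i| < e / 4)%R.
  by rewrite ffunE; case: cid.
exists (pickle (q, r)); rewrite /dec pickleK /=.
have r0 : (0 < ratr r :> R)%R by lra.
split; first by apply/ballrV => // i; rewrite mxE (lt_trans (qE i)).
move=> y /(ballrV _ _ r0) h; apply: xeO; apply/ballrV => // i.
have := h i; rewrite mxE => hi.
rewrite (le_lt_trans (ler_distD (ratr (q i)) _ _))// distrC.
by have := qE i; lra.
Qed.

Lemma measurable_open (O : set T) : open (O : set 'rV[R]_d) -> measurable O.
Proof. by move=> oO; exact: sub_sigma_algebra. Qed.

Lemma measurable_closed (O : set T) : closed (O : set 'rV[R]_d) -> measurable O.
Proof.
move=> cO; rewrite -(setCK O); apply: (@measurableC _ T).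
by apply: measurable_open; exact: (@closed_openC 'rV[R]_d).
Qed.

Lemma continuous_measurable_rV (f : T -> R) :
  continuous (f : 'rV[R]_d -> R) -> measurable_fun setT f.
Proof.
move=> /continuousP cf.
apply: (measurability _ (RGenOpens.measurableE R)).
move=> _ [_ [a [b ->]] <-]; rewrite setTI.
by apply: measurable_open; apply: cf; exact: interval_open.
Qed.

Lemma measurable_coord (i : 'I_d) :
  measurable_fun setT (fun x : T => (x : 'rV[R]_d) ord0 i).
Proof. by apply: continuous_measurable_rV; exact: coord_continuous. Qed.

(** An open set is a countable union of rational balls, and a ball of the sup
    norm is a box, that is a condition on the coordinates. *)
Lemma measurable_coords d' (X : measurableType d') (f : X -> T) :
  (forall i, measurable_fun setT (fun u => (f u : 'rV[R]_d) ord0 i)) ->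
  measurable_fun setT f.
Proof.
move=> mf; apply: (@measurability _ _ _ T setT f (@open 'rV[R]_d) erefl).
move=> _ [V oV <-]; rewrite setTI.
have [B BP] := rational_balls.
pose I := [set n | ball (B n).1 (B n).2 `<=` (V : set 'rV[R]_d)].
have -> : f @^-1` V = \bigcup_(n in I) (f @^-1` (ball (B n).1 (B n).2)).
  apply/seteqP; split => u /=.
    by move=> Vu; have [n [Bn1 Bn2]] := BP _ _ oV Vu; exists n.
  by move=> [n nI /= ?]; exact: nI.
apply: bigcup_measurable => n _.
have [r0|r0] := ltP 0%R (B n).2; last first.
  rewrite (_ : _ @^-1` _ = set0)//; apply/seteqP; split=> // u [/= ].
  by rewrite ltNge r0.
rewrite (_ : _ @^-1` _ = \bigcap_(i in [set: 'I_d])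
    ((fun u => `|(B n).1 ord0 i - (f u : 'rV[R]_d) ord0 i|%R) @^-1`
      `]-oo, (B n).2[%classic)).
  apply: fin_bigcap_measurable => // i _; rewrite -[X in measurable X]setTI.
  have mg : measurable_fun setT
      (fun u => `|(B n).1 ord0 i - (f u : 'rV[R]_d) ord0 i|%R).
    by apply: measurableT_comp => //; exact: measurable_funB.
  exact: mg.
apply/seteqP; split => u /=.
  by move=> /(ballrV _ _ r0) h i _ /=; rewrite in_itv/=.
move=> h; apply/(ballrV _ _ r0) => i; have := h i Logic.I.
by rewrite /= in_itv.
Qed.
End borel.

Section kernel.
Context {R : realType} {d : nat}.
Notation T := (borelRd R d).
Implicit Types (x y z : 'rV[R]_d).

Let mcoord d' (X : measurableType d') (f : X -> T) i : measurable_fun setT f ->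
  measurable_fun setT (fun u => (f u : 'rV[R]_d) ord0 i).
Proof. by move=> mf; exact: measurableT_comp (measurable_coord i) mf. Qed.

Lemma measurable_addrV : measurable_fun setT (fun u : T * T => (u.1 + u.2)%R : T).
Proof.
apply: measurable_coords => i.
under eq_fun do rewrite mxE.
by apply: measurable_funD; apply: mcoord.
Qed.

Lemma measurable_oppV : measurable_fun setT (fun u : T => (- u)%R : T).
Proof.
apply: measurable_coords => i.
under eq_fun do rewrite mxE.
by apply: measurable_funN; exact: measurable_coord.
Qed.

Lemma measurable_subrV : measurable_fun setT (fun u : T * T => (u.1 - u.2)%R : T).
Proof.
apply: (measurableT_comp (f := fun u : T * T => (u.1 + u.2)%R : T)
  (g := fun u : T * T => (u.1, - u.2)%R : T * T) measurable_addrV).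
apply: measurable_fun_pair => //.
exact: measurableT_comp measurable_oppV _.
Qed.

Lemma measurable_addcV x : measurable_fun setT (fun u : T => (x + u)%R : T).
Proof.
apply: measurable_coords => i.
under eq_fun do rewrite mxE.
by apply: measurable_funD => //; exact: measurable_coord.
Qed.

Lemma enorm_ge0 x : (0 <= enorm x)%R. Proof. exact: sqrtr_ge0. Qed.

Lemma Q_sum x : Q x = (\sum_(i < d) x ord0 i ^+ 2)%R.
Proof. by rewrite /Q /enorm sqr_sqrtr// sumr_ge0// => i _; exact: sqr_ge0. Qed.

Lemma Q_ge0 x : (0 <= Q x)%R. Proof. exact: sqr_ge0. Qed.

Lemma Q_eq0 x : (Q x == 0)%R = (x == 0)%R.
Proof.
rewrite Q_sum psumr_eq0; last by move=> i _; exact: sqr_ge0.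
apply/allP/eqP => [h|-> i _]; last by rewrite mxE expr0n eqxx.
apply/rowP => i; rewrite mxE; apply/eqP.
by have := h i (mem_index_enum _); rewrite implyTb sqrf_eq0.
Qed.

Lemma enorm_gt0 x : (0 < enorm x)%R = (x != 0)%R.
Proof. by rewrite lt_def enorm_ge0 andbT -Q_eq0 /Q sqrf_eq0. Qed.

Lemma enormN x : enorm (- x) = enorm x.
Proof. by rewrite /enorm; under eq_bigr do rewrite mxE sqrrN. Qed.

Lemma KN x : K (- x) = K x.
Proof. by rewrite /K oppr_eq0 enormN. Qed.

Lemma measurable_Q : measurable_fun setT (Q : T -> R).
Proof.
rewrite (_ : (Q : T -> R) = fun x : T =>
  (\sum_(i < d) (x : 'rV[R]_d) ord0 i ^+ 2)%R); last first.
  by apply/funext => x; exact: Q_sum.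
by apply: measurable_sum => i; apply: measurable_funX; exact: measurable_coord.
Qed.

Lemma measurable_enorm : measurable_fun setT (@enorm R d : T -> R).
Proof.
rewrite (_ : @enorm R d = Num.sqrt \o Q)%R; last first.
  by apply/funext => x /=; rewrite /Q sqrtr_sqr ger0_norm// enorm_ge0.
apply: measurableT_comp measurable_Q.
by apply: continuous_measurable_fun; exact: sqrt_continuous.
Qed.

Lemma measurable_K : measurable_fun setT (K : T -> \bar R).
Proof.
apply: measurable_fun_ifT => //=.
  under eq_fun do rewrite -Q_eq0.
  by apply: measurable_fun_eqr => //; exact: measurable_Q.
have mi : measurable_fun setT (fun x : T => (enorm x)^-1%R).
  by apply: measurable_funVr; exact: measurable_enorm.
case: (d == 2%N); apply: measurableT_comp => //.
  by apply: measurableT_comp mi; exact: measurable_ln.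
by apply: measurable_funVr; apply: measurable_funX; exact: measurable_enorm.
Qed.

(** The external field is attached to both points of a pair, so that the growth of
    [Q] compensates the logarithm. *)
Definition weighted_kernel x y : \bar R := K (x - y)%R + (Q x + Q y)%:E.

Lemma weighted_kernel_sym x y : weighted_kernel x y = weighted_kernel y x.
Proof. by rewrite /weighted_kernel -KN opprB [(Q x + _)%R]addrC. Qed.

Lemma measurable_weighted_kernel :
  measurable_fun setT (fun u : T * T => weighted_kernel u.1 u.2).
Proof.
apply: emeasurable_funD.
  exact: (measurableT_comp (f := K : T -> \bar R)
    (g := fun u : T * T => (u.1 - u.2)%R : T) measurable_K measurable_subrV).
apply/measurable_EFinP; apply: measurable_funD.
  exact: (measurableT_comp (f := Q : T -> R)
    (g := fst : T * T -> T) measurable_Q).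
exact: (measurableT_comp (f := Q : T -> R)
    (g := snd : T * T -> T) measurable_Q).
Qed.

Lemma Q_sub x y : (Q (x - y) <= 2 * (Q x + Q y))%R.
Proof.
rewrite !Q_sum -big_split mulr_sumr; apply: ler_sum => i _.
by rewrite !mxE /=; have := sqr_ge0 (x ord0 i + y ord0 i)%R; nra.
Qed.

(** In the plane this is [ln t <= t - 1] at [t = Q x]; otherwise the kernel is
    itself nonnegative. *)
Lemma K_lb (w : R) x : (Q x <= 2 * w)%R -> 0 <= K x + w%:E.
Proof.
move=> xw; have w0 : (0 <= w)%R by have := Q_ge0 x; lra.
rewrite /K; case: eqP => [_|/eqP x0]; first by rewrite addye.
rewrite -enorm_gt0 in x0.
case: ifP => _; rewrite -EFinD lee_fin; last first.
  by rewrite addr_ge0// invr_ge0 exprn_ge0// ltW.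
rewrite lnV ?posrE//.
have Q0 : (0 < Q x)%R by rewrite exprn_gt0.
have h : (ln (Q x) <= Q x - 1)%R.
  by have := @le_ln1Dx R (Q x - 1); rewrite [(1 + _)%R]addrC subrK; apply; lra.
by rewrite /Q in xw h; rewrite lnXn// in h; lra.
Qed.

Lemma weighted_kernel_ge0 x y : 0 <= weighted_kernel x y.
Proof. by apply: K_lb; exact: Q_sub. Qed.

End kernel.

(** * Gaussian measures *)

Section normal.
Context {R : realType}.

Lemma integral_normal_prob (m s : R) (f : R -> \bar R) :
  measurable_fun setT f ->
  (\int[normal_prob m s]_x `|f x| < +oo)%E ->
  (\int[normal_prob m s]_x f x =
   \int[lebesgue_measure]_x (f x * (normal_pdf m s x)%:E))%E.
Proof.
move=> mf finf.
rewrite -(Radon_Nikodym_change_of_variables (normal_prob_dominates m s))//=; last first.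
  by apply/integrableP; split.
apply: ae_eq_integral => //.
- apply: emeasurable_funM => //; apply: (measurable_int lebesgue_measure).
  by apply: Radon_Nikodym_integrable; exact: normal_prob_dominates.
- apply: emeasurable_funM => //=; apply/measurableT_comp => //=.
  exact: measurable_normal_pdf.
- apply: ae_eqe_mul2l => /=.
  rewrite Radon_NikodymE//=; first exact: normal_prob_dominates.
  move=> abmu.
  case: cid => /= h [h1 h2 h3].
  apply: integral_ae_eq => //=.
  + by apply/measurableT_comp =>//; exact: measurable_normal_pdf.
  + by move=> E E01 mE; rewrite -h3.
Qed.

(** The normal density of variance [v / 2], up to the factor [sqrt pi]. *)
Definition bell (v x : R) : R := ((Num.sqrt v)^-1 * expR (- (x ^+ 2 / v)))%R.

Lemma bell_ge0 v x : (0 <= bell v x)%R.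
Proof. by rewrite mulr_ge0 ?expR_ge0// invr_ge0 sqrtr_ge0. Qed.

Lemma measurable_bell v : measurable_fun setT (bell v).
Proof.
apply: measurable_funM => //; apply: measurableT_comp => //.
by apply: measurable_funN; apply: measurable_funM.
Qed.

(** Variances add up under convolution. Completing the square, the product of the
    two factors is a constant times the normal density of mean [m] and standard
    deviation [s'] of the proof. *)
Lemma bell_normal (s v x : R) : (0 < s)%R -> (0 < v)%R ->
  \int[normal_prob 0 s]_z (bell v (x + z))%:E = (bell (v + 2 * s ^+ 2) x)%:E.
Proof.
move=> s0 v0.
have mf : measurable_fun setT (fun z => (bell v (x + z))%:E).
  apply/measurable_EFinP;apply: measurableT_comp (measurable_bell v) _.
  exact: measurable_funD.
rewrite integral_normal_prob//; last first.
  apply: (@le_lt_trans _ _ (\int[normal_prob 0 s]_z ((Num.sqrt v)^-1)%:E)).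
    apply: ge0_le_integral => //.
    + exact: measurableT_comp.
    + move=> z _; rewrite gee0_abs ?lee_fin ?bell_ge0//.
      rewrite ler_piMr ?invr_ge0 ?sqrtr_ge0// -expR0 ler_expR oppr_le0.
      by rewrite divr_ge0 ?sqr_ge0// ltW.
  by rewrite integral_cst//= probability_setT mule1 ltry.
have [S SE] : exists S, (S = 2 * s ^+ 2)%R by exists (2 * s ^+ 2)%R.
rewrite -SE.
have S0 : (0 < S)%R by rewrite SE mulr_gt0 ?exprn_gt0.
pose tau := (v * S / (v + S))%R.
have vS0 : (0 < v + S)%R by rewrite addr_gt0.
have tau0 : (0 < tau)%R by rewrite divr_gt0 ?mulr_gt0.
pose m := (- x * S / (v + S))%R.
pose s' := Num.sqrt (tau / 2).
have s'0 : (0 < s')%R by rewrite sqrtr_gt0 divr_gt0.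
have s'E : (s' ^+ 2 = tau / 2)%R by rewrite sqr_sqrtr// divr_ge0// ltW.
transitivity (\int[lebesgue_measure]_z
   ((bell (v + S) x)%:E * (normal_pdf m s' z)%:E)); last first.
  rewrite ge0_integralZl//=.
  - by rewrite integral_normal_pdf mule1.
  - by apply/measurable_EFinP; exact: measurable_normal_pdf.
  - by move=> z _; rewrite lee_fin normal_pdf_ge0.
  - by rewrite lee_fin bell_ge0.
apply: eq_integral => z _; rewrite -EFinM; congr EFin.
rewrite !normal_pdfE ?gt_eqF// /normal_peak /normal_fun.
rewrite s'E.
have -> : (s ^+ 2 = S / 2)%R by rewrite SE; field.
rewrite /bell subr0 mulrACA [RHS]mulrACA -!expRD; congr (_ * expR _)%R.
  rewrite -!invfM; congr (_^-1)%R.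
  rewrite -!sqrtrM ?ltW//; congr Num.sqrt; rewrite /tau; field.
  by rewrite gt_eqF.
by rewrite /m /tau; field; rewrite !gt_eqF.
Qed.

End normal.

Section gaussian.
Context {R : realType} {d : nat}.
Notation T := (borelRd R d).
Implicit Types (x y z : 'rV[R]_d).

Lemma convolution_probability (P1 P2 : probRd R d) :
  exists P : probRd R d, forall f : T -> \bar R,
    (forall x, 0 <= f x) -> measurable_fun setT f ->
    \int[P]_x f x = \int[P1]_x \int[P2]_z f (x + z)%R.
Proof.
have [P PE] := map_probability (P1 \x P2)%E (@measurable_addrV R d).
exists P => f f0 mf.
rewrite PE// (@fubini_tonelli1 _ _ _ _ _ P1 P2 (fun u => f (u.1 + u.2)%R))//.
exact: (measurableT_comp (f := f)
  (g := fun u : T * T => (u.1 + u.2)%R : T) mf (@measurable_addrV R d)).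
Qed.

Lemma gaussian_axis (s : R) (j : 'I_d) :
  exists P : probRd R d, forall f : T -> \bar R,
    (forall x, 0 <= f x) -> measurable_fun setT f ->
    \int[P]_x f x = \int[normal_prob 0 s]_t f (t *: delta_mx ord0 j)%R.
Proof.
pose g (t : R) : T := (t *: delta_mx ord0 j)%R.
have mg : measurable_fun setT g.
  apply: measurable_coords => i.
  under eq_fun do rewrite !mxE.
  exact: measurable_funM.
have [P PE] := map_probability (normal_prob 0 s) mg.
by exists P.
Qed.

(** The coordinates listed in [l] are those that have already been smoothed. *)
Let bell_prod (v S : R) (l : seq 'I_d) x : R :=
  (\prod_(i < d) bell (if i \in l then v + S else v) (x ord0 i))%R.

Lemma measurable_bell_prod v S l : measurable_fun setT (bell_prod v S l : T -> R).
Proof.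
apply: measurable_prod => i _.
exact: (measurableT_comp (f := bell _) (measurable_bell _) (measurable_coord i)).
Qed.

Lemma bell_prod_ge0 v S l x : (0 <= bell_prod v S l x)%R.
Proof. by apply: prodr_ge0 => i _; exact: bell_ge0. Qed.

(** The Gaussian vector is built one coordinate at a time, by convolution with
    normal laws carried by the axes. *)
Lemma gaussian_vector_on (S : R) (l : seq 'I_d) : (0 < S)%R -> uniq l ->
  exists P : probRd R d, forall v x, (0 < v)%R ->
    \int[P]_z (bell_prod v S [::] (x + z)%R)%:E = (bell_prod v S l x)%:E.
Proof.
move=> S0; elim: l => [_|j l IH /= /andP[jl ul]].
  exists (dirac (0%R : T)) => v x v0; rewrite integral_dirac//=.
    by rewrite addr0 diracT mul1e.
  apply/measurable_EFinP.
  exact: (measurableT_comp (f := bell_prod v S [::] : T -> R)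
    (g := fun u : T => (x + u)%R : T) (measurable_bell_prod _ _ _) (measurable_addcV x)).
have [P PE] := IH ul.
pose s := Num.sqrt (S / 2).
have s0 : (0 < s)%R by rewrite sqrtr_gt0 divr_gt0.
have sE : (2 * s ^+ 2 = S)%R by rewrite sqr_sqrtr ?divr_ge0// ?ltW//; field.
have [P1 P1E] := gaussian_axis s j.
have [P' P'E] := convolution_probability P1 P.
have mshift v l' y : measurable_fun setT (fun z : T => (bell_prod v S l' (y + z)%R)%:E).
  apply/measurable_EFinP.
  exact: (measurableT_comp (f := bell_prod v S l' : T -> R)
    (g := fun u : T => (y + u)%R : T) (measurable_bell_prod _ _ _) (measurable_addcV y)).
exists P' => v x v0.
rewrite P'E//; last by move=> y; rewrite lee_fin bell_prod_ge0.
under eq_integral do under eq_integral do rewrite addrA.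
under eq_integral do rewrite PE//.
rewrite P1E//; last by move=> y; rewrite lee_fin bell_prod_ge0.
pose c := (\prod_(i < d | i != j) bell (if i \in l then v + S else v) (x ord0 i))%R.
have c0 : (0 <= c)%R by apply: prodr_ge0 => i _; exact: bell_ge0.
transitivity (\int[normal_prob 0 s]_t (c%:E * (bell v (x ord0 j + t))%:E)).
  apply: eq_integral => t _; rewrite -EFinM; congr EFin.
  rewrite /bell_prod (bigD1 j)//= (negbTE jl) !mxE !eqxx mulr1 mulrC; congr (_ * _)%R.
  apply: eq_bigr => i ij; rewrite !mxE eqxx/= (negbTE ij) mulr0 addr0//.
rewrite ge0_integralZl//=; first last.
- by move=> t _; rewrite lee_fin bell_ge0.
- apply/measurable_EFinP; apply: measurableT_comp (measurable_bell v) _.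
  exact: measurable_funD.
rewrite bell_normal// sE -EFinM; congr EFin.
rewrite /bell_prod [RHS](bigD1 j)//= inE eqxx mulrC; congr (_ * _)%R.
by apply: eq_bigr => i ij; rewrite inE (negbTE ij).
Qed.

(** The heat kernel at time [v / 4] and squared distance [w], up to the factor
    [pi ^ (d / 2)]. *)
Definition heat_kernel (v w : R) : R := ((Num.sqrt v)^-1 ^+ d * expR (- (w / v)))%R.

Lemma bell_prodE v S x : bell_prod v S [::] x = heat_kernel v (Q x).
Proof.
rewrite /bell_prod /heat_kernel /bell big_split /= prodr_const card_ord -expR_sum;
  congr (_ * expR _)%R.
by rewrite Q_sum sumrN mulr_suml.
Qed.

(** The centred Gaussian law with independent coordinates of variance [S / 2]
    enters only through this semigroup property of the heat kernel. *)
Definition gaussian_of (S : R) (gam : probRd R d) := forall v x, (0 < v)%R ->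
  \int[gam]_z (heat_kernel v (Q (x + z)%R))%:E = (heat_kernel (v + S) (Q x))%:E.

Lemma gaussian_vector (S : R) : (0 < S)%R ->
  exists gam : probRd R d, gaussian_of S gam.
Proof.
move=> S0; have [P PE] := gaussian_vector_on S0 (enum_uniq 'I_d).
exists P => v x v0; rewrite -(bell_prodE (v + S) S).
under eq_integral do rewrite -(bell_prodE v S).
rewrite PE//; congr EFin; apply: eq_bigr => i _.
by rewrite mem_enum.
Qed.

End gaussian.

(** * Time integrals of the heat kernel *)

Section lebesgue_affine.
Context {R : realType}.
Notation mu := (@lebesgue_measure R).

(** The counterpart of [map_probability] for infinite measures. *)
Lemma map_measure d1 d2 (T1 : measurableType d1) (T2 : measurableType d2)
    (m : {measure set T1 -> \bar R}) (f : T1 -> T2) : measurable_fun setT f ->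
  exists m' : {measure set T2 -> \bar R},
    (forall A, m' A = m (f @^-1` A)) /\
    forall A (h : T2 -> \bar R), measurable A -> measurable_fun setT h ->
      (forall y, 0 <= h y) ->
      \int[m']_(y in A) h y = \int[m]_(x in f @^-1` A) h (f x).
Proof.
move=> mf; unshelve eexists (pushforward m f); first exact: mf.
split=> // A h mA mh h0.
rewrite -(ge0_integral_pushforward mf m mA (f := h))//; exact: measurable_funTS.
Qed.

(** A translate of the Lebesgue measure gives the same mass to half-open
    intervals, which determine it. *)
Lemma integral_shift (S : R) (A : set R) (f : R -> \bar R) :
  measurable A -> measurable_fun setT f -> (forall v, 0 <= f v) ->
  \int[mu]_(v in (fun v : R => v + S)%R @^-1` A) f (v + S)%R =
  \int[mu]_(v in A) f v.
Proof.
move=> mA mf f0.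
have mS : measurable_fun setT (fun v : measurableTypeR R => v + S : measurableTypeR R)%R.
  exact: measurable_funD.
have [m [mE mint]] := map_measure mu mS.
rewrite -mint//; apply: eq_measure_integral => B mB _; apply: esym.
apply: lebesgue_measure_unique mB => _ [[a b]] _ <-.
rewrite mE (_ : _ @^-1` _ = `](a - S)%R, (b - S)%R]%classic).
  rewrite lebesgue_measure_itv/= [RHS]lebesgue_measure_itv/= !lte_fin ltrD2r.
  case: ifP => // _.
  by rewrite -!EFinB; congr EFin; ring.
by apply/seteqP; split => v /=; rewrite !in_itv/= => vab; lra.
Qed.

Lemma integral_scale (c : R) (A : set R) (f : R -> \bar R) : (0 < c)%R ->
  measurable A -> measurable_fun setT f -> (forall v, 0 <= f v) ->
  c%:E * \int[mu]_(v in (fun v : R => c * v)%R @^-1` A) f (c * v)%R =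
  \int[mu]_(v in A) f v.
Proof.
move=> c0 mA mf f0.
have mc : measurable_fun setT (fun v : measurableTypeR R => c * v : measurableTypeR R)%R.
  exact: measurable_funM.
have [m [mE mint]] := map_measure mu mc.
rewrite -mint// -[c%:E]/((NngNum (ltW c0))%:num%:E) -ge0_integral_mscale//; last first.
  exact: measurable_funTS.
apply: eq_measure_integral => B mB _; apply: esym.
apply: lebesgue_measure_unique mB => _ [[a b]] _ <-.
rewrite /= /mscale /= mE (_ : _ @^-1` _ = `](a / c)%R, (b / c)%R]%classic).
  rewrite lebesgue_measure_itv/= [X in _ = _ * X]lebesgue_measure_itv/= !lte_fin
    ltr_pM2r ?invr_gt0//.
  case: ifP => // _; last by rewrite mule0.
  by rewrite -!EFinB -EFinM; congr EFin; field; rewrite gt_eqF.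
apply/seteqP; split => v /=; rewrite !in_itv/=;
  by rewrite ltr_pdivrMr// ler_pdivlMr// [(v * c)%R]mulrC.
Qed.

End lebesgue_affine.

Section heat.
Context {R : realType} {d : nat}.
Notation mu := (@lebesgue_measure R).
Local Notation g := (@heat_kernel R d).
Notation T := (borelRd R d).

Lemma heat_kernel_ge0 v w : (0 <= g v w)%R.
Proof. by rewrite mulr_ge0 ?expR_ge0// exprn_ge0// invr_ge0 sqrtr_ge0. Qed.

Lemma measurable_heat_kernel : measurable_fun setT (fun u : R * R => g u.1 u.2).
Proof.
have m1 : measurable_fun setT (fst : R * R -> R) by [].
have m2 : measurable_fun setT (snd : R * R -> R) by [].
apply: measurable_funM.
  apply: measurable_funX; apply: measurable_funVr.
  apply: (measurableT_comp (f := @Num.sqrt R) (g := fst : R * R -> R)) => //.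
  by apply: continuous_measurable_fun; exact: sqrt_continuous.
apply: measurableT_comp => //; apply: measurable_funN.
by apply: measurable_funM => //; exact: measurable_funVr.
Qed.

Lemma measurable_heat_kernel_time w : measurable_fun setT (g ^~ w).
Proof.
exact: (measurableT_comp (f := fun u : R * R => g u.1 u.2) (g := fun v => (v, w))
  measurable_heat_kernel).
Qed.

Lemma ler_heat_kernel v w w' : (0 <= v)%R -> (w <= w')%R -> (g v w' <= g v w)%R.
Proof.
move=> v0 ww'; rewrite ler_wpM2l ?exprn_ge0 ?invr_ge0 ?sqrtr_ge0//.
by rewrite ler_expR lerN2 ler_wpM2r// invr_ge0.
Qed.

(** Over [A = ]0, +oo[] this is, at [w = |x| ^ 2], a multiple of [|x| ^ (2 - d)]
    if [d >= 3]; if [d = 2] the integral diverges, and over [A = ]0, N]] it is a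
    logarithm up to a constant depending on [N] and an error that tends to [0]. *)
Definition heat (A : set R) (w : R) : \bar R := \int[mu]_(v in A) (g v w)%:E.

Lemma heat_ge0 A w : 0 <= heat A w.
Proof. by apply: integral_ge0 => v _; rewrite lee_fin heat_kernel_ge0. Qed.

Lemma le_heat (A : set R) (w w' : R) : measurable A -> (forall v, A v -> 0 <= v)%R ->
  (w <= w')%R -> heat A w' <= heat A w.
Proof.
move=> mA A0 ww'; apply: ge0_le_integral => //.
- by move=> v _; rewrite lee_fin heat_kernel_ge0.
- by apply/measurable_EFinP; apply: measurable_funTS; exact: measurable_heat_kernel_time.
- by apply/measurable_EFinP; apply: measurable_funTS; exact: measurable_heat_kernel_time.
- by move=> v /A0 v0; rewrite lee_fin ler_heat_kernel.
Qed.

Lemma heatU (A B : set R) w : measurable A -> measurable B -> [disjoint A & B] ->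
  heat (A `|` B) w = heat A w + heat B w.
Proof.
move=> mA mB AB; rewrite /heat ge0_integral_setU//.
- by apply/measurable_EFinP; apply: measurable_funTS; exact: measurable_heat_kernel_time.
- by move=> v _; rewrite lee_fin heat_kernel_ge0.
Qed.

(** The change of variable [v = w u] in time. *)
Lemma heat_scale (A : set R) w : measurable A -> (0 < w)%R ->
  heat A w = (w * (Num.sqrt w)^-1 ^+ d)%:E * heat ((fun v : R => w * v)%R @^-1` A) 1.
Proof.
move=> mA w0; rewrite /heat -(integral_scale w0 mA); last 2 first.
- by apply/measurable_EFinP; exact: measurable_heat_kernel_time.
- by move=> v; rewrite lee_fin heat_kernel_ge0.
rewrite EFinM -muleA; congr (_ * _).
rewrite -ge0_integralZl//=; last 3 first.
- by rewrite -[X in measurable X]setTI; exact: measurable_funM.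
- by apply/measurable_EFinP; apply: measurable_funTS; exact: measurable_heat_kernel_time.
- by move=> v _; rewrite lee_fin heat_kernel_ge0.
apply: eq_integral => v _; rewrite -EFinM; congr EFin.
rewrite /g sqrtrM ?ltW// invfM exprMn mulrA; congr (_ * expR (- _))%R.
by rewrite invfM mulrA divff ?gt_eqF.
Qed.

(** The semigroup property integrated in time: averaging over the Gaussian
    moves the time interval by [S]. An interval starting at [0] thus loses
    [`]0, S]]. *)
Lemma heat_average (gam : probRd R d) (S : R) : gaussian_of S gam ->
  forall (A : set R) x, measurable A -> (forall v, A v -> 0 < v)%R ->
  \int[gam]_z heat A (Q (x + z)%R) = heat ((fun v : R => v - S)%R @^-1` A) (Q x).
Proof.
move=> gamP A x mA A0.
have mAS : measurable ((fun v : R => v - S)%R @^-1` A).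
  by rewrite -[X in measurable X]setTI; exact: measurable_funB.
transitivity (\int[gam]_z \int[mu]_v ((EFin \o g ^~ (Q (x + z)%R)) \_ A) v).
  by apply: eq_integral => z _; rewrite /heat integral_mkcond.
rewrite (@fubini_tonelli _ _ _ _ _ gam mu
  (fun u => ((EFin \o g ^~ (Q (x + u.1)%R)) \_ A) u.2)); last 2 first.
- rewrite (_ : (fun u => _) =
      (fun u : T * R => (g u.2 (Q (x + u.1)%R) * \1_A u.2)%:E)); last first.
    apply/funext => u; rewrite /patch indicE.
    by case: ifP => _ /=; rewrite ?mulr1 ?mulr0.
  apply/measurable_EFinP; apply: measurable_funM.
    apply: (measurableT_comp (f := fun u : R * R => g u.1 u.2)
      (g := fun u : T * R => (u.2, Q (x + u.1)%R)) measurable_heat_kernel).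
    apply: measurable_fun_pair => //.
    apply: (measurableT_comp (f := Q : T -> R)
      (g := fun u : T * R => (x + u.1)%R : T) (@measurable_Q R d)).
    exact: (measurableT_comp (f := fun u : T => (x + u)%R : T)
      (g := fst : T * R -> T) (measurable_addcV x)).
  have mi : measurable_fun setT (\1_A : measurableTypeR R -> R).
    exact: measurable_indic.
  exact: (measurableT_comp (g := snd : T * measurableTypeR R -> measurableTypeR R) mi).
- move=> u; rewrite /patch; case: ifP => //= _; rewrite lee_fin heat_kernel_ge0//.
rewrite /heat -(@integral_shift _ S); last 3 first.
- done.
- by apply/measurable_EFinP; exact: measurable_heat_kernel_time.
- by move=> v; rewrite lee_fin heat_kernel_ge0.
rewrite (_ : _ @^-1` _ = A); last first.
  by apply/seteqP; split => v /=; rewrite addrK.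
rewrite [RHS]integral_mkcond; apply: eq_integral => v _.
rewrite /patch; case: ifPn => vA; last by rewrite integral0_eq.
rewrite -gamP//; apply: A0; rewrite inE// in vA.
Qed.

End heat.

Section heat_bounds.
Context {R : realType} {d : nat}.
Notation mu := (@lebesgue_measure R).
Local Notation g := (@heat_kernel R d).
Local Notation heat := (@heat R d).
Notation T := (borelRd R d).

Lemma heat_le_cst (A : set R) (w c : R) : measurable A ->
  (forall v, A v -> g v w <= c)%R -> heat A w <= c%:E * mu A.
Proof.
move=> mA gc; rewrite -integral_cst//; apply: ge0_le_integral => //.
- by move=> v _; rewrite lee_fin heat_kernel_ge0.
by apply/measurable_EFinP; apply: measurable_funTS; exact: measurable_heat_kernel_time.
Qed.

Lemma heat_ge_cst (A : set R) (w c : R) : measurable A -> (0 <= c)%R ->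
  (forall v, A v -> c <= g v w)%R -> c%:E * mu A <= heat A w.
Proof.
move=> mA c0 gc; rewrite -integral_cst//; apply: ge0_le_integral => //.
by apply/measurable_EFinP; apply: measurable_funTS; exact: measurable_heat_kernel_time.
Qed.

Lemma ler_sqrtVX (a b : R) n : (0 < a)%R -> (a <= b)%R ->
  ((Num.sqrt b)^-1 ^+ n <= (Num.sqrt a)^-1 ^+ n)%R.
Proof.
move=> a0 ab; have b0 : (0 < b)%R by apply: lt_le_trans ab.
rewrite lerXn2r ?nnegrE ?invr_ge0 ?sqrtr_ge0//.
by rewrite lef_pV2 ?posrE ?sqrtr_gt0// ler_sqrt// ltW.
Qed.

(** For times in the second half of [`]0, S]], both [v] and [S] are of the same
    order and the exponent [w / v] is at most [2]. *)
Lemma heat_gain (S w : R) : (0 < S)%R -> (w <= S)%R ->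
  ((S / 2) * ((Num.sqrt S)^-1 ^+ d * expR (- 2)))%:E <= heat `]0%R, S] w.
Proof.
move=> S0 wS.
have mA : measurable `](S / 2)%R, S]%classic by [].
apply: (@le_trans _ _ (heat `](S / 2)%R, S] w)); last first.
  apply: ge0_subset_integral => //=.
  - by apply/measurable_EFinP; apply: measurable_funTS; exact:
    measurable_heat_kernel_time.
  - by move=> v _; rewrite lee_fin heat_kernel_ge0.
  - by move=> v /=; rewrite !in_itv/= => vS; lra.
pose c := ((Num.sqrt S)^-1 ^+ d * expR (- 2))%R.
apply: (le_trans _ (@heat_ge_cst _ _ c mA _ _)).
- rewrite lebesgue_measure_itv/= lte_fin ifT; last lra.
  by rewrite -EFinB -EFinM lee_fin -/c mulrC; nra.
- by rewrite mulr_ge0 ?expR_ge0// exprn_ge0// invr_ge0 sqrtr_ge0.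
- move=> v /=; rewrite in_itv/= => vS.
  have v0 : (0 < v)%R by lra.
  rewrite ler_pM ?expR_ge0 ?exprn_ge0 ?invr_ge0 ?sqrtr_ge0//.
    by apply: ler_sqrtVX => //; lra.
  by rewrite ler_expR lerN2 ler_pdivrMr//; lra.
Qed.

Lemma heat_itvU (a b c w : R) : (a <= b)%R -> (b <= c)%R ->
  heat `]a, c] w = heat `]a, b] w + heat `]b, c] w.
Proof.
move=> ab bc; rewrite -heatU//; last first.
  apply/disj_set2P/seteqP; split => // v [] /=; rewrite !in_itv/= => *; lra.
congr heat; apply/seteqP; split => v /=; rewrite !in_itv/=.
  by move=> vac; have [vb|vb] := lerP v b; [left|right]; lra.
by move=> [] *; lra.
Qed.

Lemma integral_itv_inv (a b : R) : (0 < a)%R -> (a <= b)%R ->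
  \int[mu]_(v in `]a, b]) (v^-1)%:E = (ln b - ln a)%:E.
Proof.
rewrite le_eqVlt => a0 /predU1P[->|ab].
  by rewrite set_itv_ge ?bnd_simp -?leNgt// integral_set0 subrr.
rewrite integral_itv_obnd_cbnd; last first.
  apply/measurable_EFinP; apply: measurable_funTS.
  exact: measurable_funVr.
have pos v : (a <= v)%R -> (0 < v)%R by move=> av; apply: lt_le_trans av.
rewrite (continuous_FTC2 ab (F := @ln R))//.
- apply: continuous_in_subspaceT => v; rewrite inE/= in_itv/= => /andP[av _].
  by apply: (@cvgV R R); [rewrite gt_eqF ?pos|exact: cvg_id].
- split.
  + move=> v; rewrite in_itv/= => /andP[/ltW av _].
    by apply: ex_derive; apply: is_derive1_ln; exact: pos.
  + by apply: cvg_at_right_filter; apply: continuous_ln.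
  + by apply: cvg_at_left_filter; apply: continuous_ln; apply: pos; exact: ltW.
- move=> v; rewrite in_itv/= => /andP[/ltW av _].
  by rewrite derive1E; apply: derive_val; apply: is_derive1_ln; exact: pos.
Qed.

End heat_bounds.

(** * The kernel as a time integral of the heat kernel *)

Lemma ler_add_divn {R : realType} (x y c : R) :
  (forall N, 0 < N -> x <= y + c / N)%R -> (x <= y)%R.
Proof.
move=> h; apply/ler_addgt0Pr => e e0.
have [c0|c0] := lerP c 0%R.
  by have := h 1%R ltr01; lra.
have := h (c / e)%R (divr_gt0 c0 e0).
by rewrite invf_div mulrCA divff ?gt_eqF// mulr1.
Qed.

Section planar.
Context {R : realType} {d : nat} (d2 : d = 2%N).
Notation mu := (@lebesgue_measure R).
Local Notation g := (@heat_kernel R d).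
Local Notation heat := (@heat R d).
Notation T := (borelRd R d).

Lemma heat_kernel_planar v w : (0 <= v)%R -> (g v w = v^-1 * expR (- (w / v)))%R.
Proof. by move=> v0; rewrite /g d2 exprVn sqr_sqrtr. Qed.

(** [exp (1 / v) >= 1 / v] controls the singularity at time [0]. *)
Lemma heat_planar_lty (N : R) : (0 < N)%R -> heat `]0%R, N] 1 \is a fin_num.
Proof.
move=> N0; rewrite ge0_fin_numE ?heat_ge0//.
apply: (@le_lt_trans _ _ (1%:E * mu `]0%R, N]%classic)).
  apply: heat_le_cst => // v /=; rewrite in_itv/= => /andP[v0 _].
  rewrite (heat_kernel_planar _ (ltW v0)) expRN -invfM invf_le1 ?mulr_gt0 ?expR_gt0//.
  rewrite -[leLHS](divff (lt0r_neq0 v0)) ler_pM2l//.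
  apply: le_trans (expR_ge1Dx _).
  by rewrite mul1r lerDr.
by rewrite mul1e lebesgue_measure_itv/=; case: ifP => _; rewrite ?ltry// -EFinB ltry.
Qed.

(** The time integral at distance one, cut off at [N]; it grows like [ln N] and
    renormalizes the divergent planar integral. *)
Definition theta (N : R) : R := fine (heat `]0%R, N] 1).

Lemma thetaK N : (0 < N)%R -> heat `]0%R, N] 1 = (theta N)%:E.
Proof. by move=> N0; rewrite /theta fineK// heat_planar_lty. Qed.

(** In the plane the time integral is scale invariant. *)
Lemma heat_planar (N w : R) : (0 < N)%R -> (0 < w)%R ->
  heat `]0%R, N] w = (theta (N / w))%:E.
Proof.
move=> N0 w0.
have w1 : (w * (Num.sqrt w)^-1 ^+ d = 1)%R.
  by rewrite d2 exprVn sqr_sqrtr ?ltW// divff ?gt_eqF.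
rewrite heat_scale// w1 mul1e -thetaK ?divr_gt0//; congr heat.
apply/seteqP; split => v /=; rewrite !in_itv/= pmulr_rgt0//;
  by rewrite ler_pdivlMr// mulrC.
Qed.

(** [theta N - theta (N / w)] is the integral of [exp (- 1 / v) / v] between
    [N / w] and [N]. The first factor is monotone, hence compares with its value at
    [N] in the direction required by the sign of [ln w], and [1 / v] integrates to
    [ln w]. *)
Lemma theta_log (N w : R) : (0 < N)%R -> (0 < w)%R ->
  (theta N <= theta (N / w) + expR (- N^-1) * ln w)%R.
Proof.
move=> N0 w0.
have Nw0 : (0 < N / w)%R by rewrite divr_gt0.
have lnNw : (ln (N / w) = ln N - ln w)%R by rewrite lnM ?posrE ?invr_gt0// lnV ?posrE.
have mg a b : measurable_fun (`]a, b] : set R) (fun v => (expR (- N^-1) * v^-1)%:E).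
  apply/measurable_EFinP; apply: measurable_funTS.
  by apply: measurable_funM => //; exact: measurable_funVr.
have mh a b : measurable_fun (`]a, b] : set R) (fun v => (g v 1)%:E).
  by apply/measurable_EFinP; apply: measurable_funTS; exact: measurable_heat_kernel_time.
have step a b : (0 < a)%R -> (a <= b)%R ->
    \int[mu]_(v in `]a, b]) (expR (- N^-1) * v^-1)%:E
      = (expR (- N^-1) * (ln b - ln a))%:E.
  move=> a0 ab; under eq_integral do rewrite EFinM.
  rewrite ge0_integralZl//=.
  - by rewrite integral_itv_inv// EFinM.
  - apply/measurable_EFinP; apply: measurable_funTS; exact: measurable_funVr.
  - move=> v; rewrite in_itv/= => vab; rewrite lee_fin invr_ge0; lra.
have ge0 a b v : (0 < a)%R -> v \in `]a, b] -> (0 <= expR (- N^-1) * v^-1)%R.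
  move=> a0; rewrite in_itv/= => vab.
  by rewrite mulr_ge0 ?expR_ge0// invr_ge0; lra.
have [NNw|NwN] := lerP N (N / w)%R.
  have := @heat_itvU R d 0 N (N / w) 1 (ltW N0) NNw.
  rewrite !thetaK//.
  have : \int[mu]_(v in `]N, (N / w)%R]) (expR (- N^-1) * v^-1)%:E <=
    heat `]N, (N / w)%R] 1.
    apply: ge0_le_integral => //.
    - by move=> v; apply: ge0.
    - exact: mg.
    - exact: mh.
    - move=> v /=; rewrite in_itv/= => vN.
      have v0 : (0 < v)%R by lra.
      rewrite lee_fin (heat_kernel_planar _ (ltW v0)) mulrC ler_pM2l ?invr_gt0//.
      rewrite ler_expR lerN2 mul1r lef_pV2 ?posrE//; lra.
  rewrite step// lnNw => + E.
  case: (heat `]N, (N / w)%R] 1) E => [r| |]; rewrite ?addey ?addeNy// => -[->].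
  by rewrite lee_fin; lra.
have := @heat_itvU R d 0 (N / w) N 1 (ltW Nw0) (ltW NwN).
rewrite !thetaK//.
have : heat `](N / w)%R, N] 1 <= \int[mu]_(v in `](N / w)%R, N])
  (expR (- N^-1) * v^-1)%:E.
  apply: ge0_le_integral => //.
  - by move=> v _; rewrite lee_fin heat_kernel_ge0.
  - exact: mh.
  - exact: mg.
  - move=> v /=; rewrite in_itv/= => vN.
    have v0 : (0 < v)%R by lra.
    rewrite lee_fin (heat_kernel_planar _ (ltW v0)) mulrC ler_pM2r ?invr_gt0//.
    rewrite ler_expR lerN2 mul1r lef_pV2 ?posrE//; lra.
rewrite step ?(ltW NwN)// lnNw => + E.
case: (heat `](N / w)%R, N] 1) E => [r| |]; rewrite ?addey ?addeNy// => -[->].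
by rewrite lee_fin; lra.
Qed.

Lemma K_planar (x : 'rV[R]_d) : x != 0%R -> K x = (- (ln (Q x) / 2))%:E.
Proof.
move=> x0; rewrite /K (negbTE x0) (introT eqP d2).
have e0 : (0 < enorm x)%R by rewrite enorm_gt0.
by rewrite lnV ?posrE// /Q lnXn//; congr EFin; field.
Qed.

End planar.

Section spatial.
Context {R : realType} {d : nat} (d3 : (2 < d)%N).
Notation mu := (@lebesgue_measure R).
Local Notation g := (@heat_kernel R d).
Local Notation heat := (@heat R d).
Notation T := (borelRd R d).

Let cvg_sqrtV : ((Num.sqrt v)^-1 @[v --> +oo] --> (0 : R))%R.
Proof.
apply/cvgrPdist_le => e e0.
near=> v.
have v0 : (e^-1 ^+ 2 <= v)%R by near: v; apply: nbhs_pinfty_ge; exact: num_real.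
rewrite sub0r normrN ger0_norm ?invr_ge0 ?sqrtr_ge0//.
rewrite -[leRHS]invrK lef_pV2 ?posrE ?invr_gt0//.
  have ei : (0 <= e^-1)%R by rewrite invr_ge0 ltW.
  by rewrite -[leLHS]ger0_norm// -sqrtr_sqr ler_wsqrtr.
by rewrite sqrtr_gt0 (lt_le_trans _ v0)// exprn_gt0// invr_gt0.
Unshelve. all: by end_near. Qed.

Let tail_lty : \int[mu]_(v in `[1%R, +oo[) ((Num.sqrt v)^-1 ^+ 3)%:E < +oo.
Proof.
pose F (v : R) := (- 2 * (Num.sqrt v)^-1)%R.
have dF (v : R) : (0 < v)%R -> is_derive v (1%R : R) F ((Num.sqrt v)^-1 ^+ 3)%R.
  move=> v0.
  have s0 : Num.sqrt v != 0%R by rewrite gt_eqF// sqrtr_gt0.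
  have h := is_derive1_sqrt v0.
  have h2 := @is_deriveV R (@Num.sqrt R) v _ 1%R s0 h.
  have h3 := @is_deriveZ R R R _ (-2)%R v 1%R _ h2.
  apply: (is_derive_eq h3).
  by rewrite /GRing.scale /=; field.
have cF (v : R) : (0 < v)%R -> {for v, continuous F}.
  move=> v0; apply/differentiable_continuous/derivable1_diffP.
  by apply: ex_derive; exact: dF.
rewrite (@ge0_continuous_FTC2y R _ F 1%R 0%R).
- by rewrite sub0e -EFinN ltry.
- by move=> v _; rewrite exprn_ge0// invr_ge0 sqrtr_ge0.
- apply: continuous_in_subspaceT => v; rewrite inE/= in_itv/= andbT => v1.
  have v0 : (0 < v)%R by apply: lt_le_trans v1.
  apply: (@continuous_comp _ _ _ (fun v => (Num.sqrt v)^-1)%R (fun x => x ^+ 3)%R);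
    last exact: exprn_continuous.
  by apply: cvgV; [rewrite gt_eqF// sqrtr_gt0|exact: sqrt_continuous].
- rewrite -[X in _ --> X](mulr0 (-2)%R); apply: cvgM; [exact: cvg_cst|exact: cvg_sqrtV].
- by move=> v v1; apply: ex_derive; apply: dF; apply: lt_trans v1.
- by apply: cvg_at_right_filter; apply: cF.
- move=> v; rewrite in_itv/= andbT => v1; rewrite derive1E; apply: derive_val.
  by apply: dF; apply: lt_trans v1.
Qed.

Let heat0y w : heat `]0%R, +oo[ w = heat `]0%R, 1%R] w + heat `]1%R, +oo[ w.
Proof.
rewrite -heatU//; last first.
  apply/disj_set2P/seteqP; split => // v [] /=; rewrite !in_itv/= !andbT => *; lra.
congr heat; apply/seteqP; split => v /=; rewrite !in_itv/= !andbT.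
  by move=> vac; have [vb|vb] := lerP v 1; [left|right]; lra.
by move=> [] *; lra.
Qed.

(** At small times the exponential beats the power, by
    [exp (y ^+ 2) >= y ^+ (2 * d) / d`!]; at large times the integrand is at most
    [v ^ (- 3 / 2)]. *)
Lemma heat_spatial_lty : heat `]0%R, +oo[ 1 \is a fin_num.
Proof.
rewrite ge0_fin_numE ?heat_ge0// heat0y lte_add_pinfty//.
  apply: (@le_lt_trans _ _ ((d`!%:R)%:E * mu `]0%R, 1%R]%classic)).
    apply: heat_le_cst => // v /=; rewrite in_itv/= => /andP[v0 v1].
    rewrite /g expRN ler_pdivrMr ?expR_gt0// mul1r.
    pose y := (Num.sqrt v)^-1%R.
    have y2 : (v^-1 = y ^+ 2)%R by rewrite exprVn sqr_sqrtr// ltW.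
    have y1 : (1 <= y)%R.
      rewrite invr_ge1 ?sqrtr_gt0// ?unitf_gt0 ?sqrtr_gt0//.
      by rewrite -[leRHS]sqrtr1 ler_sqrt.
    rewrite -/y y2.
    have := @expR_ge1Dxn R (y ^+ 2) d.-1 (sqr_ge0 y).
    rewrite prednK; last by apply: leq_trans d3.
    move=> h.
    have h2 : (y ^+ 2 ^+ d / d`!%:R <= expR (y ^+ 2))%R by lra.
    rewrite ler_pdivrMr ?ltr0n ?fact_gt0// in h2.
    rewrite mulrC; apply: le_trans h2.
    by rewrite -exprM ler_weXn2l// leq_pmull.
  by rewrite lebesgue_measure_itv/= lte01 -EFinB -EFinM ltry.
apply: (@le_lt_trans _ _ (\int[mu]_(v in `]1%R, +oo[) ((Num.sqrt v)^-1 ^+ 3)%:E)).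
  apply: ge0_le_integral => //.
  - by move=> v _; rewrite lee_fin heat_kernel_ge0.
  - by apply/measurable_EFinP; apply: measurable_funTS; exact:
    measurable_heat_kernel_time.
  - apply/measurable_EFinP; apply: measurable_funTS.
    apply: measurable_funX; apply: measurable_funVr.
    by apply: continuous_measurable_fun; exact: sqrt_continuous.
  - move=> v /=; rewrite in_itv/= andbT => v1; rewrite lee_fin /g.
    have v0 : (0 < v)%R by apply: lt_trans v1.
    rewrite -[leRHS]mulr1 ler_pM ?exprn_ge0 ?invr_ge0 ?sqrtr_ge0 ?expR_ge0//.
      rewrite ler_wiXn2l ?invr_ge0 ?sqrtr_ge0// invf_le1 ?sqrtr_gt0//.
      by rewrite -sqrtr1 ler_wsqrtr// ltW.
    by rewrite -[leRHS]expR0 ler_expR oppr_le0 divr_ge0// ltW.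
rewrite integral_itv_obnd_cbnd; first exact: tail_lty.
apply/measurable_EFinP; apply: measurable_funTS.
apply: measurable_funX; apply: measurable_funVr.
by apply: continuous_measurable_fun; exact: sqrt_continuous.
Qed.

(** The normalizing constant between the time integral and [K], see [heat_spatial]. *)
Definition kappa : R := fine (heat `]0%R, +oo[ 1).

Lemma kappa_gt0 : (0 < kappa)%R.
Proof.
rewrite fine_gt0//; apply/andP; split; last first.
  by rewrite -ge0_fin_numE ?heat_ge0// heat_spatial_lty.
rewrite heat0y; apply: (@lt_le_trans _ _ (heat `]0%R, 1%R] 1)).
  apply: lt_le_trans (heat_gain (@ltr01 R) (lexx _)).
  by rewrite lte_fin !mulr_gt0 ?expR_gt0// exprn_gt0// invr_gt0 sqrtr_gt0.
by rewrite leeDl// heat_ge0.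
Qed.

(** By scaling, the time integral is homogeneous of degree [2 - d] in [x]. *)
Lemma heat_spatial (x : 'rV[R]_d) : x != 0%R ->
  heat `]0%R, +oo[ (Q x) = kappa%:E * K x.
Proof.
move=> x0.
have e0 : (0 < enorm x)%R by rewrite enorm_gt0.
have Q0 : (0 < Q x)%R by rewrite exprn_gt0.
rewrite heat_scale// (_ : _ @^-1` _ = `]0%R, +oo[%classic); last first.
  by apply/seteqP; split => v /=; rewrite !in_itv/= !andbT pmulr_rgt0.
rewrite -[X in _ * X](fineK heat_spatial_lty) -/kappa muleC; congr (_ * _).
rewrite /K (negbTE x0) gtn_eqF//; congr EFin.
rewrite /Q sqrtr_sqr ger0_norm ?enorm_ge0//.
have -> : ((enorm x)^-1 ^+ d = (enorm x)^-1 ^+ 2 * (enorm x)^-1 ^+ (d - 2))%R.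
  by rewrite -exprD subnKC// ltnW.
by rewrite mulrA exprVn mulfV ?expf_neq0 ?gt_eqF// mul1r exprVn.
Qed.

End spatial.

(** * Gaussian averages of the kernel *)

Section superharmonic.
Context {R : realType} {d : nat}.
Notation mu := (@lebesgue_measure R).
Local Notation g := (@heat_kernel R d).
Local Notation heat := (@heat R d).
Notation T := (borelRd R d).

Lemma measurable_heat (A : set R) : measurable A -> measurable_fun setT (heat A).
Proof.
move=> mA.
rewrite (_ : heat A = fun w => \int[mu]_v (g v w * \1_A v)%:E); last first.
  apply/funext => w; rewrite /heat integral_mkcond; apply: eq_integral => v _.
  by rewrite /patch indicE; case: ifP => _ /=; rewrite ?mulr1 ?mulr0.
apply: (@measurable_fun_fubini_tonelli_F _ _ _ _ _ mu
  (fun u => (g u.2 u.1 * \1_A u.2)%:E)).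
  apply/measurable_EFinP; apply: measurable_funM.
    apply: (measurableT_comp (f := fun u : R * R => g u.1 u.2)
      (g := fun u : R * R => (u.2, u.1)) (@measurable_heat_kernel R d)).
    exact: measurable_fun_pair.
  have mi : measurable_fun setT (\1_A : measurableTypeR R -> R).
    exact: measurable_indic.
  exact: (measurableT_comp (g := snd : measurableTypeR R * measurableTypeR R ->
    measurableTypeR R) mi).
by move=> u; rewrite lee_fin mulr_ge0 ?heat_kernel_ge0.
Qed.

Lemma measurable_Q_shift x : measurable_fun setT (fun z : T => Q (x + z)%R).
Proof.
exact: (measurableT_comp (f := Q : T -> R)
      (g := fun u : T => (x + u)%R : T) (@measurable_Q R d) (measurable_addcV x)).
Qed.

Lemma measurable_K_shift x : measurable_fun setT (fun z : T => K (x + z)%R).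
Proof.
exact: (measurableT_comp (f := K : T -> \bar R)
      (g := fun u : T => (x + u)%R : T) (@measurable_K R d) (measurable_addcV x)).
Qed.

Lemma measurable_heatQ (A : set R) x : measurable A ->
  measurable_fun setT (fun z : T => heat A (Q (x + z)%R)).
Proof.
move=> mA; exact: (measurableT_comp (f := heat A)
  (g := fun z : T => Q (x + z)%R) (measurable_heat mA) (measurable_Q_shift x)).
Qed.

(** The lower bound of [heat_gain]: what [K] loses at least, up to a constant
    factor, under averaging over a Gaussian of parameter [S]. *)
Definition gain (S : R) : R := (S / 2 * ((Num.sqrt S)^-1 ^+ d * expR (- 2)))%R.

Lemma gain_gt0 S : (0 < S)%R -> (0 < gain S)%R.
Proof.
move=> S0; rewrite !mulr_gt0 ?invr_gt0 ?expR_gt0//.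
by rewrite exprn_gt0// invr_gt0 sqrtr_gt0.
Qed.

Lemma gain_heat S w : (0 < S)%R ->
  (if (w <= S)%R then gain S else 0%R)%:E <= heat `]0%R, S] w.
Proof.
move=> S0; case: ifPn => [wS|_]; last exact: heat_ge0.
exact: heat_gain.
Qed.

(** At [x = 0], where the kernel is infinite, the time integral diverges: it is at
    least its value at any other point, and these values are unbounded near [0]. *)
Lemma K_le_heat (x : 'rV[R]_d) : (2 < d)%N -> (@kappa R d)%:E * K x <=
  heat `]0%R, +oo[ (Q x).
Proof.
move=> d3; have [->|x0] := eqVneq x 0%R; last by rewrite heat_spatial.
suff -> : heat `]0%R, +oo[ (Q (0 : 'rV[R]_d)%R) = +oo by rewrite leey.
have Q00 : Q (0 : 'rV[R]_d)%R = 0%R by apply/eqP; rewrite Q_eq0.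
rewrite Q00; apply/eqyP => A A0.
have d0 : (0 < d)%N by apply: ltn_trans d3.
pose k := @kappa R d; have k0 : (0 < k)%R := @kappa_gt0 R d d3.
(* At distance 1 / r from the origin the time integral is k * r ^ (d - 2). *)
pose r := (1 + A / k)%R.
have Ak : (0 < A / k)%R by rewrite divr_gt0.
have r0 : (0 < r)%R by rewrite /r; lra.
pose y : 'rV[R]_d := (r^-1 *: delta_mx ord0 (Ordinal d0))%R.
have Qy : Q y = (r^-1 ^+ 2)%R.
  rewrite Q_sum (bigD1 (Ordinal d0))//= big1 ?addr0.
    by rewrite !mxE !eqxx mulr1.
  by move=> i i0; rewrite !mxE eqxx/= (negbTE i0) mulr0 expr0n.
have y0 : y != 0%R by rewrite -Q_eq0 Qy sqrf_eq0 invr_eq0 gt_eqF.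
have h : heat `]0%R, +oo[ (Q y) <= heat `]0%R, +oo[ 0.
  apply: le_heat => //; last exact: Q_ge0.
  by move=> v /=; rewrite in_itv/= andbT => /ltW.
apply: le_trans h; rewrite heat_spatial// -/k /K (negbTE y0) gtn_eqF//.
have -> : enorm y = r^-1%R.
  apply/eqP; rewrite -(@eqrXn2 _ 2) ?enorm_ge0 ?invr_ge0 ?ltW//.
  by rewrite -Qy.
rewrite -EFinM lee_fin -exprVn invrK -ler_pdivrMl// mulrC.
have r1 : (1 <= r)%R by rewrite /r; lra.
apply: (@le_trans _ _ r); first by rewrite /r; lra.
by rewrite -[leLHS]expr1 ler_weXn2l// subn_gt0.
Qed.

(** The average of [K] is the time integral over [`]S, +oo[], so that the part
    over [`]0, S]] is gained. *)
Lemma K_gaussian_spatial (S : R) (gam : probRd R d) (P : T -> R) x :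
  (2 < d)%N -> (0 < S)%R -> gaussian_of S gam ->
  measurable_fun setT P -> (forall z, 0 <= P z)%R ->
  \int[gam]_z (K (x + z)%R + (P z)%:E) +
     ((@kappa R d)^-1 * (if (Q x <= S)%R then gain S else 0))%:E
    <= K x + \int[gam]_z (P z)%:E.
Proof.
move=> d3 S0 gamS mP P0.
have [->|x0] := eqVneq x 0%R.
  rewrite /K eqxx addye ?leey// -ltNye (lt_le_trans (ltNyr 0%R))//.
  by apply: integral_ge0 => z _; rewrite lee_fin.
have k0 : (0 < @kappa R d)%R := @kappa_gt0 R d d3.
have K0 y : 0 <= @K R d y.
  rewrite /K; case: ifP => // _; rewrite gtn_eqF// lee_fin invr_ge0.
  by rewrite exprn_ge0// enorm_ge0.
rewrite ge0_integralD//=; last 3 first.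
- exact: measurable_K_shift.
- by move=> z _; rewrite lee_fin.
- exact/measurable_EFinP.
rewrite addeAC leeD2r//.
rewrite -(@lee_pmul2l _ (@kappa R d)%:E)// ?ltry ?lte_fin//.
rewrite ge0_muleDr; last 2 first.
- by apply: integral_ge0 => z _; exact: K0.
- rewrite lee_fin mulr_ge0 ?invr_ge0 ?(ltW k0)//.
  by case: ifP => _ //; exact/ltW/gain_gt0.
rewrite -EFinM mulrA divff ?gt_eqF// mul1r -heat_spatial//.
have -> : `]0%R, +oo[%classic = `]0%R, S] `|` `]S, +oo[ :> set R.
  apply/seteqP; split => v /=; rewrite !in_itv/= !andbT.
    by move=> vac; have [vb|vb] := lerP v S; [left|right]; lra.
  by move=> [] *; lra.
rewrite heatU//; last first.
  by apply/disj_set2P/seteqP; split => // v [] /=; rewrite !in_itv/= !andbT => *; lra.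
rewrite addeC leeD ?gain_heat//.
rewrite -ge0_integralZl//=; [|exact: measurable_K_shift|by rewrite lee_fin ltW].
have -> : `]S, +oo[%classic = (fun v : R => v - S)%R @^-1` `]0%R, +oo[ :> set R.
  by apply/seteqP; split => v /=; rewrite !in_itv/= !andbT subr_gt0.
rewrite -(heat_average gamS)//; last by move=> v /=; rewrite in_itv/= andbT.
apply: ge0_le_integral => //.
- by move=> z _; rewrite mule_ge0 ?lee_fin ?(ltW k0).
- by apply: measurable_funeM; exact: measurable_K_shift.
- exact: measurable_heatQ.
- by move=> z _; exact: K_le_heat.
Qed.

(** The factor [exp (- 1 / N)] of [theta_log] multiplies the nonnegative
    function [K + p] rather than [K], whose sign varies. *)
Lemma K_le_heat_planar (d2 : d = 2%N) (N : R) (x : 'rV[R]_d) (p : R) : (0 < N)%R ->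
  (0 <= p)%R ->
  (expR (- N^-1))%:E * (K x + p%:E) + (theta (d := d) N / 2)%:E
    <= 2^-1%:E * heat `]0%R, N] (Q x) + p%:E.
Proof.
move=> N0 p0.
have e1 : (expR (- N^-1) <= 1)%R.
  by rewrite -[leRHS]expR0 ler_expR oppr_le0 invr_ge0 ltW.
have h (w : R) : (0 < w)%R ->
    ((theta (d := d) N - expR (- N^-1) * ln w)%:E <= heat `]0%R, N] w).
  by move=> w0; rewrite heat_planar// lee_fin lerBlDr theta_log.
have [->|x0] := eqVneq x 0%R; last first.
  have Q0 : (0 < Q x)%R by rewrite exprn_gt0// enorm_gt0.
  rewrite K_planar//.
  have := h _ Q0; rewrite heat_planar// lee_fin => h1.
  rewrite -[leLHS]/(_%:E) -[leRHS]/(_%:E) lee_fin.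
  have : (expR (- N^-1) * p <= p)%R by rewrite ler_piMl.
  by nra.
suff -> : heat `]0%R, N] (Q (0 : 'rV[R]_d)%R) = +oo.
  by rewrite gt0_muley ?lte_fin// addye// leey.
have -> : Q (0 : 'rV[R]_d)%R = 0%R by apply/eqP; rewrite Q_eq0.
apply/eqyP => A A0.
(* With this w the lower bound of theta_log equals A. *)
pose w := expR ((theta (d := d) N - A) / expR (- N^-1)).
apply: le_trans (le_heat (w' := w) _ _ _) => //.
- apply: le_trans (h w (expR_gt0 _)).
  by rewrite lee_fin /w expRK mulrCA divff ?gt_eqF ?expR_gt0// mulr1; lra.
- by move=> v /=; rewrite in_itv/= => /andP[/ltW].
- exact: expR_ge0.
Qed.

(** As in higher dimension, with the time integral cut off at [N] and
    renormalized by [theta N]; all the errors are of order [1 / N]. *)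
Lemma K_gaussian_planar (S : R) (gam : probRd R d) (P : T -> R) x :
  (d = 2%N) -> (0 < S)%R -> gaussian_of S gam ->
  measurable_fun setT P -> (forall z, 0 <= P z)%R ->
  (forall z, 0 <= K (x + z)%R + (P z)%:E) ->
  \int[gam]_z (K (x + z)%R + (P z)%:E) +
     (2^-1 * (if (Q x <= S)%R then gain S else 0))%:E
    <= K x + \int[gam]_z (P z)%:E.
Proof.
move=> d2 S0 gamS mP P0 KP0.
have intP0 : 0 <= \int[gam]_z (P z)%:E.
  by apply: integral_ge0 => z _; rewrite lee_fin.
have [->|x0] := eqVneq x 0%R.
  by rewrite /K eqxx addye ?leey// -ltNye (lt_le_trans (ltNyr 0%R)).
have Q0 : (0 < Q x)%R by rewrite exprn_gt0// enorm_gt0.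
have mKP : measurable_fun setT (fun z : T => K (x + z)%R + (P z)%:E).
  apply: emeasurable_funD; first exact: measurable_K_shift.
  exact/measurable_EFinP.
rewrite K_planar//.
set A := (\int[gam]_z (K (x + z)%R + _)).
have A0 : 0 <= A by apply: integral_ge0.
set B := (\int[gam]_z (P z)%:E) in intP0 *.
set D := (if _ then _ else _).
have [->|By] := eqVneq B +oo; first by rewrite addey// leey.
have Bfin : B \is a fin_num by rewrite ge0_fin_numE// ltey.
have main (N : R) : (0 < N)%R ->
  (expR (- N^-1))%:E * A + (theta (d := d) N / 2)%:E + (D / 2)%:E
    <= (theta (d := d) (N / Q x) / 2 + S / N / 2)%:E + B.
  move=> N0.
  have eN0 : 0 <= (expR (- N^-1))%:E by rewrite lee_fin expR_ge0.
  have th0 : (0 <= theta (d := d) N)%R by rewrite fine_ge0// heat_ge0.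
  have mh : measurable_fun setT (fun z : T => 2^-1%:E * heat `]0%R, N] (Q (x + z)%R)).
    by apply: measurable_funeM; exact: measurable_heatQ.
  have -> : (expR (- N^-1))%:E * A + (theta (d := d) N / 2)%:E =
     \int[gam]_z ((expR (- N^-1))%:E * (K (x + z)%R + (P z)%:E) +
       (theta (d := d) N / 2)%:E).
    rewrite ge0_integralD//=.
    - by rewrite ge0_integralZl//= integral_cst//= probability_setT mule1.
    - by move=> z _; rewrite mule_ge0.
    - exact: measurable_funeM.
    - by rewrite lee_fin divr_ge0.
  apply: (@le_trans _ _ (\int[gam]_z (2^-1%:E * heat `]0%R, N] (Q (x + z)%R) + (P z)%:E)
    + (D / 2)%:E)).
    apply: leeD2r; apply: ge0_le_integral => //.
    - by move=> z _; rewrite adde_ge0// ?mule_ge0// lee_fin divr_ge0.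
    - by apply: emeasurable_funD => //; exact: measurable_funeM.
    - by apply: emeasurable_funD => //; exact/measurable_EFinP.
    - by move=> z _; exact: K_le_heat_planar.
  rewrite ge0_integralD//=; last 3 first.
  - by move=> z _; rewrite mule_ge0// heat_ge0.
  - by move=> z _; rewrite lee_fin.
  - exact/measurable_EFinP.
  rewrite addeAC leeD2r// ge0_integralZl//=; last 2 first.
  - exact: measurable_heatQ.
  - by move=> z _; exact: heat_ge0.
  rewrite (heat_average gamS)//; last by move=> v /=; rewrite in_itv/= => /andP[].
  have -> : (fun v : R => v - S)%R @^-1` `]0%R, N] = `]S, (N + S)%R]%classic.
    by apply/seteqP; split => v /=; rewrite !in_itv/= => *; lra.
  have hA : heat `]S, (N + S)%R] (Q x) + D%:E <=
    (theta (d := d) (N / Q x))%:E + (S / N)%:E.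
    apply: (@le_trans _ _ (heat `]S, (N + S)%R] (Q x) + heat `]0%R, S] (Q x))).
      by apply: leeD2l; exact: gain_heat.
    have S0' := ltW S0; have N0' := ltW N0.
    rewrite addeC -heat_itvU//; last lra.
    rewrite (@heat_itvU _ _ 0%R N)//; last lra.
    rewrite heat_planar//; apply: leeD2l.
    apply: le_trans (heat_le_cst (c := N^-1%R) _ _) _ => //.
      move=> v /=; rewrite in_itv/= => vN.
      have v0 : (0 < v)%R by lra.
      rewrite (heat_kernel_planar d2 _ (ltW v0)) -[leRHS]mulr1 ler_pM ?invr_ge0
        ?expR_ge0//; first lra.
        by rewrite lef_pV2 ?posrE//; lra.
      by rewrite -[leRHS]expR0 ler_expR oppr_le0 divr_ge0 ?ltW.
    rewrite lebesgue_measure_itv/= lte_fin ifT; last lra.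
    by rewrite -EFinB -EFinM lee_fin (_ : (_ * _ = S / N)%R)//; ring.
  have : heat `]S, (N + S)%R] (Q x) \is a fin_num.
    rewrite ge0_fin_numE ?heat_ge0//.
    apply: le_lt_trans (_ : (theta (d := d) (N / Q x) + S / N - D)%:E < _);
      last by rewrite ltry.
    by rewrite -leeBrDr// in hA.
  move: hA; case: (heat _ _) => // r; rewrite -!EFinD !lee_fin => hr _; lra.
have Afin : A \is a fin_num.
  rewrite ge0_fin_numE//.
  have := main 1%R ltr01.
  case: (A) A0 => [r _|_|//]; first by rewrite ltry.
  rewrite gt0_muley ?lte_fin ?expR_gt0// !addye//.
  by rewrite -(fineK Bfin) -EFinD leye_eq.
rewrite -(fineK Afin) -(fineK Bfin) -!EFinD lee_fin.
have fA0 : (0 <= fine A)%R by exact: fine_ge0.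
set w := Q x in Q0 main *.
apply: (@ler_add_divn R _ _ (fine A + w * `|ln w| / 2 + S / 2)) => N N0.
have := main N N0.
rewrite -(fineK Afin) -(fineK Bfin) -EFinM -!EFinD lee_fin => h1.
have h2 := theta_log d2 (divr_gt0 N0 Q0) (w := w^-1).
rewrite invr_gt0 invf_div lnV ?posrE// invrK divfK ?gt_eqF// in h2.
have {h2} := h2 Q0 => h2.
have e1 : (1 - N^-1 <= expR (- N^-1))%R by exact: expR_ge1Dx.
have e2 : (1 - w / N <= expR (- (w / N)))%R by exact: expR_ge1Dx.
have e3 : (expR (- (w / N)) <= 1)%R.
  by rewrite -[leRHS]expR0 ler_expR oppr_le0 divr_ge0 // ltW.
have e4 : (fine A * (1 - N^-1) <= fine A * expR (- N^-1))%R by rewrite ler_wpM2l.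
have e5 : (expR (- (w / N)) * (- ln w) <= - ln w + w / N * `|ln w|)%R.
  rewrite -[X in (_ <= X + _)%R]mul1r -lerBlDl -mulrBl.
  have := ler_norm (ln w); have := ler_norm (- ln w); rewrite normrN => n1 n2.
  by have := normr_ge0 (ln w); nra.
by rewrite /=; lra.
Qed.

(** Superharmonicity with a quantitative gain. The function [P] compensates the
    negative part of the logarithm, so that the average is that of a nonnegative
    function. *)
Lemma K_gaussian : (2 <= d)%N -> exists2 c : R, (0 < c)%R &
  forall (S : R) (gam : probRd R d) (P : T -> R) x,
  (0 < S)%R -> gaussian_of S gam ->
  measurable_fun setT P -> (forall z, 0 <= P z)%R ->
  (forall z, 0 <= K (x + z)%R + (P z)%:E) ->
  \int[gam]_z (K (x + z)%R + (P z)%:E) +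
     (if (Q x <= S)%R then c * gain S else 0)%:E
    <= K x + \int[gam]_z (P z)%:E.
Proof.
rewrite leq_eqVlt => /predU1P[/esym d2'|d2]; last first.
  exists (kappa (d := d))^-1%R => [|S gam P x S0 gamS mP P0 KP0].
    by rewrite invr_gt0 kappa_gt0.
  have := K_gaussian_spatial x d2 S0 gamS mP P0.
  by case: ifP; rewrite ?mulr0.
exists 2^-1%R => // S gam P x S0 gamS mP P0 KP0.
have := K_gaussian_planar d2' S0 gamS mP P0 KP0.
by case: ifP; rewrite ?mulr0.
Qed.

End superharmonic.

Section fatou_limit.
Context {R : realType} d (T : measurableType d) (m : {measure set T -> \bar R}).

Lemma fatou_cvg (f : (T -> \bar R)^nat) (F : T -> \bar R) (C : (\bar R)^nat)
  (l : \bar R) :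
  (forall n, measurable_fun setT (f n)) -> (forall n x, 0 <= f n x) ->
  (forall x, f ^~ x @ \oo --> F x) -> C @ \oo --> l ->
  (forall n, \int[m]_x f n x <= C n) -> \int[m]_x F x <= l.
Proof.
move=> mf f0 fF Cl fC.
have -> : \int[m]_x F x = \int[m]_x limn_einf (f ^~ x).
  apply: eq_integral => x _; rewrite is_cvg_limn_einfE; first exact/esym/cvg_lim.
  by apply/cvg_ex; exists (F x).
apply: (le_trans (fatou m measurableT mf (fun n x _ => f0 n x))).
rewrite limn_einf_lim -(cvg_lim _ Cl)//.
apply: lee_lim; [exact: is_cvg_einfs|by apply/cvg_ex; exists l|].
near=> n; apply: (le_trans _ (fC n)).
by apply: ereal_inf_lbound; exists n => //=.
Unshelve. all: by end_near. Qed.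

End fatou_limit.

Section gaussian_moment.
Context {R : realType} {d : nat}.
Notation T := (borelRd R d).

Lemma cvg_exp_quotient (q : R) : (0 <= q)%R ->
  ((n.+1%:R * (1 - expR (- (q / n.+1%:R)))) @[n --> \oo] --> q)%R.
Proof.
move=> q0.
have lb n : (q - q ^+ 2 / n.+1%:R <= n.+1%:R * (1 - expR (- (q / n.+1%:R))))%R.
  set v : R := n.+1%:R; have v0 : (0 < v)%R by rewrite ltr0n.
  clearbody v.
  have u0 : (0 <= q / v)%R by rewrite divr_ge0// ltW.
  have h : (expR (- (q / v)) <= 1 - q / v + (q / v) ^+ 2)%R.
    rewrite expRN -[leLHS]mul1r ler_pdivrMr ?expR_gt0//.
    move: (q / v)%R u0 => u u0.
    apply: (@le_trans _ _ ((1 - u + u ^+ 2) * (1 + u))%R).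
      by have : (0 <= u ^+ 3)%R by [exact: exprn_ge0]; lra.
    by rewrite ler_wpM2l ?expR_ge1Dx//; nra.
  have -> : (q - q ^+ 2 / v = v * (q / v - (q / v) ^+ 2))%R by field; rewrite gt_eqF.
  by rewrite ler_wpM2l ?(ltW v0)//; lra.
have ub n : (n.+1%:R * (1 - expR (- (q / n.+1%:R))) <= q)%R.
  set v : R := n.+1%:R; have v0 : (0 < v)%R by rewrite ltr0n.
  clearbody v.
  have := expR_ge1Dx (- (q / v)) => h.
  rewrite -[leRHS](@divfK _ v) ?gt_eqF// mulrC ler_wpM2r ?(ltW v0)//; lra.
apply: (@squeeze_cvgr _ _ _ _ (fun n => q - q ^+ 2 / n.+1%:R)%R (cst q)).
- by near=> n; rewrite lb ub.
- rewrite -[X in _ --> X]subr0; apply: cvgB; first exact: cvg_cst.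
  rewrite -[X in _ --> X](mulr0 (q ^+ 2)%R); apply: cvgMr.
  exact: cvg_harmonic.
- exact: cvg_cst.
Unshelve. all: by end_near. Qed.

(** The functions [v (1 - exp (- Q / v))] tend to [Q] as [v] tends to infinity, and
    their averages are given by the semigroup property; Fatou's lemma concludes. *)
Lemma gaussian_moment (S : R) (gam : probRd R d) x : (0 < S)%R ->
  gaussian_of S gam -> \int[gam]_z (Q (x + z)%R)%:E <= (Q x + d%:R * S)%:E.
Proof.
move=> S0 gamS.
pose f n z := (n.+1%:R * (1 - expR (- (Q (x + z)%R / n.+1%:R))))%:E.
have fr01 n z : (0 <= 1 - expR (- (Q (x + z)%R / n.+1%:R)) <= 1)%R.
  rewrite gerBl expR_ge0 andbT subr_ge0 -[leRHS]expR0 ler_expR oppr_le0.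
  by rewrite divr_ge0// Q_ge0.
have me n : measurable_fun setT (fun z : T => expR (- (Q (x + z)%R / n.+1%:R))).
  apply: measurableT_comp => //; apply: measurable_funN.
  by apply: measurable_funM => //; exact: measurable_Q_shift.
apply: (@fatou_cvg _ _ _ gam f _ (cst (Q x + d%:R * S)%:E)).
- move=> n; apply/measurable_EFinP; apply: measurable_funM => //.
  exact: measurable_funB.
- by move=> n z; rewrite lee_fin mulr_ge0//; case/andP: (fr01 n z).
- by move=> z; apply/fine_cvgP; split; [near=> n|exact: cvg_exp_quotient (Q_ge0 _)].
- exact: cvg_cst.
move=> n; rewrite /f /cst.
set v : R := n.+1%:R; have v0 : (0 < v)%R by rewrite ltr0n.
  clearbody v.
have vS0 : (0 < v + S)%R by rewrite addr_gt0.
have sv0 : (0 < Num.sqrt v)%R by rewrite sqrtr_gt0.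
have hI : \int[gam]_z (expR (- (Q (x + z)%R / v)))%:E =
    (Num.sqrt v ^+ d * heat_kernel (d := d) (v + S) (Q x))%:E.
  rewrite EFinM -gamS// -ge0_integralZl//=.
  - apply: eq_integral => z _; rewrite -EFinM /heat_kernel mulrA -exprMn mulfV ?gt_eqF//.
    by rewrite expr1n mul1r.
  - apply/measurable_EFinP.
    apply: (measurableT_comp (f := fun u : R * R => heat_kernel (d := d) u.1 u.2)
      (g := fun z : T => (v, Q (x + z)%R)) (@measurable_heat_kernel R d)).
    by apply: measurable_fun_pair => //; exact: measurable_Q_shift.
  - by move=> z _; rewrite lee_fin heat_kernel_ge0.
have lb : (1 - (d%:R * S + Q x) / v <=
  Num.sqrt v ^+ d * heat_kernel (d := d) (v + S) (Q x))%R.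
  apply: (@le_trans _ _ (expR (- ((d%:R * S + Q x) / v)))); first exact: expR_ge1Dx.
  have -> : (- ((d%:R * S + Q x) / v) = (- (S / v)) *+ d + - (Q x / v))%R.
    by rewrite -mulr_natr; field; rewrite gt_eqF.
  rewrite expRD /heat_kernel mulrA -exprMn; apply: ler_pM; rewrite ?expR_ge0//.
    rewrite -[X in expR X]mulr_natl expRM_natl; apply: lerXn2r;
      rewrite ?nnegrE ?expR_ge0//.
    + pose t := (v / (v + S))%R.
      have t0 : (0 < t)%R by rewrite divr_gt0.
      have t1 : (t <= 1)%R by rewrite ler_pdivrMr// mul1r; lra.
      have -> : (Num.sqrt v / Num.sqrt (v + S) = Num.sqrt t)%R.
        by rewrite -sqrtrV ?(ltW vS0)// -sqrtrM ?(ltW v0).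
      apply: (@le_trans _ _ t).
        rewrite expRN -[leRHS]invrK lef_pV2 ?posrE ?expR_gt0 ?invr_gt0//.
        apply: le_trans (expR_ge1Dx _).
        by rewrite /t invf_div le_eqVlt; apply/orP; left; apply/eqP; field;
          rewrite gt_eqF.
      rewrite -[leLHS]ger0_norm ?(ltW t0)// -sqrtr_sqr ler_wsqrtr//.
      by rewrite expr2 ler_piMr// ltW.
  by rewrite ler_expR lerN2 ler_wpM2l ?Q_ge0// lef_pV2 ?posrE// lerDl ltW.
have me' : measurable_fun setT (fun z : T => (expR (- (Q (x + z)%R / v)))%:E).
  apply/measurable_EFinP; apply: measurableT_comp => //; apply: measurable_funN.
  by apply: measurable_funM => //; exact: measurable_Q_shift.
have inte : gam.-integrable setT (fun z : T => (expR (- (Q (x + z)%R / v)))%:E).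
  apply/integrableP; split=> //.
  under eq_integral do rewrite gee0_abs ?lee_fin ?expR_ge0//.
  by rewrite hI ltry.
under eq_integral do rewrite EFinM EFinB.
have int1 : gam.-integrable setT (cst 1%:E).
  by apply: finite_measure_integrable_cst.
rewrite integralZl//; last exact: integrableB.
rewrite integralB//= integral_cst//= probability_setT mule1 hI -EFinB -EFinM lee_fin.
have -> : (Q x + d%:R * S = v * ((d%:R * S + Q x) / v))%R by field; rewrite gt_eqF.
by rewrite ler_wpM2l ?(ltW v0)//; lra.
Unshelve. all: by end_near. Qed.
End gaussian_moment.

(** * Energies *)

Section energy.
Context {R : realType} {d : nat}.
Notation T := (borelRd R d).
Implicit Types (al be : probRd R d).

(** If the integral of [f] is infinite, so is that of the positive part of
    [f - h], while the negative part is dominated by [h]. *)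
Lemma ge0_integralB dd (X : measurableType dd) (m : {measure set X -> \bar R})
    (f : X -> \bar R) (h : X -> R) :
  measurable_fun setT f -> (forall u, 0 <= f u) ->
  measurable_fun setT h -> (forall u, 0 <= h u)%R ->
  \int[m]_x (h x)%:E < +oo ->
  \int[m]_x (f x - (h x)%:E) = \int[m]_x f x - \int[m]_x (h x)%:E.
Proof.
move=> mf f0 mh h0 hlty.
have mh' : measurable_fun setT (EFin \o h) by exact/measurable_EFinP.
have inth : m.-integrable setT (EFin \o h).
  apply/integrableP; split=> //.
  by under eq_integral do rewrite /= ger0_norm//.
have [foo|foo] := eqVneq (\int[m]_x f x) +oo; last first.
  rewrite integralB//; apply/integrableP; split=> //.
  under eq_integral do rewrite gee0_abs//.
  by rewrite ltey.
have mg : measurable_fun setT (fun x => f x - (h x)%:E).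
  exact: emeasurable_funB.
have Ih0 : 0 <= \int[m]_x (h x)%:E by apply: integral_ge0 => u _; rewrite lee_fin.
have hfin : \int[m]_x (h x)%:E \is a fin_num by rewrite ge0_fin_numE.
rewrite foo integralE.
have -> : \int[m]_x (fun u => f u - (h u)%:E)^\+ x = +oo.
  apply/eqP; rewrite -leye_eq.
  have : \int[m]_x f x <= \int[m]_x (fun u => f u - (h u)%:E)^\+ x + \int[m]_x (h x)%:E.
    rewrite -ge0_integralD//.
    - apply: ge0_le_integral => //.
      + by apply: emeasurable_funD => //; exact: measurable_funepos.
      + by move=> u _; rewrite -leeBlDr//= funeposE le_max lexx.
    - exact: measurable_funepos.
    - by move=> u _; rewrite lee_fin.
  rewrite foo leye_eq => /eqP; move: hfin; case: (\int[m]_x (h x)%:E) => // r _.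
  by case: (\int[m]_x _ ).
have : \int[m]_x (fun u => f u - (h u)%:E)^\- x <= \int[m]_x (h x)%:E.
  apply: ge0_le_integral => //.
  - exact: measurable_funeneg.
  - move=> u _; rewrite funenegE ge_max lee_fin h0 andbT.
    by rewrite fin_num_oppeB// addeC geeDl// oppe_le0.
have : 0 <= \int[m]_x (fun u => f u - (h u)%:E)^\- x.
  by apply: integral_ge0 => u _; exact: funeneg_ge0.
move: hfin; case: (\int[m]_x (h x)%:E) => // r _.
by case: (\int[m]_x _ ).
Qed.

Definition second_moment al : \bar R := \int[al]_x (Q x)%:E.
Definition weighted_potential al (y : 'rV[R]_d) :
  \bar R := \int[al]_x weighted_kernel x y.
(** A symmetric bilinear form that exceeds the weighted energy, on the diagonal, by
    the second moment. *)
Definition cross_energy al be : \bar R := \int[be]_y weighted_potential al y.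

Lemma second_moment_ge0 al : 0 <= second_moment al.
Proof. by apply: integral_ge0 => x _; rewrite lee_fin Q_ge0. Qed.

Lemma weighted_potential_ge0 al y : 0 <= weighted_potential al y.
Proof. by apply: integral_ge0 => x _; exact: weighted_kernel_ge0. Qed.

Lemma cross_energy_ge0 al be : 0 <= cross_energy al be.
Proof. by apply: integral_ge0 => x _; exact: weighted_potential_ge0. Qed.

Lemma measurable_weighted_potential al :
  measurable_fun setT (weighted_potential al : T -> \bar R).
Proof.
apply: (@measurable_fun_fubini_tonelli_G _ _ T T R al
  (fun u : T * T => weighted_kernel u.1 u.2)).
- exact: measurable_weighted_kernel.
- by move=> u; exact: weighted_kernel_ge0.
Qed.

Lemma measurable_weighted_kernel_left y :
  measurable_fun setT (fun x : T => weighted_kernel x y).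
Proof.
by apply: (measurableT_comp (f := fun u : T * T => weighted_kernel u.1 u.2)
  (g := fun x : T => (x, y) : T * T) (@measurable_weighted_kernel R d)).
Qed.

Lemma cross_energy_sym al be : cross_energy al be = cross_energy be al.
Proof.
transitivity (\int[al]_x \int[be]_y weighted_kernel x y).
  apply: esym.
  apply: (@fubini_tonelli _ _ T T R al be (fun u : T * T => weighted_kernel u.1 u.2)).
  - exact: measurable_weighted_kernel.
  - by move=> u; exact: weighted_kernel_ge0.
by apply: eq_integral => x _; apply: eq_integral => y _; rewrite weighted_kernel_sym.
Qed.

Let integral_QD al (r s : R) : second_moment al = r%:E -> (0 <= s)%R ->
  \int[al]_x (Q x + s)%:E = (r + s)%:E.
Proof.
move=> qr s0; rewrite EFinD -qr.
under eq_integral do rewrite EFinD.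
rewrite ge0_integralD//=.
- by rewrite integral_cst//= probability_setT mule1.
- by move=> x _; rewrite lee_fin Q_ge0.
- by apply/measurable_EFinP; exact: measurable_Q.
Qed.

Lemma U_weighted_potential al (r : R) y : second_moment al = r%:E -> U al y =
  weighted_potential al y - (r + Q y)%:E.
Proof.
move=> qr.
transitivity (\int[al]_x (weighted_kernel x y - (Q x + Q y)%:E)).
  by apply: eq_integral => x _; rewrite /weighted_kernel addeK.
rewrite ge0_integralB.
- by rewrite (integral_QD qr (Q_ge0 y)).
- exact: measurable_weighted_kernel_left.
- by move=> x; exact: weighted_kernel_ge0.
- by apply: measurable_funD => //; exact: measurable_Q.
- by move=> x; rewrite addr_ge0 ?Q_ge0.
- by rewrite (integral_QD qr (Q_ge0 y)) ltry.
Qed.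

Lemma second_moment_fin_ge0 al (r : R) : second_moment al = r%:E -> (0 <= r)%R.
Proof. by move=> qr; rewrite -lee_fin -qr second_moment_ge0. Qed.

Lemma mutual_energyE al (r : R) : second_moment al = r%:E ->
  mutual_energy al = cross_energy al al - (2 * r)%:E.
Proof.
move=> qr; have r0 := second_moment_fin_ge0 qr.
have hI : \int[al]_y (r + Q y)%:E = (2 * r)%:E.
  under eq_integral do rewrite addrC.
  by rewrite (integral_QD qr r0) mulr_natl mulr2n.
rewrite /mutual_energy; under eq_integral do rewrite (U_weighted_potential _ qr).
rewrite ge0_integralB ?hI ?ltry//.
- exact: measurable_weighted_potential.
- exact: weighted_potential_ge0.
- by apply: measurable_funD => //; exact: measurable_Q.
- by move=> x; rewrite addr_ge0 ?Q_ge0.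
Qed.

Lemma weighted_energyE al (r : R) : second_moment al = r%:E ->
  weighted_energy al = cross_energy al al - r%:E.
Proof.
move=> qr; rewrite /weighted_energy (mutual_energyE qr).
rewrite [X in (_ + X)%dE](_ : _ = r%:E)//.
case: (cross_energy al al) => [s| |] //=.
by rewrite -!EFinB /= ; congr EFin; ring.
Qed.

(** The dual addition makes the weighted energy infinite as soon as the second
    moment is. *)
Lemma weighted_energy_lty al : weighted_energy al < +oo ->
  exists r s : R, second_moment al = r%:E /\ cross_energy al al = s%:E.
Proof.
have [qoo|qfin] := eqVneq (second_moment al) +oo.
  rewrite /weighted_energy [X in (_ + X)%dE](_ : _ = +oo)//.
  by case: (mutual_energy al).
have qr : second_moment al = (fine (second_moment al))%:E by rewrite fineK//
  ge0_fin_numE ?second_moment_ge0// ltey.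
rewrite (weighted_energyE qr).
have := cross_energy_ge0 al al; case: (cross_energy al al) => // s _ _.
by exists (fine (second_moment al)), s.
Qed.

End energy.

(** * First variation of the energy *)

Section variation.
Context {R : realType} {d : nat}.
Notation T := (borelRd R d).
Implicit Types (al be mu nu rho P : probRd R d).

(** [P = mu - t rho + t nu], written without subtraction so that it makes sense for
    integrals that may be infinite. *)
Definition shifted mu (t : R) rho nu P := forall f : T -> \bar R,
  (forall x, 0 <= f x) -> measurable_fun setT f ->
  \int[P]_x f x + t%:E * \int[rho]_x f x = \int[mu]_x f x + t%:E * \int[nu]_x f x.

Definition dominated rho mu := exists2 M : R, (0 <= M)%R &
  forall f : T -> \bar R, (forall x, 0 <= f x) -> measurable_fun setT f ->
  \int[rho]_x f x <= M%:E * \int[mu]_x f x.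

Definition finite_energy nu := second_moment nu < +oo /\ cross_energy nu nu < +oo.

(** The derivative at [mu] of the energy in the direction [nu]; it is the integral
    of [2 U + Q] against [nu], up to the constant [2 * second_moment mu]. *)
Definition slope mu nu : R := (2 * fine (cross_energy mu nu) - fine (second_moment nu))%R.

Let eK al be : cross_energy al be < +oo -> cross_energy al be =
  (fine (cross_energy al be))%:E.
Proof. by move=> h; rewrite fineK// ge0_fin_numE ?cross_energy_ge0. Qed.

Lemma second_momentK al : second_moment al < +oo -> second_moment al =
  (fine (second_moment al))%:E.
Proof. by move=> h; rewrite fineK// ge0_fin_numE ?second_moment_ge0. Qed.

Lemma dominated_cross_energy rho mu be : dominated rho mu -> cross_energy be mu < +oo ->
  cross_energy be rho < +oo.
Proof.
move=> [M M0 h] ef; apply: le_lt_trans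
  (h _ (weighted_potential_ge0 be) (measurable_weighted_potential be)) _.
by rewrite -/(cross_energy be mu) (eK ef) -EFinM ltry.
Qed.

Lemma dominated_second_moment rho mu : dominated rho mu -> second_moment mu < +oo ->
  second_moment rho < +oo.
Proof.
move=> [M M0 h] ef; apply: le_lt_trans (h (EFin \o Q) _ _) _.
- by move=> x; rewrite lee_fin Q_ge0.
- by apply/measurable_EFinP; exact: measurable_Q.
- by rewrite -/(second_moment mu) (second_momentK ef) -EFinM ltry.
Qed.

Lemma quadratic_ge0 (X Y t0 : R) : (0 < t0)%R ->
  (forall t, 0 < t <= t0 -> 0 <= t * Y + t ^+ 2 * X)%R -> (0 <= Y)%R.
Proof.
move=> t00 h; rewrite leNgt; apply/negP => Y0.
pose t := Num.min t0 (- Y / (2 * (`|X| + 1)))%R.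
have X1 : (0 < `|X| + 1)%R by rewrite ltr_wpDl.
have t_gt0 : (0 < t)%R by rewrite lt_min t00 divr_gt0// ?oppr_gt0// mulr_gt0.
have tt0 : (t <= t0)%R by rewrite ge_min lexx.
have tX : (t * (2 * (`|X| + 1)) <= - Y)%R.
  by rewrite -ler_pdivlMr ?mulr_gt0// ge_min lexx orbT.
have := h t; rewrite t_gt0 tt0 => /(_ isT).
have -> : (t * Y + t ^+ 2 * X = t * (Y + t * X))%R by ring.
rewrite pmulr_rge0// => h1.
have : (t * X <= t * `|X|)%R by rewrite ler_wpM2l ?ler_norm// ltW.
nra.
Qed.

(** The energy of [mu + t (nu - rho)] expanded in [t]. The hypotheses are the
    bilinear relations between the pairings of the four measures. *)
Lemma second_order (pp mp np rp mm mn mr nn nr rr qp qm qn qr t : R) :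
  (pp + t * rp = mp + t * np -> mp + t * mr = mm + t * mn ->
  np + t * nr = mn + t * nn -> rp + t * rr = mr + t * nr ->
  qp + t * qr = qm + t * qn -> mm - qm <= pp - qp ->
  0 <= t * (2 * mn - qn - (2 * mr - qr)) + t ^+ 2 * (nn - 2 * nr + rr))%R.
Proof. by nra. Qed.

(** The energy of the competitors is a quadratic polynomial in [t] that is minimal
    at [t = 0], so that its linear coefficient is nonnegative. *)
Lemma first_variation mu rho nu (t0 : R) (C : set (probRd R d)) :
  (forall P, C P -> weighted_energy mu <= weighted_energy P) ->
  finite_energy mu -> dominated rho mu ->
  finite_energy nu -> cross_energy mu nu < +oo -> (0 < t0)%R ->
  (forall t, (0 < t <= t0)%R -> exists2 P, C P & shifted mu t rho nu P) ->
  (slope mu rho <= slope mu nu)%R.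
Proof.
move=> Cmin [qmu emu] dom [qnu enu] emunu t00 ex.
have emurho := dominated_cross_energy dom emu.
have erhorho : cross_energy rho rho < +oo.
  by apply: (dominated_cross_energy dom); rewrite cross_energy_sym.
have enurho : cross_energy nu rho < +oo.
  by apply: (dominated_cross_energy dom); rewrite cross_energy_sym.
have qrho := dominated_second_moment dom qmu.
rewrite -subr_ge0.
pose X := (fine (cross_energy nu nu) - 2 * fine (cross_energy nu rho) + fine
  (cross_energy rho rho))%R.
apply: (@quadratic_ge0 X _ t0 t00) => t /[dup] tt0 /andP[t_gt0 _].
have [P CP Psh] := ex t tt0.
have mQ : measurable_fun setT (EFin \o Q : T -> \bar R).
  by apply/measurable_EFinP; exact: measurable_Q.
have Q0 (x : T) : 0 <= (EFin \o Q) x by rewrite lee_fin Q_ge0.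
have te0 al be : 0 <= t%:E * cross_energy al be by rewrite mule_ge0 ?cross_energy_ge0//
  lee_fin ltW.
have le_e be : cross_energy be P <= cross_energy be mu + t%:E * cross_energy be nu.
  by rewrite /cross_energy -(Psh _ (weighted_potential_ge0 be)
    (measurable_weighted_potential be)) leeDl// (te0 be rho).
have lty_e be : cross_energy be mu < +oo -> cross_energy be nu < +oo ->
  cross_energy be P < +oo.
  move=> h1 h2; apply: le_lt_trans (le_e be) _.
  by rewrite (eK h1) (eK h2) -EFinM -EFinD ltry.
have emuP := lty_e _ emu emunu.
have enuP : cross_energy nu P < +oo by apply: lty_e => //; rewrite cross_energy_sym.
have erhoP : cross_energy rho P < +oo by apply: lty_e; rewrite cross_energy_sym.
have ePP : cross_energy P P < +oo by apply: lty_e; rewrite cross_energy_sym.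
have qP : second_moment P < +oo.
  apply: (@le_lt_trans _ _ (second_moment mu + t%:E * second_moment nu)).
    rewrite /second_moment -(Psh _ Q0 mQ) leeDl// mule_ge0 ?lee_fin ?(ltW t_gt0)//;
      exact: second_moment_ge0.
  by rewrite (second_momentK qmu) (second_momentK qnu) -EFinM -EFinD ltry.
have := Cmin P CP.
rewrite (weighted_energyE (second_momentK qmu)) (weighted_energyE (second_momentK qP))
  (eK ePP) (eK emu).
rewrite -!EFinB lee_fin => hJ.
have Ee be : cross_energy be P < +oo -> cross_energy be rho < +oo ->
  cross_energy be mu < +oo -> cross_energy be nu < +oo ->
    (fine (cross_energy be P) + t * fine (cross_energy be rho) =
      fine (cross_energy be mu) + t * fine (cross_energy be nu))%R.
  move=> h1 h2 h3 h4.
  have : cross_energy be P + t%:E * cross_energy be rho =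
    cross_energy be mu + t%:E * cross_energy be nu.
    exact: (Psh _ (weighted_potential_ge0 be) (measurable_weighted_potential be)).
  by rewrite (eK h1) (eK h2) (eK h3) (eK h4) -!EFinM -!EFinD => -[].
have Eq : (fine (second_moment P) + t * fine (second_moment rho) =
  fine (second_moment mu) + t * fine (second_moment nu))%R.
  have : second_moment P + t%:E * second_moment rho =
    second_moment mu + t%:E * second_moment nu by exact: Psh _ Q0 mQ.
  by rewrite (second_momentK qP) (second_momentK qrho) (second_momentK qmu)
    (second_momentK qnu) -!EFinM -!EFinD => -[].
have Emu := Ee mu emuP emurho emu emunu.
have Enu := Ee nu enuP enurho (eq_ind _ (fun z => z < +oo) emunu _
  (cross_energy_sym _ _)) enu.
have Erho := Ee rho erhoP erhorho
  (eq_ind _ (fun z => z < +oo) emurho _ (cross_energy_sym _ _))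
   (eq_ind _ (fun z => z < +oo) enurho _ (cross_energy_sym _ _)).
have EP := Ee P ePP (eq_ind _ (fun z => z < +oo) erhoP _ (cross_energy_sym _ _))
  (eq_ind _ (fun z => z < +oo) emuP _ (cross_energy_sym _ _))
  (eq_ind _ (fun z => z < +oo) enuP _ (cross_energy_sym _ _)).
rewrite /slope /X; rewrite !(cross_energy_sym P) (cross_energy_sym nu mu)
  (cross_energy_sym rho mu) (cross_energy_sym rho nu) in Emu Enu Erho EP *.
exact: (second_order EP Emu Enu Erho Eq hJ).
Qed.

End variation.

Section competitors.
Context {R : realType} {d : nat}.
Notation T := (borelRd R d).
Implicit Types (mu nu rho P : probRd R d) (W : set T).

Definition conditioned mu W rho :=
  (forall A, rho A = (fine (mu W))^-1%:E * mu (A `&` W)) /\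
  (forall f : T -> \bar R, (forall x, 0 <= f x) -> measurable_fun setT f ->
    \int[rho]_x f x = (fine (mu W))^-1%:E * \int[mu]_(x in W) f x).

Lemma conditioned_dominated mu W rho : measurable W -> conditioned mu W rho ->
  dominated rho mu.
Proof.
move=> mW [_ h]; exists (fine (mu W))^-1%R; first by rewrite invr_ge0 fine_ge0.
move=> f f0 mf; rewrite h//.
apply: lee_wpmul2l; first by rewrite lee_fin invr_ge0 fine_ge0.
by apply: ge0_subset_integral => //; exact: measurableT.
Qed.

Lemma shifted_exists mu nu W rho (t : R) : measurable W -> 0 < mu W ->
  conditioned mu W rho -> (0 <= t <= fine (mu W))%R ->
  exists P, shifted mu t rho nu P.
Proof.
move=> mW W0 [_ rhoE] /andP[t0 tm].
have m0 : (0 < fine (mu W))%R.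
  by rewrite fine_gt0// W0/= ltey_eq fin_num_measure.
have tau01 : (0 <= t / fine (mu W) <= 1)%R.
  by rewrite divr_ge0 ?(ltW m0)//= ler_pdivrMr// mul1r.
have [P PE] := mixture_probability mu nu mW tau01.
exists P => f f0 mf.
rewrite PE// rhoE// divfK ?gt_eqF//.
have -> : \int[mu]_x f x = \int[mu]_(x in ~` W) f x + \int[mu]_(x in W) f x.
  rewrite -ge0_integral_setU//; first by rewrite setvU.
  - exact: measurableC.
  - by rewrite setvU.
  - exact/disj_setPCr.
rewrite muleA -EFinM -[RHS]addeA -addeA; congr (_ + _).
rewrite addeAC; congr (_ + _).
have I0 : 0 <= \int[mu]_(x in W) f x by exact: integral_ge0.
rewrite -ge0_muleDl; last 2 first.
- by rewrite lee_fin subr_ge0; case/andP: tau01.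
- by rewrite lee_fin; case/andP: tau01.
by rewrite -EFinD subrK mul1e.
Qed.

Lemma shifted_measure mu nu rho P (t : R) (A : set T) : measurable A ->
  shifted mu t rho nu P ->
  (fine (P A) + t * fine (rho A) = fine (mu A) + t * fine (nu A))%R.
Proof.
move=> mA Psh.
have := Psh (EFin \o \1_A) _ _; rewrite !integral_indic// !setIT => h.
have {h} : P A + t%:E * rho A = mu A + t%:E * nu A.
  by apply: h => [x|]; [rewrite lee_fin|apply/measurable_EFinP; exact: measurable_indic].
rewrite -(fineK (fin_num_measure P _ mA)) -(fineK (fin_num_measure rho _ mA)).
rewrite -(fineK (fin_num_measure mu _ mA)) -(fineK (fin_num_measure nu _ mA)).
by rewrite -!EFinM -!EFinD => -[].
Qed.

(** If the minimal energy were infinite, every competitor would be a minimizer.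
    A Dirac mass at a point of [G], and the measure obtained from it by moving the
    fraction [1 - a] elsewhere, are two distinct competitors. *)
Lemma minimizer_finite_energy mu (G : set T) (a : R) : (0 < d)%N ->
  measurable G -> (0 < a < 1)%R ->
  unique_minimizer weighted_energy (measures_with_mass G a) mu ->
  finite_energy mu.
Proof.
move=> d0 mG /andP[a0 a1] [Cmu mumin muuniq].
have [Jlt|] := boolP (weighted_energy mu < +oo).
  by have [r [s [qr es]]] := weighted_energy_lty Jlt; split; rewrite ?qr ?es ltry.
rewrite -leNgt leye_eq => /eqP Joo; exfalso.
have all nu : measures_with_mass G a nu -> forall A : set T, measurable A -> nu A = mu A.
  move=> Cnu; apply: muuniq => // la Cla.
  by have := mumin _ Cla; rewrite Joo leye_eq => /eqP ->; rewrite leey.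
have [x Gx] : G !=set0.
  apply/set0P/eqP => G0.
  by move: Cmu; rewrite /measures_with_mass/= G0 measure0 lee_fin leNgt a0.
pose y : T := (x + delta_mx ord0 (Ordinal d0))%R.
have tau01 : (0 <= 1 - a <= 1)%R by lra.
have [P PE] := mixture_probability (dirac x) (dirac y) (@measurableT _ T) tau01.
have PA (A : set T) : measurable A -> P A = (a * \1_A x + (1 - a) * \1_A y)%:E.
  move=> mA; have := PE (EFin \o \1_A).
  rewrite integral_indic// setIT => ->; last 2 first.
  - by move=> z; rewrite lee_fin.
  - by apply/measurable_EFinP; exact: measurable_indic.
  rewrite setCT integral_set0 add0e !integral_indic// !setIT.
  rewrite /= !diracE indicE in_setT mulr1 subKr -!EFinM -EFinD !indicE.
  by [].
(* The two measures differ on this hyperplane through x, which avoids y. *)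
pose A : set T := (fun z : T => (z : 'rV[R]_d) ord0 (Ordinal d0)) @^-1`
  [set x ord0 (Ordinal d0)].
have mA : measurable A.
  by rewrite -[A]setTI; apply: measurable_coord => //; exact: measurable_set1.
have xA : x \in A by rewrite inE.
have yA : y \in A = false.
  apply/negbTE; rewrite notin_setE /A /= !mxE !eqxx /= => /eqP.
  by rewrite addrC -subr_eq0 addrK oner_eq0.
have C1 : measures_with_mass G a (dirac x).
  by rewrite /measures_with_mass /= diracE mem_set// lee_fin ltW.
have C2 : measures_with_mass G a P.
  rewrite /measures_with_mass /= PA// lee_fin !indicE mem_set// mulr1 lerDl mulr_ge0//.
  by rewrite subr_ge0 ltW.
have := all _ C1 _ mA; rewrite -(all _ C2 _ mA) PA//= diracE !indicE xA yA.
by rewrite mulr0 addr0 mulr1 => -[a1']; rewrite -a1' ltxx in a1.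
Qed.

End competitors.

(** * Smoothing a stationary measure *)

Section smoothing.
Context {R : realType} {d : nat}.
Notation T := (borelRd R d).
Implicit Types (mu nu be : probRd R d).

Definition near_pairs (S : R) (x y : 'rV[R]_d) : R :=
  if (Q (x - y) <= S)%R then 1%R else 0%R.

Lemma measurable_near_pairs S :
  measurable_fun setT (fun u : T * T => near_pairs S u.1 u.2).
Proof.
apply: measurable_fun_ifT => //.
apply: measurable_fun_ler => //.
exact: (measurableT_comp (f := Q : T -> R)
    (g := fun u : T * T => (u.1 - u.2)%R : T) (@measurable_Q R d)
      (@measurable_subrV R d)).
Qed.

Lemma near_pairs_ge0 S x y : (0 <= near_pairs S x y)%R.
Proof. by rewrite /near_pairs; case: ifP. Qed.

Definition pair_mass be mu (S : R) : \bar R :=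
  \int[mu]_x \int[be]_y (near_pairs S x y)%:E.

(** The averaging inequality for the kernel, integrated in both variables. It is
    applied with [P] the quadratic part of the weighted kernel. *)
Lemma convolution_energy (c S : R) (gam mu nu be : probRd R d) : (0 < S)%R ->
  gaussian_of S gam -> (0 <= c)%R ->
  (forall (P : T -> R) x,
    measurable_fun setT P -> (forall z, 0 <= P z)%R ->
    (forall z, 0 <= K (x + z)%R + (P z)%:E) ->
    \int[gam]_z (K (x + z)%R + (P z)%:E) + (if (Q x <= S)%R then c else 0)%:E
      <= K x + \int[gam]_z (P z)%:E) ->
  (forall f : T -> \bar R, (forall x, 0 <= f x) -> measurable_fun setT f ->
    \int[nu]_x f x = \int[mu]_x \int[gam]_z f (x + z)%R) ->
  cross_energy be nu + c%:E * pair_mass be mu S + second_moment mu <=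
    cross_energy be mu + second_moment nu.
Proof.
move=> S0 gamS c0 KP nuE.
have mQ : measurable_fun setT (EFin \o Q : T -> \bar R).
  by apply/measurable_EFinP; exact: measurable_Q.
have Q0 (x : T) : 0 <= (EFin \o Q) x by rewrite lee_fin Q_ge0.
have mM : measurable_fun setT (fun x : T => \int[gam]_z (Q (x + z)%R)%:E).
  apply: (@measurable_fun_fubini_tonelli_F _ _ T T R gam
    (fun u : T * T => (Q (u.1 + u.2)%R)%:E)).
    apply/measurable_EFinP.
    exact: (measurableT_comp (f := Q : T -> R)
      (g := fun u : T * T => (u.1 + u.2)%R : T) (@measurable_Q R d)
        (@measurable_addrV R d)).
  by move=> u; rewrite lee_fin Q_ge0.
have mHs x : measurable_fun setT (fun u : T * T => weighted_kernel u.1 (x + u.2)%R).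
  apply: (measurableT_comp (f := fun u : T * T => weighted_kernel u.1 u.2)
    (g := fun u : T * T => (u.1, (x + u.2)%R) : T * T) (@measurable_weighted_kernel R d)).
  apply: measurable_fun_pair => //.
  exact: (measurableT_comp (f := fun u : T => (x + u)%R : T)
    (g := snd : T * T -> T) (measurable_addcV x)).
have mG : measurable_fun setT (fun u : T * T => c%:E * (near_pairs S u.1 u.2)%:E).
  by apply: measurable_funeM; apply/measurable_EFinP; exact: measurable_near_pairs.
have G0 x y : 0 <= c%:E * (near_pairs S x y)%:E by rewrite mule_ge0 ?lee_fin
  ?near_pairs_ge0.
have M0 (x : T) : 0 <= \int[gam]_z (Q (x + z)%R)%:E.
  by apply: integral_ge0 => z _; rewrite lee_fin Q_ge0.
have pt x y : \int[gam]_z weighted_kernel y (x + z)%R + c%:E * (near_pairs S x y)%:E +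
  (Q x)%:E
    <= weighted_kernel x y + \int[gam]_z (Q (x + z)%R)%:E.
  have := KP (fun z => Q y + Q (x + z))%R (x - y)%R _ _ _.
  have -> : \int[gam]_z weighted_kernel y (x + z)%R =
      \int[gam]_z (K (x - y + z)%R + (Q y + Q (x + z))%:E).
    apply: eq_integral => z _; rewrite /weighted_kernel -KN opprB; congr (K _ + _).
    by rewrite addrAC.
  have -> : c%:E * (near_pairs S x y)%:E = (if (Q (x - y) <= S)%R then c else 0)%:E.
    by rewrite /near_pairs; case: ifP => _; rewrite ?mule1 ?mule0.
  have -> : \int[gam]_z (Q y + Q (x + z))%:E = (Q y)%:E + \int[gam]_z (Q (x + z)%R)%:E.
    under eq_integral do rewrite EFinD.
    rewrite ge0_integralD//=.
    - by rewrite integral_cst//= probability_setT mule1.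
    - by rewrite lee_fin Q_ge0.
    - by move=> z _; rewrite lee_fin Q_ge0.
    - by apply/measurable_EFinP; exact: measurable_Q_shift.
  move=> h; have {h} := h _ _ _.
  have HE : weighted_kernel x y = K (x - y)%R + (Q y)%:E + (Q x)%:E.
    by rewrite /weighted_kernel [(Q x + Q y)%R]addrC EFinD addeA.
  move=> h; rewrite HE [leRHS]addeAC; apply: leeD2r; rewrite -[leRHS]addeA; apply: h.
  - by apply: measurable_funD => //; exact: measurable_Q_shift.
  - by move=> z; rewrite addr_ge0 ?Q_ge0.
  - move=> z; have := weighted_kernel_ge0 y (x + z)%R; rewrite /weighted_kernel -KN opprB.
    by rewrite [in K _]addrAC.
have mV (x : T) : measurable_fun setT
  (fun y : T => \int[gam]_z weighted_kernel y (x + z)%R).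
  apply: (@measurable_fun_fubini_tonelli_F _ _ T T R gam
    (fun u : T * T => weighted_kernel u.1 (x + u.2)%R)); first exact: mHs.
  by move=> u; exact: weighted_kernel_ge0.
have mG1 (x : T) : measurable_fun setT (fun y : T => c%:E * (near_pairs S x y)%:E).
  by apply: (measurableT_comp (f := fun u : T * T => c%:E * (near_pairs S u.1 u.2)%:E)
   (g := pair x) mG (pair1_measurable x)).
have mN1 (x : T) : measurable_fun setT (fun y : T => (near_pairs S x y)%:E).
  apply/measurable_EFinP.
  by apply: (measurableT_comp (f := fun u : T * T => near_pairs S u.1 u.2)
   (g := pair x) (measurable_near_pairs S) (pair1_measurable x)).
have mNI : measurable_fun setT (fun x : T => \int[be]_y (near_pairs S x y)%:E).
  apply: (@measurable_fun_fubini_tonelli_F _ _ T T R be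
    (fun u : T * T => (near_pairs S u.1 u.2)%:E)).
    by apply/measurable_EFinP; exact: measurable_near_pairs.
  by move=> u; rewrite lee_fin near_pairs_ge0.
have NI0 x : 0 <= \int[be]_y (near_pairs S x y)%:E.
  by apply: integral_ge0 => y _; rewrite lee_fin near_pairs_ge0.
have VE x : \int[gam]_z weighted_potential be (x + z)%R =
  \int[be]_y \int[gam]_z weighted_kernel y (x + z)%R.
  apply: esym; rewrite /weighted_potential.
  apply: (@fubini_tonelli _ _ T T R be gam
    (fun u : T * T => weighted_kernel u.1 (x + u.2)%R)).
    exact: mHs.
  by move=> u; exact: weighted_kernel_ge0.
have pt1 x : \int[gam]_z weighted_potential be (x + z)%R + c%:E *
  (\int[be]_y (near_pairs S x y)%:E) + (Q x)%:E
    <= weighted_potential be x + \int[gam]_z (Q (x + z)%R)%:E.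
  have -> : \int[gam]_z weighted_potential be (x + z)%R + c%:E *
    (\int[be]_y (near_pairs S x y)%:E) + (Q x)%:E =
    \int[be]_y (\int[gam]_z weighted_kernel y (x + z)%R + c%:E * (near_pairs S x y)%:E +
      (Q x)%:E).
    rewrite [RHS]ge0_integralD//=.
    - rewrite integral_cst//= probability_setT mule1 [in RHS]ge0_integralD//=.
      + rewrite [in RHS]ge0_integralZl//=; first by rewrite VE.
        by move=> y _; rewrite lee_fin near_pairs_ge0.
      + by move=> y _; apply: integral_ge0 => z _; exact: weighted_kernel_ge0.
    - by move=> y _; rewrite adde_ge0//; apply: integral_ge0 => z _; exact:
      weighted_kernel_ge0.
    - exact: emeasurable_funD.
    - by rewrite lee_fin Q_ge0.
  have -> : weighted_potential be x + \int[gam]_z (Q (x + z)%R)%:E =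
    \int[be]_y (weighted_kernel y x + \int[gam]_z (Q (x + z)%R)%:E).
    rewrite [RHS]ge0_integralD//=.
    - by rewrite integral_cst//= probability_setT mule1.
    - by move=> y _; exact: weighted_kernel_ge0.
    - exact: measurable_weighted_kernel_left.
  apply: ge0_le_integral => //.
  - move=> y _; apply: adde_ge0; last by rewrite lee_fin Q_ge0.
    by apply: adde_ge0 => //; apply: integral_ge0 => z _; exact: weighted_kernel_ge0.
  - by apply: emeasurable_funD => //; exact: emeasurable_funD.
  - by apply: emeasurable_funD => //; exact: measurable_weighted_kernel_left.
  - by move=> y _; rewrite (weighted_kernel_sym y x); exact: pt.
have mVb : measurable_fun setT (fun x : T => \int[gam]_z weighted_potential be (x + z)%R).
  apply: (@measurable_fun_fubini_tonelli_F _ _ T T R gam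
    (fun u : T * T => weighted_potential be (u.1 + u.2)%R)).
    exact: (measurableT_comp (f := weighted_potential be : T -> \bar R)
      (g := fun u : T * T => (u.1 + u.2)%R : T) (measurable_weighted_potential be)
        (@measurable_addrV R d)).
  by move=> u; exact: weighted_potential_ge0.
have Vb0 x : 0 <= \int[gam]_z weighted_potential be (x + z)%R by apply:
  integral_ge0 => z _; exact: weighted_potential_ge0.
rewrite /cross_energy (nuE _ (weighted_potential_ge0 be)
  (measurable_weighted_potential be)).
rewrite {2}/second_moment (nuE (EFin \o Q) Q0 mQ).
rewrite /pair_mass -ge0_integralZl//.
have cN0 x : 0 <= c%:E * \int[be]_y (near_pairs S x y)%:E by rewrite mule_ge0.
have mcN : measurable_fun setT (fun x : T => c%:E * \int[be]_y (near_pairs S x y)%:E).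
  exact: measurable_funeM.
rewrite -(ge0_integralD mu measurableT (fun x _ => Vb0 x) mVb (fun x _ => cN0 x) mcN).
rewrite /second_moment -(ge0_integralD mu measurableT _ _ (fun x _ => Q0 x) mQ);
  last 2 first.
- by move=> x _; apply: adde_ge0.
- exact: emeasurable_funD.
rewrite -(ge0_integralD mu measurableT (fun x _ => weighted_potential_ge0 be x)
  (measurable_weighted_potential be)
  (fun x _ => M0 x) mM).
apply: ge0_le_integral => //.
- by move=> x _; apply: adde_ge0 => //; apply: adde_ge0.
- by apply: emeasurable_funD => //; exact: emeasurable_funD.
- by apply: emeasurable_funD => //; exact: measurable_weighted_potential.
Qed.

End smoothing.

Section thin_sets.
Context {R : realType} {d : nat}.
Notation T := (borelRd R d).
Implicit Types (mu nu : probRd R d).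

(** Convolution with a Gaussian lowers the mutual energy with [mu] by a multiple
    of [gain S] times the mass of the near pairs, and raises the second moment by at most
    [d S]. Stationarity forbids a net decrease of the slope, and [gain S] is of
    order [S ^ (1 - d / 2)]. *)
Lemma pair_mass_bound mu : (2 <= d)%N -> finite_energy mu ->
  (forall nu, finite_energy nu -> cross_energy mu nu < +oo ->
    (slope mu mu <= slope mu nu)%R) ->
  exists2 C : R, (0 <= C)%R &
    forall S, (0 < S)%R -> pair_mass mu mu S <= (C * (Num.sqrt S) ^+ d)%:E.
Proof.
move=> d2 [qmu emu] bmin.
have [c c0 Kc] := @K_gaussian R d d2.
exists (d%:R * expR 2 / c)%R; first by rewrite divr_ge0 ?mulr_ge0 ?expR_ge0// ltW.
move=> S S0.
have [gam gamS] := @gaussian_vector R d S S0.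
have [nu nuE] := convolution_probability mu gam.
have g0 := @gain_gt0 R d S S0.
have cg0 : (0 < c * gain (d := d) S)%R by rewrite mulr_gt0.
have KP : forall (P : T -> R) x,
    measurable_fun setT P -> (forall z, 0 <= P z)%R ->
    (forall z, 0 <= K (x + z)%R + (P z)%:E) ->
    \int[gam]_z (K (x + z)%R + (P z)%:E) +
      (if (Q x <= S)%R then (c * gain (d := d) S)%R else 0%R)%:E
      <= K x + \int[gam]_z (P z)%:E.
  by move=> P x; exact: Kc.
have conv be := @convolution_energy R d _ S gam mu nu be S0 gamS (ltW cg0) KP nuE.
have pm0 be : 0 <= (c * gain (d := d) S)%:E * pair_mass be mu S.
  rewrite mule_ge0 ?lee_fin ?(ltW cg0)//; apply: integral_ge0 => x _.
  by apply: integral_ge0 => y _; rewrite lee_fin near_pairs_ge0.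
have mQ : measurable_fun setT (EFin \o Q : T -> \bar R).
  by apply/measurable_EFinP; exact: measurable_Q.
have Q0 (x : T) : 0 <= (EFin \o Q) x by rewrite lee_fin Q_ge0.
have qnu_le : second_moment nu <= second_moment mu + (d%:R * S)%:E.
  rewrite /second_moment (nuE (EFin \o Q) Q0 mQ).
  have -> : \int[mu]_x (Q x)%:E + (d%:R * S)%:E = \int[mu]_x ((Q x)%:E + (d%:R * S)%:E).
    rewrite ge0_integralD//=.
    - by rewrite integral_cst//= probability_setT mule1.
    - by move=> x _; exact: Q0.
    - by move=> x _; rewrite lee_fin mulr_ge0 ?(ltW S0).
  apply: ge0_le_integral => //.
  - by move=> x _; apply: integral_ge0 => z _; rewrite lee_fin Q_ge0.
  - apply: (@measurable_fun_fubini_tonelli_F _ _ T T R gam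
      (fun u : T * T => (Q (u.1 + u.2)%R)%:E)).
      apply/measurable_EFinP.
      exact: (measurableT_comp (f := Q : T -> R)
        (g := fun u : T * T => (u.1 + u.2)%R : T) (@measurable_Q R d)
          (@measurable_addrV R d)).
    by move=> u; rewrite lee_fin Q_ge0.
  - exact: emeasurable_funD.
  - by move=> x _; rewrite -EFinD; exact: gaussian_moment.
have qnu : second_moment nu < +oo.
  by apply: le_lt_trans qnu_le _; rewrite (second_momentK qmu) -EFinD ltry.
have conv_lty be : cross_energy be mu < +oo -> cross_energy be nu < +oo.
  move=> h; apply: le_lt_trans (_ : cross_energy be mu + second_moment nu < +oo).
    apply: le_trans (conv be); rewrite -addeA leeDl// adde_ge0 ?second_moment_ge0//.
  by rewrite (second_momentK qnu) lte_add_pinfty// ltry.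
have emunu := conv_lty _ emu.
have enunu : cross_energy nu nu < +oo by apply: conv_lty; rewrite cross_energy_sym.
have := bmin nu (conj qnu enunu) emunu; rewrite /slope => hb.
have := conv mu.
have [r pmr] : exists r, pair_mass mu mu S = r%:E.
  have : (c * gain (d := d) S)%:E * pair_mass mu mu S < +oo.
    apply: le_lt_trans (_ : cross_energy mu mu + second_moment nu < +oo).
      apply: le_trans (conv mu); rewrite addeAC leeDr// adde_ge0 ?second_moment_ge0
        ?cross_energy_ge0//.
    by rewrite (second_momentK qnu) lte_add_pinfty// ltry.
  have : 0 <= pair_mass mu mu S.
    apply: integral_ge0 => x _.
    by apply: integral_ge0 => y _; rewrite lee_fin near_pairs_ge0.
  case: (pair_mass mu mu S) => [r _ _|_|//]; first by exists r.
  by rewrite gt0_muley.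
rewrite pmr.
have -> : cross_energy mu nu =
  (fine (cross_energy mu nu))%:E by rewrite fineK// ge0_fin_numE ?cross_energy_ge0.
have -> : cross_energy mu mu =
  (fine (cross_energy mu mu))%:E by rewrite fineK// ge0_fin_numE ?cross_energy_ge0.
have h1 : (fine (second_moment nu) <= fine (second_moment mu) + d%:R * S)%R.
  by rewrite -lee_fin EFinD -(second_momentK qmu) -(second_momentK qnu).
rewrite (second_momentK qmu) (second_momentK qnu) => h2'.
have {h2'} h2 : (fine (cross_energy mu nu) + c * gain (d := d) S * r + fine
  (second_moment mu) <=
  fine (cross_energy mu mu) + fine (second_moment nu))%R by rewrite -lee_fin.
have {}hb : (2 * (c * gain (d := d) S * r) <= d%:R * S)%R.
  move: hb h1 h2.
  move: (fine (cross_energy mu mu)) (fine (cross_energy mu nu))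
    (fine (second_moment mu)) (fine (second_moment nu)) (c * gain S * r)%R (d%:R * S)%R
      => *; lra.
have sd0 : (0 < Num.sqrt S ^+ d)%R by rewrite exprn_gt0// sqrtr_gt0.
have : (c * expR (- 2) * r <= d%:R * Num.sqrt S ^+ d)%R.
  rewrite -(ler_pM2r S0) -(ler_pM2r (_ : 0 < (Num.sqrt S)^-1 ^+ d)%R); last first.
    by rewrite exprn_gt0// invr_gt0 sqrtr_gt0.
  rewrite -[X in (_ <= X)%R]mulrA [(S * _)%R]mulrC mulrA -[(d%:R * _ * _)%R]mulrA -exprMn.
  rewrite mulfV ?expr1n ?mulr1 ?gt_eqF ?sqrtr_gt0//.
  apply: le_trans hb; rewrite le_eqVlt; apply/orP; left; apply/eqP.
  by rewrite /gain; field.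
rewrite expRN => h; rewrite lee_fin mulrAC ler_pdivlMr//.
have e2 := expR_gt0 (2 : R)%R.
rewrite -(ler_pM2l e2) in h.
apply: le_trans (le_trans h _); rewrite le_eqVlt; apply/orP; left; apply/eqP.
  by field; rewrite gt_eqF.
by ring.
Qed.

End thin_sets.

(** * Thin sets are null for stationary measures *)

Section thin_null.
Context {R : realType} {d : nat}.
Notation T := (borelRd R d).
Implicit Types (mu nu : probRd R d).

(** Two points of the same cell form a near pair. *)
Lemma pair_mass_cells mu (S : R) (N : nat) (P : nat -> set T) :
  (forall j, measurable (P j)) -> trivIset setT P ->
  (forall j x y, (j < N)%N -> P j x -> P j y -> Q (x - y) <= S)%R ->
  (\sum_(j < N) fine (mu (P j)) ^+ 2)%:E <= pair_mass mu mu S.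
Proof.
move=> mP tP PS.
have mi j : measurable_fun setT (\1_(P j) : T -> R) by exact: measurable_indic.
have inner x : \int[mu]_y (\sum_(j < N) \1_(P j) x * \1_(P j) y)%:E =
    (\sum_(j < N) \1_(P j) x * fine (mu (P j)))%:E.
  under eq_integral do rewrite -sumEFin.
  rewrite ge0_integral_sum//.
  - rewrite -sumEFin; apply: eq_bigr => j _.
    under eq_integral do rewrite EFinM.
    rewrite ge0_integralZl//=.
    + rewrite integral_indic// setIT EFinM fineK//; exact: fin_num_measure.
    + exact/measurable_EFinP.
  - move=> j; apply/measurable_EFinP; exact: measurable_funM.
have -> : (\sum_(j < N) fine (mu (P j)) ^+ 2)%:E =
    \int[mu]_x \int[mu]_y (\sum_(j < N) \1_(P j) x * \1_(P j) y)%:E.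
  under eq_integral do rewrite inner -sumEFin.
  rewrite ge0_integral_sum//.
  - rewrite -sumEFin; apply: eq_bigr => j _.
    under eq_integral do rewrite EFinM muleC.
    rewrite ge0_integralZl//=.
    + rewrite integral_indic// setIT expr2 EFinM fineK//; exact: fin_num_measure.
    + exact/measurable_EFinP.
    + by rewrite lee_fin fine_ge0.
  - move=> j; apply/measurable_EFinP; exact: measurable_funM.
  - by move=> j x _; rewrite lee_fin mulr_ge0// fine_ge0.
apply: ge0_le_integral => //.
- move=> x _; apply: integral_ge0 => y _; rewrite lee_fin; apply: sumr_ge0 => j _.
  by rewrite mulr_ge0.
- rewrite (_ : (fun _ => _) = fun x :
  T => (\sum_(j < N) \1_(P j) x * fine (mu (P j)))%:E); last first.
    by apply/funext => x; rewrite inner.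
  apply/measurable_EFinP; apply: measurable_sum => j; exact: measurable_funM.
- apply: (@measurable_fun_fubini_tonelli_F _ _ T T R mu
    (fun u : T * T => (near_pairs S u.1 u.2)%:E)).
    by apply/measurable_EFinP; exact: measurable_near_pairs.
  by move=> u; rewrite lee_fin near_pairs_ge0.
move=> x _; apply: ge0_le_integral => //.
- by move=> y _; rewrite lee_fin; apply: sumr_ge0 => j _; rewrite mulr_ge0.
- by apply/measurable_EFinP; apply: measurable_sum => j; exact: measurable_funM.
- apply/measurable_EFinP.
  exact: (measurableT_comp (f := fun u : T * T => near_pairs S u.1 u.2)
   (g := pair x) (measurable_near_pairs S) (pair1_measurable x)).
move=> y _; rewrite lee_fin.
have [[j jN]|nex] := pselect (exists j : 'I_N, P j x); last first.
  rewrite big1 ?near_pairs_ge0// => j _; rewrite indicE memNset ?mul0r//.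
  by move=> Pjx; apply: nex; exists j.
rewrite (bigD1 j)//= big1 ?addr0; last first.
  move=> i ij; rewrite [\1_(P i) x]indicE memNset ?mul0r// => Pix.
  have := tP i j Logic.I Logic.I (ex_intro _ x (conj Pix jN)) => /val_inj ijE.
  by rewrite ijE eqxx in ij.
rewrite [\1_(P j) x]indicE mem_set// mul1r indicE.
have [yP|_] := boolP (y \in P j); last exact: near_pairs_ge0.
by rewrite /near_pairs (PS j)//; exact: set_mem.
Qed.

(** A quantitative form of having dimension at most [d - 1]. *)
Definition thin (E : set T) := exists B : R, [/\ (0 < B)%R &
  forall n : nat, exists N (P : nat -> set T), [/\ (N%:R <= B * n.+1%:R ^+ d.-1)%R,
    (forall j, measurable (P j)),
    E `<=` \bigcup_(j in [set j | (j < N)%N]) P j &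
    (forall j x y, (j < N)%N -> P j x -> P j y -> Q (x - y) <= (B / n.+1%:R) ^+ 2)%R]].

(** By Cauchy-Schwarz over the [N] cells,
    [mu E ^+ 2 <= N * \sum_j mu (P j) ^+ 2], which is of order
    [n ^ (d - 1) * n ^ (- d)]. The inequality is used in the linearized form
    [2 t p <= p ^ 2 + t ^ 2] for each cell. *)
Lemma thin_null mu (E : set T) : (0 < d)%N ->
  (exists2 C : R, (0 <= C)%R &
    forall S, (0 < S)%R -> pair_mass mu mu S <= (C * (Num.sqrt S) ^+ d)%:E) ->
  measurable E -> thin E -> mu E = 0.
Proof.
move=> d0 [C C0 hC] mE [B [B0 hB]].
have mEfin : mu E \is a fin_num by exact: fin_num_measure.
set p := fine (mu E).
have p0 : (0 <= p)%R by rewrite fine_ge0.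
suff p_le : (p <= 0)%R.
  by rewrite -(fineK mEfin) -/p; congr EFin; apply/eqP; rewrite eq_le p_le p0.
have key (L : R) n : (0 < L)%R -> (2 * L * p <= C * B ^+ d + B * L ^+ 2 / n.+1%:R)%R.
  move=> L0; have [N [P [NB mP EP PS]]] := hB n.
  set v : R := n.+1%:R in NB PS *; have v0 : (0 < v)%R by rewrite ltr0n.
  pose D := seqDU P.
  have mD j : measurable (D j).
    by apply: measurableD => //; exact: bigsetU_measurable.
  have tD : trivIset setT D by exact: trivIset_seqDU.
  have DS j x y : (j < N)%N -> D j x -> D j y -> (Q (x - y) <= (B / v) ^+ 2)%R.
    by move=> jN [Px _] [Py _]; exact: PS jN Px Py.
  have Bv0 : (0 < B / v)%R by rewrite divr_gt0.
  have := le_trans (pair_mass_cells mu mD tD DS) (hC _ (exprn_gt0 2 Bv0)).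
  rewrite lee_fin sqrtr_sqr (ger0_norm (ltW Bv0)) => h.
  have pD : (p <= \sum_(j < N) fine (mu (D j)))%R.
    rewrite -lee_fin -sumEFin fineK//.
    under eq_bigr do rewrite fineK ?fin_num_measure//.
    apply: (@le_trans _ _ (mu (\big[setU/set0]_(j < N) D j))); last first.
      by rewrite measure_bigsetU.
    apply: le_measure; rewrite ?inE//; first exact: bigsetU_measurable.
    rewrite -bigsetU_seqDU => x /EP [j jN Pj]; by rewrite -bigcup_mkord; exists j.
  (* At this scale the second term is negligible for large v, since there are of
     order v ^ (d - 1) cells; L is sent to infinity afterwards. *)
  pose t := (L / v ^+ d)%R.
  have t0 : (0 < t)%R by rewrite divr_gt0// exprn_gt0.
  have h2 : (2 * t * p <= \sum_(j < N) fine (mu (D j)) ^+ 2 + N%:R * t ^+ 2)%R.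
    apply: (@le_trans _ _ (\sum_(j < N) (fine (mu (D j)) ^+ 2 + t ^+ 2)))%R; last first.
      by rewrite big_split/= sumr_const card_ord -[X in (_ + X)%R]mulr_natl.
    apply: (@le_trans _ _ (\sum_(j < N) (2 * t * fine (mu (D j)))))%R.
      by rewrite -mulr_sumr; apply: ler_wpM2l => //; lra.
    apply: ler_sum => j _; have := sqr_ge0 (fine (mu (D j)) - t)%R.
    by move: (fine _) => w; nra.
  have h3 : (2 * t * p <= C * (B / v) ^+ d + B * v ^+ d.-1 * t ^+ 2)%R.
    apply: le_trans h2 _; apply: lerD => //.
    by rewrite ler_wpM2r// sqr_ge0.
  have vd : (0 < v ^+ d)%R by rewrite exprn_gt0.
  rewrite -(ler_pM2r vd) in h3.
  apply: le_trans (le_trans h3 _); rewrite le_eqVlt; apply/orP; left; apply/eqP.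
    by rewrite /t; field; rewrite gt_eqF.
  have -> : (v ^+ d.-1 = v ^+ d / v)%R.
    by rewrite -[in RHS](prednK d0) exprS mulrC mulKf ?gt_eqF.
  by rewrite expr_div_n /t; field; rewrite !gt_eqF.
have key2 (L : R) : (0 < L)%R -> (2 * L * p <= C * B ^+ d)%R.
  move=> L0; apply: (@ler_add_divn _ _ _ (B * L ^+ 2)%R) => M M0.
  have [n nM] : exists n : nat, (M <= n.+1%:R)%R.
    exists (Num.truncn M); exact/ltW/truncnS_gt.
  apply: le_trans (key L n L0) _; rewrite lerD2l.
  apply: ler_wpM2l; first by rewrite mulr_ge0 ?sqr_ge0// ltW.
  by rewrite lef_pV2 ?posrE ?ltr0n.
apply: (@ler_add_divn _ _ _ (C * B ^+ d / 2)%R) => L L0.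
by rewrite add0r ler_pdivlMr//; have := key2 L L0; lra.
Qed.

End thin_null.

(** * Curves and surfaces are thin *)

Section curve.
Context {R : realType} {d : nat}.
Notation T := (borelRd R d).
Implicit Types (c : R -> 'rV[R]_d).

Lemma norm_rV (x : 'rV[R]_d) (r : R) : (0 <= r)%R ->
  (`|x| <= r)%R <-> (forall i, `|x ord0 i| <= r)%R.
Proof.
move=> r0; rewrite /Num.norm/= mx_normrE; split=> [h i|h].
  by apply: le_trans h; apply: (le_bigmax _ _ (ord0, i)).
by apply/bigmax_leP; split => // -[i j] _ /=; rewrite (ord1 i); exact: h.
Qed.

Lemma coord_le_enorm (x : 'rV[R]_d) i : (`|x ord0 i| <= enorm x)%R.
Proof.
rewrite -(ger0_norm (enorm_ge0 x)) -ler_sqr ?nnegrE// !real_normK ?num_real//.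
rewrite -/(Q x) Q_sum (bigD1 i)//= lerDl sumr_ge0// => j _; exact: sqr_ge0.
Qed.

Lemma Q_le_coord (x : 'rV[R]_d) (r : R) : (forall i, `|x ord0 i| <= r)%R ->
  (Q x <= d%:R * r ^+ 2)%R.
Proof.
move=> h; rewrite Q_sum.
apply: (@le_trans _ _ (\sum_(i < d) r ^+ 2)%R); last first.
  by rewrite sumr_const card_ord mulr_natl.
apply: ler_sum => i _; rewrite -real_normK ?num_real//.
by apply: lerXn2r; rewrite ?nnegrE// (le_trans _ (h i)).
Qed.

(** The mean value theorem for each coordinate, whose derivative is at most the
    speed. *)
Lemma curve_lipschitz c : (forall t, derivable c t 1%R) ->
  (forall t, enorm (derive1 c t) = 1%R) ->
  forall s t i, (`|c t ord0 i - c s ord0 i| <= `|t - s|)%R.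
Proof.
move=> dc c1 s t i.
wlog st : s t / (s < t)%R.
  move=> h; have [st|st|->] := ltgtP s t; first exact: h.
  - by rewrite distrC [leRHS]distrC; exact: h.
  - by rewrite !subrr.
pose f u := c u ord0 i.
have df u : is_derive u (1%R : R) f ((derive1 c u) ord0 i).
  have h : derivable f u 1%R by have /derivable_mxP := dc u; apply.
  apply: DeriveDef => //.
  by rewrite derive1E (derive_mx (dc u)) mxE.
have [z _ ->] := MVT st (fun x _ => df x)
  (derivable_within_continuous (fun x _ => @ex_derive _ _ _ _ _ _ _ (df x))).
rewrite normrM -[leRHS]mul1r ler_wpM2r//.
by rewrite -(c1 z) coord_le_enorm.
Qed.

Lemma curve_continuous c : (forall t, derivable c t 1%R) -> continuous c.
Proof. by move=> dc t; apply/differentiable_continuous/derivable1_diffP. Qed.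

Lemma measurable_preimage_continuous c (A : set T) : continuous c ->
  measurable A -> measurable (c @^-1` A : set (measurableTypeR R)).
Proof.
move=> cc mA.
have mc : measurable_fun setT (c : measurableTypeR R -> T).
  apply: measurable_coords => i; apply: continuous_measurable_fun => t.
  apply: (@continuous_comp _ _ _ c (fun M : 'rV[R]_d => M ord0 i)); first exact: cc.
  exact: coord_continuous.
by rewrite -[X in measurable X]setTI; exact: mc.
Qed.

Lemma curve_piece_closed c (p r : R) : continuous c ->
  closed (c @` `[p, r]%classic).
Proof.
move=> cc; apply: compact_closed; first exact: norm_hausdorff.
apply: continuous_compact; last exact: segment_compact.
exact: continuous_subspaceT.
Qed.

(** A visit to the unit ball around [x] at parameter [t] costs a unit of
    length inside the ball of radius [2]. The length inside the latter being finite,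
    visits at large parameters are impossible, and near [x] the curve is a
    compact arc. *)
Lemma smooth_curve_closed (G : set 'rV[R]_d) : smooth_curve G -> closed G.
Proof.
move=> [c [alpha [_ [dc _] c1 [_ cG] cfin]]].
have cc := curve_continuous dc.
have lip := curve_lipschitz dc c1.
move=> x clx.
have Bc : compact (closed_ball x 2%R).
  apply: bounded_closed_compact; last exact: closed_ball_closed.
  exists (`|x| + 2)%R; split => [|r xr y]; first exact: num_real.
  rewrite closed_ballE// /closed_ball_/= => xy; apply: le_trans (ltW xr).
  by rewrite -lerBlDl (le_trans (lerB_dist _ _))// distrC.
pose Sx := c @^-1` (closed_ball x 2%R).
have Slt : lebesgue_measure Sx < +oo by exact: cfin.
have mS : measurable (Sx : set (measurableTypeR R)).
  apply: measurable_preimage_continuous => //.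
  by apply: measurable_closed; exact: closed_ball_closed.
pose F (n : nat) : set R := Sx `&` [set t | (n%:R <= `|t|)%R].
have mF n : measurable (F n : set (measurableTypeR R)).
  apply: measurableI => //.
  rewrite (_ : [set t | _] = (fun t : R => `|t|%R) @^-1`
    `[n%:R, +oo[%classic); last first.
    by apply/seteqP; split => t /=; rewrite in_itv/= andbT.
  rewrite -[X in measurable X]setTI.
  by have mn : measurable_fun setT (fun t : R => `|t|%R) by []; exact: mn.
have F0 : \bigcap_n F n = set0.
  apply/seteqP; split => // t /(_ (Num.truncn `|t|).+1 Logic.I) [_ /=].
  by rewrite leNgt truncnS_gt.
have cvgF : (lebesgue_measure \o F) n @[n --> \oo] --> 0.
  rewrite -[X in _ --> X](measure0 (@lebesgue_measure R)) -F0.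
  apply: nonincreasing_cvg_mu => //.
  - apply: le_lt_trans Slt; apply: le_measure; rewrite ?inE//.
    by move=> t [].
  - by rewrite F0.
  - apply/nonincreasing_seqP => n; apply/subsetPset => t [St /= nt]; split => //=.
    by apply: le_trans nt; rewrite ler_nat.
have n1 : nbhs (0 : \bar R) [set y | y < 1].
  by apply: open_nbhs_nbhs; split; [exact: open_ereal_lt_ereal|exact: lte01].
have [M _ /(_ M (leqnn M)) /= FM] := cvgF _ n1.
have bnd t : ball x 1%R (c t) -> (`|t| <= M%:R + 1)%R.
  rewrite -ball_normE /= => xt; rewrite leNgt; apply/negP => Mt.
  (* The unit parameter interval around t is mapped into the ball of radius 2. *)
  have inF s : (`|t - s| <= 1)%R -> F M s.
    move=> ts; split.
      rewrite /Sx /= closed_ballE// /closed_ball_/=.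
      apply: (le_trans (ler_distD (c t) _ _)).
      have : (`|c t - c s| <= 1)%R.
        apply/norm_rV => // i; rewrite !mxE; apply: le_trans ts.
        exact: lip.
      by lra.
    rewrite /=; have := lerB_dist t s; lra.
  have : lebesgue_measure (`[t, (t + 1)%R]%classic : set R) <= lebesgue_measure (F M).
    apply: le_measure; rewrite ?inE// => s /=; rewrite in_itv/= => tts.
    by apply: inF; rewrite distrC ger0_norm; lra.
  rewrite lebesgue_measure_itv/= lte_fin ltrDl ltr01 -EFinB addrC addKr => h.
  by have := le_lt_trans h FM; rewrite ltxx.
have : closure (c @` `[(- (M%:R + 1))%R, (M%:R + 1)%R]%classic) x.
  move=> B nB.
  have nB1 : nbhs x (B `&` ball x 1%R) by apply: filterI => //; exact: nbhsx_ballx.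
  have [y [Gy [By xy]]] := clx _ nB1.
  move: Gy; rewrite -cG => -[t _ tE].
  exists y; split => //; exists t => //=.
  by rewrite in_itv/= -ler_norml; apply: bnd; rewrite tE.
rewrite -(closure_id _).1; last exact: curve_piece_closed.
by move=> [t _ <-]; rewrite -cG; exists t.
Qed.

(** The arc is cut into [n + 1] arcs of equal length. *)
Lemma thin_curve_piece c (m : nat) : d = 2%N -> continuous c ->
  (forall s t i, (`|c t ord0 i - c s ord0 i| <= `|t - s|)%R) ->
  thin (c @` `[(- m.+1%:R)%R, m.+1%:R]%classic : set T).
Proof.
move=> d2 cc lip.
pose L : R := (2 * m.+1%:R)%R.
have L0 : (0 < L)%R by rewrite mulr_gt0// ltr0n.
have L2 : (2 <= L)%R by rewrite /L -[leLHS]mulr1 ler_pM2l// ler1n.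
exists (d%:R * L)%R; split; first by rewrite mulr_gt0// d2.
move=> n; set v : R := n.+1%:R.
have v0 : (0 < v)%R by rewrite ltr0n.
pose a j : R := (- m.+1%:R + j%:R * (L / v))%R.
exists n.+1, (fun j => c @` `[a j, a j.+1]%classic); split.
- have -> : (d.-1 = 1)%N by rewrite d2.
  rewrite expr1 -/v -[leLHS]mul1r ler_wpM2r ?(ltW v0)// (_ : d%:R = 2 :> R)%R;
    first by lra.
  by rewrite d2.
- by move=> j; apply: measurable_closed; exact: curve_piece_closed.
- move=> _ [t /= /[!in_itv]/= /andP[t1 t2] <-].
  have Lv0 : (0 < L / v)%R by rewrite divr_gt0.
  pose y := ((t + m.+1%:R) / (L / v))%R.
  have y0 : (0 <= y)%R by rewrite divr_ge0 ?(ltW Lv0)//; lra.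
  have tE : (t = - m.+1%:R + y * (L / v))%R by rewrite divfK ?gt_eqF//; ring.
  have yv : (y <= v)%R.
    rewrite ler_pdivrMr// mulrC divfK ?gt_eqF// /L; lra.
  have [yv'|vy] := ltP y v.
    exists (Num.truncn y).
      by rewrite /= -(ltr_nat R); apply: le_lt_trans yv'; rewrite truncn_le.
    exists t => //=; rewrite in_itv/= /a tE !lerD2l !ler_pM2r//.
    by apply/andP; split; [rewrite truncn_le|exact/ltW/truncnS_gt].
  exists n => //=; exists t => //=; rewrite in_itv/= /a tE !lerD2l !ler_pM2r//.
  have -> : y = v by apply/eqP; rewrite eq_le yv vy.
  by rewrite /v ler_nat leqnSn lexx.
- move=> j _ _ _ [s /= /[!in_itv]/= sI <-] [t /= /[!in_itv]/= tI <-].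
  have st : (`|s - t| <= L / v)%R.
    have aE : (a j.+1 = a j + L / v)%R by rewrite /a -[j.+1%:R]natr1; ring.
    rewrite ler_norml; move: sI tI; rewrite aE.
    by move: (a j) (L / v)%R => A B sI tI; lra.
  apply: (@le_trans _ _ (d%:R * (L / v) ^+ 2)%R).
    by apply: Q_le_coord => i; rewrite !mxE; apply: le_trans st; exact: lip.
  rewrite -mulrA [leRHS]exprMn ler_wpM2r ?sqr_ge0// expr2 ler_peMr//.
  by rewrite ler1n d2.
Qed.

End curve.

Section surface.
Context {R : realType} {d : nat}.
Notation T := (borelRd R d).
Implicit Types (phi : 'rV[R]_d -> R) (x y z v : 'rV[R]_d).

Lemma derive_grad phi x v : differentiable phi x ->
  'D_v phi x = (\sum_(i < d) v ord0 i * grad phi x ord0 i)%R.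
Proof.
move=> dphi; rewrite deriveE// {1}(row_sum_delta v) linear_sum/=.
by apply: eq_bigr => i _; rewrite linearZ/= /grad mxE deriveE.
Qed.

Lemma is_derive_along phi y v (t : R) : differentiable phi (y + t *: v)%R ->
  is_derive t (1%R : R) (fun s => phi (y + s *: v)%R) ('D_v phi (y + t *: v)%R).
Proof.
move=> dphi.
have E : (fun h : R => h^-1 *: (phi (y + (h *: (1%R : R) + t) *: v) - phi (y + t *: v)))%R
   = (fun h : R => h^-1 *: (phi (h *: v + (y + t *: v)) - phi (y + t *: v)))%R.
  apply/funext => h; congr (_ *: (phi _ - _))%R.
  by rewrite scalerDl /GRing.scale /= mulr1 addrCA.
have dv : derivable phi (y + t *: v)%R v by exact: diff_derivable.
by apply: DeriveDef; rewrite /derivable /derive E.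
Qed.

(** Rolle's theorem along a chord with both ends on the level set. *)
Lemma level_set_mvt phi (A : set 'rV[R]_d) y z :
  (forall t : R, (0 <= t <= 1)%R -> A (y + t *: (z - y))%R) ->
  (forall w, A w -> differentiable phi w) ->
  phi y = 0%R -> phi z = 0%R ->
  exists2 w, A w & (\sum_(i < d) (z - y) ord0 i * grad phi w ord0 i = 0)%R.
Proof.
move=> Aseg dphi py pz.
pose f (t : R) := phi (y + t *: (z - y))%R.
have df (t : R) : (0 <= t <= 1)%R ->
  is_derive t (1%R : R) f ('D_(z - y) phi (y + t *: (z - y))%R).
  by move=> t01; apply: is_derive_along; apply: dphi; exact: Aseg.
have f0 : f 0%R = 0%R by rewrite /f scale0r addr0.
have f1 : f 1%R = 0%R by rewrite /f scale1r addrCA subrr addr0.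
have df' (t : R) : t \in `]0%R, 1%R[ ->
  is_derive t (1%R : R) f ('D_(z - y) phi (y + t *: (z - y))%R).
  by rewrite in_itv/= => t01; apply: df; lra.
have fc : {within `[0%R, 1%R], continuous f}.
  apply: derivable_within_continuous => t /[!in_itv]/= t01.
  exact: (@ex_derive _ _ _ _ _ _ _ (df t t01)).
have [t t01] := MVT (@ltr01 R) df' fc.
rewrite f0 f1 !subrr subr0 mulr1 => /esym D0.
have {}t01 : (0 <= t <= 1)%R by move: t01; rewrite in_itv/=; lra.
exists (y + t *: (z - y))%R; first exact: Aseg.
by rewrite -derive_grad//; apply: dphi; exact: Aseg.
Qed.

(** A coordinate [i0] in which the gradient does not vanish at [x] is, on the
    surface near [x], a Lipschitz function of the others: the gradient at some
    point near the chord annihilates the chord, and its [i0]-th component is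
    bounded below. *)
Lemma surface_local_lipschitz (G V : set 'rV[R]_d) phi x :
  G x -> V x -> local_equation G V phi ->
  exists i0 : 'I_d, exists rho L : R, [/\ (0 < rho)%R, (0 <= L)%R &
    forall (r : R) y z, (0 <= r)%R -> (G `&` ball x rho) y -> (G `&` ball x rho) z ->
      (forall j, j != i0 -> `|z ord0 j - y ord0 j| <= r)%R ->
      (`|z ord0 i0 - y ord0 i0| <= L * r)%R].
Proof.
move=> Gx Vx [oV dV nzV GV].
have [i0 gi0] : exists i0, grad phi x ord0 i0 != 0%R.
  apply/not_existsP => h; have := nzV _ Vx; apply/negP; rewrite negbK.
  by apply/eqP/rowP => i; rewrite [RHS]mxE; apply/eqP; have /negP := h i; rewrite negbK.
pose k := `|grad phi x ord0 i0|%R.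
have k0 : (0 < k)%R by rewrite normr_gt0.
have k20 : (0 < k / 2)%R by rewrite divr_gt0.
have [_ cg] := dV x Vx.
have nV : nbhs x V by exact: open_nbhs_nbhs.
have nB : nbhs x (V `&` (grad phi @^-1` ball (grad phi x) (k / 2)%R)).
  by apply: filterI => //; apply: cg; exact: nbhsx_ballx.
have /nbhs_ballP[rho /= rho0 hrho] := nB.
pose M := (`|grad phi x| + k)%R.
have M0 : (0 <= M)%R by rewrite addr_ge0 ?(ltW k0).
exists i0, rho, (d%:R * M / (k / 2))%R; split => //.
  by rewrite divr_ge0 ?(ltW k20)// mulr_ge0.
move=> r y z r0 [Gy By] [Gz Bz] hr.
have py : phi y = 0%R.
  have : (G `&` V) y by split => //; case: (hrho _ By).
  by rewrite GV => -[].
have pz : phi z = 0%R.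
  have : (G `&` V) z by split => //; case: (hrho _ Bz).
  by rewrite GV => -[].
have seg (t : R) : (0 <= t <= 1)%R -> ball x rho (y + t *: (z - y))%R.
  move=> /andP[t0 t1]; move: By Bz; rewrite -ball_normE /= => By Bz.
  have -> : (x - (y + t *: (z - y)) = (1 - t) *: (x - y) + t *: (x - z))%R.
    by rewrite scalerBl scale1r !scalerBr; apply/rowP => i; rewrite !mxE; ring.
  apply: le_lt_trans (ler_normD _ _) _.
  rewrite !normrZ (ger0_norm t0) ger0_norm; last by rewrite subr_ge0.
  have [->|t0'] := eqVneq t 0%R; first by rewrite subr0 mul1r mul0r addr0.
  have tp : (0 < t)%R by rewrite lt0r t0'.
  move: (`|x - y|)%R (`|x - z|)%R By Bz => A B; nra.
have dW w : ball x rho w -> differentiable phi w.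
  by move=> /hrho[Vw _]; case: (dV w Vw).
have [w Bw] := @level_set_mvt phi (ball x rho) y z seg dW py pz.
have [_ /=] := hrho _ Bw; rewrite -ball_normE /= => gw.
have gj j : (`|grad phi x ord0 j - grad phi w ord0 j| < k / 2)%R.
  apply: le_lt_trans gw.
  have /(norm_rV _ (normr_ge0 _)) := lexx `|grad phi x - grad phi w|%R.
  by move=> /(_ j); rewrite !mxE.
have gxj j : (`|grad phi x ord0 j| <= `|grad phi x|)%R.
  by have /(norm_rV _ (normr_ge0 _)) := lexx `|grad phi x|%R; exact.
have gwj j : (`|grad phi w ord0 j| <= M)%R.
  have := ler_distD (grad phi x ord0 j) (grad phi w ord0 j) 0%R.
  rewrite !subr0 distrC => h; apply: le_trans h _; rewrite /M addrC.
  apply: lerD; first exact: gxj.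
  by apply: (le_trans (ltW (gj j))); lra.
have gi : (k / 2 <= `|grad phi w ord0 i0|)%R.
  have := ler_distD (grad phi w ord0 i0) (grad phi x ord0 i0) 0%R.
  rewrite !subr0 -/k => h; have := gj i0; move: h.
  by move: `|_|%R `|_|%R => A B; lra.
rewrite (bigD1 i0)//= => /eqP; rewrite addr_eq0 => /eqP sE.
have sb : (`|(z - y) ord0 i0 * grad phi w ord0 i0| <= d%:R * (r * M))%R.
  rewrite sE normrN; apply: le_trans (ler_norm_sum _ _ _) _.
  apply: (@le_trans _ _ (\sum_(i < d | i != i0) (r * M))%R).
    apply: ler_sum => j ji0; rewrite normrM.
    apply: ler_pM => //.
    by have := hr j ji0; rewrite !mxE.
  have -> : (d%:R * (r * M) = \sum_(i < d) (r * M))%R.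
    by rewrite sumr_const card_ord mulr_natl.
  rewrite [leRHS](bigD1 i0)//= lerDr; exact: mulr_ge0.
have zyE : ((z - y) ord0 i0 = z ord0 i0 - y ord0 i0)%R by rewrite !mxE.
rewrite normrM zyE in sb.
rewrite mulrAC ler_pdivlMr// -mulrA [(M * r)%R]mulrC.
apply: le_trans sb; exact: ler_wpM2l.
Qed.

(** The coordinates other than [i0] are cut by a grid of step [1 / (n + 1)]; the
    remaining coordinate then varies by at most [L / (n + 1)] in a cell. *)
Lemma thin_surface_local (G V : set 'rV[R]_d) phi x : (0 < d)%N -> closed G ->
  G x -> V x -> local_equation G V phi ->
  exists2 rho : R, (0 < rho)%R & thin (G `&` ball x rho : set T).
Proof.
move=> d0 cG Gx Vx hV.
have [i0 [rho0 [L [rho00 L0 hL]]]] := surface_local_lipschitz Gx Vx hV.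
pose rho := Num.min rho0 (1 / 2)%R.
have rhoP : (0 < rho)%R by rewrite lt_min rho00/=; lra.
exists rho => //.
have rho1 : (rho <= 1 / 2)%R by rewrite ge_min lexx orbT.
have rho2 : (rho <= rho0)%R by rewrite ge_min lexx.
have mGB : measurable (G `&` ball x rho : set T).
  apply: measurableI; first exact: measurable_closed.
  by apply: measurable_open; exact: ball_open.
have d1 : (1 <= d%:R :> R)%R by rewrite ler1n.
exists (d%:R * (1 + L))%R; split; first by rewrite mulr_gt0//; lra.
move=> n; set v : R := n.+1%:R.
have v0 : (0 < v)%R by rewrite ltr0n.
pose u (y : 'rV[R]_d) j := (y ord0 j - x ord0 j + 1 / 2)%R.
pose F := {ffun 'I_d.-1 -> 'I_n.+1}.
pose strip (f : F) l : set T :=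
  [set y | ((f l)%:R / v <= u y (lift i0 l) <= (f l).+1%:R / v)%R].
pose cell (f : F) : set T := (G `&` ball x rho) `&` \bigcap_l strip f l.
have mstrip f l : measurable (strip f l).
  have -> : strip f l = (fun y : T => u y (lift i0 l)) @^-1`
      `[((f l)%:R / v)%R, ((f l).+1%:R / v)%R]%classic.
    by apply/seteqP; split => y /=; rewrite in_itv.
  rewrite -[X in measurable X]setTI.
  have mu : measurable_fun setT (fun y : T => u y (lift i0 l)).
    by do 2! apply: measurable_funD => //; exact: measurable_coord.
  exact: mu.
have mcell f : measurable (cell f).
  apply: measurableI => //; apply: fin_bigcap_measurable => [|l _]; last exact: mstrip.
  exact: finite_finset.
exists (n.+1 ^ d.-1)%N, (fun k => cell (nth [ffun=> ord0] (enum F) k)); split => //.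
- rewrite natrX ler_peMl ?exprn_ge0 ?(ltW v0)//.
  by move: (d%:R : R)%R d1 => D D1; nra.
- move=> y [Gy By].
  have uy j : (0 <= u y j * v < v)%R.
    have := By; move/(ballrV _ _ rhoP)/(_ j) => h.
    have {}h : (`|x ord0 j - y ord0 j| < 1 / 2)%R by apply: lt_le_trans h _.
    rewrite pmulr_lge0// -[ltRHS]mul1r ltr_pM2r// /u.
    by move: h; rewrite ltr_norml => h; lra.
  (* The shift by 1 / 2 in u makes it range between 0 and 1 on the ball. *)
  pose f : F := [ffun l => inord (Num.truncn (u y (lift i0 l) * v))].
  exists (enum_rank f).
    by rewrite /= (leq_trans (ltn_ord _))// card_ffun !card_ord.
  rewrite nth_enum_rank; split => // l _; rewrite /strip /= ffunE.
  have /andP[u0 uv] := uy (lift i0 l).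
  rewrite ler_pdivrMr// ler_pdivlMr// inordK; last first.
    by rewrite -(ltr_nat R); apply: le_lt_trans uv; rewrite truncn_le.
  by rewrite truncn_le// u0; exact/ltW/truncnS_gt.
move=> k y z _; set f := nth _ _ _ => -[[Gy By] sy] [[Gz Bz] sz].
have b0 w : ball x rho w -> ball x rho0 w by exact: le_ball.
have v1 : (0 <= v^-1)%R by rewrite invr_ge0 ltW.
have hj j : j != i0 -> (`|y ord0 j - z ord0 j| <= v^-1)%R.
  rewrite eq_sym => /unlift_some[l -> _].
  have := sy l Logic.I; have := sz l Logic.I; rewrite /strip /u /= -[(f l).+1%:R]natr1.
  rewrite mulrDl (mul1r (v^-1)%R) ler_norml; move: (v^-1)%R (_ / v)%R => w A; lra.
have hi := hL _ z y v1 (conj Gz (b0 _ Bz)) (conj Gy (b0 _ By)) hj.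
apply: (@le_trans _ _ (d%:R * ((1 + L) / v) ^+ 2)%R).
  apply: Q_le_coord => j; rewrite !mxE mulrDl mul1r.
  have [->|ji] := eqVneq j i0; first by apply: (le_trans hi); rewrite lerDr.
  by apply: (le_trans (hj _ ji)); rewrite lerDl mulr_ge0.
rewrite -mulrA [leRHS]exprMn ler_wpM2r ?sqr_ge0// expr2 ler_peMr//.
Qed.

End surface.

Section admissible_null.
Context {R : realType} {d : nat}.
Notation T := (borelRd R d).
Implicit Types (mu nu : probRd R d).

Lemma null_bigcup mu (P : nat -> set T) : (forall n, measurable (P n)) ->
  (forall n, mu (P n) = 0) -> mu (\bigcup_n P n) = 0.
Proof.
move=> mP P0; apply: measure_negligible; first exact: bigcup_measurable.
apply: negligible_bigcup => n; apply/negligibleP; [exact: mP|exact: P0].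
Qed.

(** The Lindelöf argument, with the balls of [rational_balls]. *)
Lemma null_locally mu (E : set T) : measurable E ->
  (forall x : 'rV[R]_d, E x -> exists2 r : R, (0 < r)%R & mu (E `&` ball x r) = 0) ->
  mu E = 0.
Proof.
move=> mE h; have [B hB] := @rational_balls R d.
pose D n : set T := ball (B n).1 (B n).2.
have mD n : measurable (D n) by apply: measurable_open; exact: ball_open.
pose P n := if `[< mu (E `&` D n) = 0 >] then E `&` D n else set0.
have mP n : measurable (P n) by rewrite /P; case: ifP => // _; exact: measurableI.
have EP : E `<=` \bigcup_n P n.
  move=> x Ex; have [r r0 mr] := h x Ex.
  have xr : ball (x : 'rV[R]_d) r x by exact: ballxx.
  have [n [Dx Dr]] := hB _ x (ball_open x r) xr.
  have : mu (E `&` D n) = 0.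
    apply: (subset_measure0 (B := E `&` ball (x : 'rV[R]_d) r)) => //.
    - exact: measurableI.
    - by apply: measurableI => //; apply: measurable_open; exact: ball_open.
    - by move=> y [Ey /Dr].
  by exists n => //; rewrite /P asboolT.
have P0 : mu (\bigcup_n P n) = 0.
  apply: null_bigcup => // n; rewrite /P; case: ifPn => [/asboolP//|_].
  exact: measure0.
by apply: (subset_measure0 (B := \bigcup_n P n)) => //; exact: bigcup_measurable.
Qed.

Lemma admissible_closed (G : set 'rV[R]_d) : admissible_Gamma G -> closed G.
Proof.
by rewrite /admissible_Gamma; case: ifP => _; [exact: smooth_curve_closed|case].
Qed.

(** A measure from which no direction lowers the energy does not charge the curve
    or the surface, which is a countable union of thin pieces. *)
Lemma admissible_null mu (G : set 'rV[R]_d) : (2 <= d)%N -> admissible_Gamma G ->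
  finite_energy mu ->
  (forall nu, finite_energy nu -> cross_energy mu nu < +oo ->
    (slope mu mu <= slope mu nu)%R) ->
  mu (G : set T) = 0.
Proof.
move=> d2 hG fmu bmin; have d0 : (0 < d)%N by exact: ltnW.
have cG := admissible_closed hG.
have null E : measurable E -> thin E -> mu E = 0.
  by move=> mE tE; exact: (thin_null d0 (pair_mass_bound d2 fmu bmin)).
move: hG; rewrite /admissible_Gamma; case: ifP => [/eqP d2' hG|_ [_]].
  have [c [alpha [_ [dc _] c1 [_ rcG] _]]] := hG.
  have cc := curve_continuous dc.
  apply: (subset_measure0 (B := \bigcup_m
      (c @` `[(- m.+1%:R)%R, m.+1%:R]%classic : set T))).
  - exact: measurable_closed.
  - by apply: bigcup_measurable => m _; apply: measurable_closed; exact: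
    curve_piece_closed.
  - rewrite -rcG => _ [t _ <-]; exists (Num.truncn `|t|) => //; exists t => //=.
    by rewrite in_itv/= -ler_norml; exact/ltW/truncnS_gt.
  - apply: null_bigcup => m.
      by apply: measurable_closed; exact: curve_piece_closed.
    apply: null; first by apply: measurable_closed; exact: curve_piece_closed.
    exact: thin_curve_piece d2' cc (curve_lipschitz dc c1).
move=> [n [alpha [_ _ _ hn]]]; apply: null_locally; first exact: measurable_closed.
move=> x Gx; have [V [phi [Vx eqV _]]] := hn x Gx.
have [r r0 tr] := thin_surface_local d0 cG Gx Vx eqV.
exists r => //; apply: null => //; apply: measurableI; first exact: measurable_closed.
by apply: measurable_open; exact: ball_open.
Qed.

End admissible_null.

(** * Semicontinuity of potentials *)

Section kernel_continuity.
Context {R : realType} {d : nat}.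
Notation T := (borelRd R d).
Implicit Types (mu nu : probRd R d) (x y z : 'rV[R]_d).

Lemma Q_continuous : continuous (Q : 'rV[R]_d -> R).
Proof.
have -> : (Q : 'rV[R]_d -> R) = (fun x => \sum_(i < d) x ord0 i ^+ 2)%R.
  by apply/funext => x; exact: Q_sum.
move=> x; apply: (@cvg_big _ _ _ _ _ (@add_continuous _) _ (nbhs x)) => i _.
apply: (@continuous_comp _ _ _ (fun M : 'rV[R]_d => M ord0 i) (fun t : R => t ^+ 2)%R).
  exact: coord_continuous.
exact: exprn_continuous.
Qed.

Lemma enorm_continuous : continuous (@enorm R d).
Proof.
have -> : @enorm R d = Num.sqrt \o Q.
  by apply/funext => x; rewrite /= /Q sqrtr_sqr ger0_norm// enorm_ge0.
move=> x; apply: continuous_comp; first exact: Q_continuous.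
exact: sqrt_continuous.
Qed.

(** Continuity includes the origin, where the value of the kernel is [+oo]. *)
Lemma K_continuous : (2 <= d)%N -> continuous (K : 'rV[R]_d -> \bar R).
Proof.
move=> d2 x; have [->|x0] := eqVneq x 0%R; last first.
  pose k (z : 'rV[R]_d) : R :=
    (if d == 2%N then ln (enorm z)^-1 else (enorm z ^+ (d - 2))^-1)%R.
  have kE z : z != 0%R -> K z = (k z)%:E.
    by move=> z0; rewrite /K (negbTE z0) /k; case: ifP.
  have x1 : (enorm x != 0)%R by rewrite gt_eqF// enorm_gt0.
  have kc : {for x, continuous k}.
    rewrite /k; case: (d == 2%N).
      apply: (@continuous_comp _ _ _ (fun z : 'rV[R]_d => (enorm z)^-1)%R (@ln R)).
        by apply: (@continuousV _ _ (@enorm R d)) => //; exact: enorm_continuous.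
      by apply: continuous_ln; rewrite invr_gt0 enorm_gt0.
    apply: (@continuousV _ _ (fun z : 'rV[R]_d => enorm z ^+ (d - 2))%R).
      by rewrite expf_neq0.
    apply: (@continuous_comp _ _ _ (@enorm R d) (fun t : R => t ^+ (d - 2))%R).
      exact: enorm_continuous.
    exact: exprn_continuous.
  have near0 : \forall z \near x, z != 0%R.
    have o : nbhs (enorm x) [set t | (0 < t)%R].
      by apply: open_nbhs_nbhs; split; [exact: open_gt|rewrite /= enorm_gt0].
    have := @enorm_continuous x _ o; rewrite nbhs_simpl/=; apply: filterS => z /=.
    by rewrite enorm_gt0.
  rewrite /continuous_at kE//; apply: (cvg_EFin (F := nbhs x)).
    by apply: filterS near0 => z /kE ->.
  apply: cvg_trans kc; apply: (near_eq_cvg (F := nbhs x)).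
  by apply: filterS near0 => z /kE /= ->.
have K0 : K (0%R : 'rV[R]_d) = +oo by rewrite /K eqxx.
rewrite /continuous_at K0; apply/(cvgeyPge (F := nbhs (0%R : 'rV[R]_d))) => A.
pose B := (Num.max A 1)%R.
have B1 : (1 <= B)%R by rewrite le_max lexx orbT.
have AB : (A <= B)%R by rewrite le_max lexx.
have o : nbhs (enorm (0%R : 'rV[R]_d)) [set t | (t < expR (- B))%R].
  apply: open_nbhs_nbhs; split; first exact: open_lt.
  by rewrite /= /enorm big1 ?sqrtr0 ?expR_gt0// => i _; rewrite mxE expr0n.
have := @enorm_continuous 0%R _ o; rewrite nbhs_simpl/=; apply: filterS => z /= zB.
apply: (@le_trans _ _ B%:E); first by rewrite lee_fin.
rewrite /K; case: eqP => [_|/eqP z0]; first exact: leey.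
rewrite -enorm_gt0 in z0.
case: ifPn => [_|dn2]; rewrite lee_fin.
  rewrite lnV ?posrE// lerNr -[leRHS]expRK ler_ln ?posrE ?expR_gt0//; exact: ltW.
have e1 : (enorm z <= 1)%R.
  by apply: (le_trans (ltW zB)); rewrite -expR0 ler_expR; lra.
apply: (@le_trans _ _ (enorm z)^-1%R).
  rewrite -[leLHS]invrK lef_pV2 ?posrE ?invr_gt0//; last lra.
  apply: (le_trans (ltW zB)); rewrite expRN lef_pV2 ?posrE ?expR_gt0//; last lra.
  by apply: le_trans (expR_ge1Dx _); lra.
rewrite lef_pV2 ?posrE ?exprn_gt0//.
have -> : (d - 2 = (d - 3).+1)%N by rewrite subnSK// ltn_neqAle eq_sym dn2.
by rewrite exprS ler_piMr ?exprn_ile1// ltW.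
Qed.

Lemma weighted_kernel_cvg x (y_ : nat -> 'rV[R]_d) y : (2 <= d)%N -> y_ @ \oo --> y ->
  (fun n => weighted_kernel x (y_ n)) @ \oo --> weighted_kernel x y.
Proof.
move=> d2 yy; rewrite /weighted_kernel.
apply: cvgeD.
- by rewrite fin_num_adde_defl.
- apply: (cvg_comp (fun n => x - y_ n)%R K _ (@K_continuous d2 (x - y)%R)).
  by apply: cvgB => //; exact: cvg_cst.
- apply: cvg_EFin; first exact: nearW.
  apply: cvgD; first exact: cvg_cst.
  exact: (cvg_comp y_ Q yy (@Q_continuous y)).
Qed.

(** Fatou's lemma, the weighted kernel being continuous and nonnegative. *)
Lemma weighted_potential_lsc mu x (y_ : nat -> 'rV[R]_d) (C : (\bar R)^nat) (l : \bar R) :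
  (2 <= d)%N -> y_ @ \oo --> x -> C @ \oo --> l ->
  (forall n, weighted_potential mu (y_ n) <= C n) -> weighted_potential mu x <= l.
Proof.
move=> d2 yx Cl VC; apply: (@fatou_cvg _ _ T mu (fun n u => weighted_kernel u (y_ n))
  (fun u => weighted_kernel u x) C l _ _ _ Cl VC).
- by move=> n; exact: measurable_weighted_kernel_left.
- by move=> n u; exact: weighted_kernel_ge0.
- by move=> u; exact: weighted_kernel_cvg.
Qed.

End kernel_continuity.

(** * Averages over conditioned measures *)

Section strict_comparison.
Context {R : realType} dd (T : measurableType dd).
Variable m : {measure set T -> \bar R}.

Lemma integral_conull (C : set T) (f : T -> \bar R) : measurable C ->
  m (~` C) = 0 -> measurable_fun setT f -> (forall x, 0 <= f x) ->
  \int[m]_x f x = \int[m]_(x in C) f x.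
Proof.
move=> mC C0 mf f0.
rewrite (@ge0_negligible_integral _ _ _ m setT (~` C))//; last exact: measurableC.
by rewrite setTD setCK.
Qed.

(** The set [D] is exhausted by the sets where [g + 1 / n <= h], one of which has
    positive mass. *)
Lemma integral_lt (C D : set T) (g h : T -> \bar R) :
  measurable C -> m (~` C) = 0 -> measurable D -> D `<=` C -> 0 < m D ->
  measurable_fun setT g -> measurable_fun setT h ->
  (forall x, 0 <= g x) -> (forall x, 0 <= h x) -> \int[m]_x g x < +oo ->
  (forall x, C x -> g x <= h x) -> (forall x, D x -> g x < h x) ->
  \int[m]_x g x < \int[m]_x h x.
Proof.
move=> mC C0 mD DC D0 mg mh g0 h0 gfin gh gh'.
pose E (n : nat) := D `&` [set x | g x + (n.+1%:R^-1)%:E <= h x].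
have mE n : measurable (E n).
  rewrite /E -[X in _ `&` X]setTI; apply: measurableI => //.
  by apply: measurable_lee => //; exact: emeasurable_funD.
have DE : D `<=` \bigcup_n E n.
  move=> x Dx; have := gh' x Dx; have := g0 x.
  case gE: (g x) => [r| |]//; case hE: (h x) => [s| |]// _.
    rewrite lte_fin => rs.
    have sr : (0 < s - r)%R by rewrite subr_gt0.
    exists (Num.truncn (s - r)^-1) => //; split => //=; rewrite gE hE.
    rewrite -EFinD lee_fin -lerBrDl -[leRHS]invrK lef_pV2 ?posrE ?invr_gt0//.
    exact/ltW/truncnS_gt.
  by move=> _; exists 0%N => //; split => //=; rewrite hE leey.
have [n En] : exists n, 0 < m (E n).
  apply: contrapT => /forallNP h'.
  have : m (\bigcup_n E n) = 0.
    apply: measure_negligible; first exact: bigcup_measurable.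
    apply: negligible_bigcup => n; apply/negligibleP; first exact: mE.
    apply/eqP; rewrite eq_le measure_ge0 andbT leNgt; apply/negP; exact: h'.
  move=> /(subset_measure0 mD (bigcup_measurable (fun n _ => mE n)) DE) D00.
  by rewrite D00 ltxx in D0.
set w : R := n.+1%:R^-1%R.
have w0 : (0 < w)%R by rewrite invr_gt0 ltr0n.
have mI : measurable_fun setT (EFin \o \1_(E n) : T -> \bar R).
  by apply/measurable_EFinP; exact: measurable_indic.
apply: (@lt_le_trans _ _ (\int[m]_x g x + w%:E * m (E n))).
  by rewrite lteDl ?mule_gt0// ge0_fin_numE// integral_ge0.
have -> : w%:E * m (E n) = \int[m]_x (w%:E * (\1_(E n) x)%:E).
  rewrite ge0_integralZl// ?lee_fin ?(ltW w0)//.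
  by rewrite integral_indic// setIT.
have mwI : measurable_fun setT (fun x : T => w%:E * (\1_(E n) x)%:E).
  by apply: emeasurable_funM.
have wI0 x : 0 <= w%:E * (\1_(E n) x)%:E :> \bar R.
  by rewrite -EFinM lee_fin mulr_ge0 ?(ltW w0).
rewrite -ge0_integralD//.
rewrite (integral_conull mC C0)//; last 2 first.
- exact: emeasurable_funD.
- by move=> x; exact: adde_ge0.
rewrite (integral_conull mC C0 mh)//.
apply: ge0_le_integral => //.
- by move=> x _; exact: adde_ge0.
- by apply: measurable_funTS; exact: emeasurable_funD.
- exact: measurable_funTS.
move=> x Cx; rewrite indicE; have [xE|_] := boolP (x \in E n); last first.
  by rewrite mule0 adde0; exact: gh.
by rewrite mule1; move: xE; rewrite inE => -[].
Qed.

End strict_comparison.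

Section conditioned_integral.
Context {R : realType} {d : nat}.
Notation T := (borelRd R d).
Implicit Types (mu nu rho : probRd R d) (W : set T).

Lemma conditioned_exists mu W : measurable W -> 0 < mu W ->
  exists rho, conditioned mu W rho.
Proof.
move=> mW W0; have [P h1 h2] := conditional_probability mW W0.
by exists (P : probRd R d); split.
Qed.

Lemma conditioned_setT mu : conditioned mu setT mu.
Proof.
split=> [A|f _ _]; rewrite probability_setT invr1 mul1e//.
by rewrite setIT.
Qed.

Lemma conditioned_self mu W rho : measurable W -> 0 < mu W ->
  conditioned mu W rho -> rho W = 1.
Proof.
move=> mW W0 [-> _]; rewrite setIid -{2}(fineK (fin_num_measure mu _ mW)) -EFinM.
by rewrite mulVf// gt_eqF// fine_gt0// W0/= ltey_eq fin_num_measure.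
Qed.

Lemma conditioned_setC mu W rho : conditioned mu W rho -> rho (~` W) = 0.
Proof. by move=> [-> _]; rewrite setICl measure0 mule0. Qed.

(** Split into positive and negative parts, to which [conditioned] applies. *)
Lemma conditioned_integral mu W rho (f : T -> \bar R) : measurable W -> 0 < mu W ->
  conditioned mu W rho -> measurable_fun setT f -> \int[rho]_x f^\- x < +oo ->
  (fine (mu W))^-1%:E * \int[mu]_(x in W) f x = \int[rho]_x f x.
Proof.
move=> mW W0 [_ rhoE] mf fin.
have c0 : (0 < (fine (mu W))^-1)%R.
  by rewrite invr_gt0 fine_gt0// W0/= ltey_eq fin_num_measure.
rewrite [in RHS]integralE [in LHS]integralE.
have mfn := measurable_funeneg mf; have mfp := measurable_funepos mf.
have n0 : 0 <= \int[mu]_(x in W) f^\- x by exact: integral_ge0.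
move: fin; rewrite !rhoE// => fin.
rewrite muleBr//.
apply: fin_num_adde_defl; rewrite fin_numN ge0_fin_numE//.
move: fin; case: (\int[mu]_(x in W) f^\- x) n0 => [r _ _| _|//]; first exact: ltry.
by rewrite gt0_muley// lte_fin.
Qed.

Lemma effective_potentialE mu (r : R) y : second_moment mu = r%:E ->
  2%R%:E * U mu y + (Q y)%:E = 2%R%:E * weighted_potential mu y - (2 * r + Q y)%:E.
Proof.
move=> qr; rewrite (U_weighted_potential y qr).
case: (weighted_potential mu y) (weighted_potential_ge0 mu y) => [v _| _|//].
  by rewrite -EFinB -!EFinM -EFinD -EFinB; congr EFin; ring.
by rewrite addye// gt0_muley ?lte_fin// !addye.
Qed.

Lemma conditioned_finite_energy mu W rho : measurable W -> finite_energy mu ->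
  conditioned mu W rho -> finite_energy rho /\ cross_energy mu rho < +oo.
Proof.
move=> mW [qmu emu] /(conditioned_dominated mW) dom.
have emurho := dominated_cross_energy dom emu.
split=> //; split; first exact: dominated_second_moment dom qmu.
by apply: (dominated_cross_energy dom); rewrite cross_energy_sym.
Qed.

Lemma measurable_double_potential mu :
  measurable_fun setT (fun y : T => 2%R%:E * weighted_potential mu y).
Proof. by apply: emeasurable_funM => //; exact: measurable_weighted_potential. Qed.

Lemma integral_double_potential mu nu : \int[nu]_y (2%R%:E * weighted_potential mu y) =
  2%R%:E * cross_energy mu nu.
Proof.
rewrite ge0_integralZl//; first exact: measurable_weighted_potential.
by move=> y _; exact: weighted_potential_ge0.
Qed.

(** This identifies the constants [A_Gamma] and [A_0] of the theorem. *)
Lemma potential_average mu W rho : measurable W -> finite_energy mu -> 0 < mu W ->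
  conditioned mu W rho ->
  (fine (mu W))^-1%:E * \int[mu]_(y in W) (2%R%:E * U mu y + (Q y)%:E) =
  (slope mu rho - 2 * fine (second_moment mu))%:E.
Proof.
move=> mW fmu W0 hrho; have [[qrho _] emurho] := conditioned_finite_energy mW fmu hrho.
have qmu := second_momentK fmu.1; have r0 := second_moment_fin_ge0 qmu.
move: (fine (second_moment mu)) qmu r0 => r qmu r0.
under eq_integral do rewrite (effective_potentialE _ qmu).
pose h (y : 'rV[R]_d) := (2 * r + Q y)%R.
have h0 y : (0 <= h y)%R by rewrite addr_ge0 ?Q_ge0// mulr_ge0.
have mh : measurable_fun setT (h : T -> R).
  by apply: measurable_funD => //; exact: measurable_Q.
have mhe : measurable_fun setT (EFin \o h : T -> \bar R) by exact/measurable_EFinP.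
have hE : \int[rho]_y (h y)%:E = (2 * r)%:E + second_moment rho.
  rewrite /h; under eq_integral do rewrite EFinD.
  rewrite ge0_integralD//=.
  - by rewrite integral_cst//= probability_setT mule1.
  - by move=> y _; rewrite lee_fin mulr_ge0.
  - by move=> y _; rewrite lee_fin Q_ge0.
  - by apply/measurable_EFinP; exact: measurable_Q.
have hfin : \int[rho]_y (h y)%:E < +oo by rewrite hE (second_momentK qrho) -EFinD ltry.
have V20 y : 0 <= 2%R%:E * weighted_potential mu y by rewrite mule_ge0
  ?weighted_potential_ge0.
have mF : measurable_fun setT (fun y : T => 2%R%:E * weighted_potential mu y - (h y)%:E).
  by apply: emeasurable_funB => //; exact: measurable_double_potential.
rewrite (conditioned_integral mW W0 hrho mF); last first.
  apply: le_lt_trans hfin; apply: ge0_le_integral => //.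
  - exact: measurable_funeneg.
  - move=> y _; rewrite funenegE ge_max lee_fin h0 andbT.
    by case: (2%R%:E * weighted_potential mu y) (V20 y) => [v v0|_|//];
      rewrite ?leNye// -EFinB -EFinN lee_fin; move: v0; rewrite lee_fin; lra.
rewrite (ge0_integralB (@measurable_double_potential mu) V20 mh h0 hfin)
  integral_double_potential hE.
rewrite (second_momentK qrho) -[cross_energy mu rho]fineK ?ge0_fin_numE
  ?cross_energy_ge0//.
by rewrite -EFinM -EFinD -?EFinB /slope; congr EFin; ring.
Qed.

End conditioned_integral.

(** * Mass and levels of the minimizer *)

Section minimizer.
Context {R : realType} {d : nat}.
Notation T := (borelRd R d).
Context (mu : probRd R d) (G : set 'rV[R]_d) (a : R).
Context (d2 : (2 <= d)%N) (hG : admissible_Gamma G) (a01 : (0 < a < 1)%R).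
Context (hmin : forall P, measures_with_mass G a P ->
  weighted_energy mu <= weighted_energy P).
Context (massG : a%:E <= mu (G : set T)) (fmu : finite_energy mu).
Implicit Types (nu rho : probRd R d) (W : set T).

Let mG : measurable (G : set T).
Proof. by apply: measurable_closed; exact: admissible_closed. Qed.

Let G_gt0 : 0 < mu (G : set T).
Proof. by apply: lt_le_trans massG; rewrite lte_fin; case/andP: a01. Qed.

Lemma stationary W rho nu (t0 : R) : measurable W -> 0 < mu W ->
  conditioned mu W rho -> finite_energy nu -> cross_energy mu nu < +oo ->
  (0 < t0 <= fine (mu W))%R ->
  (forall t, 0 < t <= t0 ->
    a <= fine (mu (G : set T)) + t * (fine (nu (G : set T)) - fine (rho (G : set T))))%R
      ->
  (slope mu rho <= slope mu nu)%R.
Proof.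
move=> mW W0 hrho fnu emunu /andP[t00 t0W] ht.
apply: (@first_variation R d mu rho nu t0 (measures_with_mass G a)) => //; first exact:
  conditioned_dominated hrho.
move=> t /[dup] tt0 /andP[t_gt0 t_le].
have tW : (0 <= t <= fine (mu W))%R by rewrite ltW//= (le_trans t_le).
have [P Psh] := shifted_exists nu mW W0 hrho tW.
exists P => //; rewrite /measures_with_mass /= -[P _]fineK ?fin_num_measure// lee_fin.
by have := shifted_measure mG Psh; have := ht t tt0; lra.
Qed.

Let fine_le1 nu (A : set T) : measurable A -> (0 <= fine (nu A) <= 1)%R.
Proof.
move=> mA; rewrite fine_ge0//= -lee_fin fineK ?fin_num_measure//.
exact: probability_le1.
Qed.

(** A measure stationary in all directions does not charge [G], while [mu] does. *)
Lemma not_stationary : ~ (forall nu, finite_energy nu -> cross_energy mu nu < +oo ->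
  (slope mu mu <= slope mu nu)%R).
Proof.
move=> h; have := G_gt0.
by rewrite (admissible_null d2 hG fmu h) ltxx.
Qed.

(** If the constraint were not saturated, a small fraction of the whole mass of
    [mu] could be moved anywhere. *)
Lemma mass_eq : fine (mu (G : set T)) = a.
Proof.
apply/eqP; rewrite eq_le; apply/andP; split; last first.
  by rewrite -lee_fin fineK ?fin_num_measure.
rewrite leNgt; apply/negP => aG; apply: not_stationary => nu fnu emunu.
(* Removing a fraction t of all the mass removes at most t from G. *)
pose t0 := (fine (mu (G : set T)) - a)%R.
have muT : fine (mu (setT : set T)) = 1%R by rewrite probability_setT.
have t01 : (0 < t0 <= fine (mu (setT : set T)))%R.
  rewrite muT /t0; have := fine_le1 mu mG; case/andP: a01; lra.
apply: (@stationary setT mu nu t0) => //.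
- by rewrite probability_setT.
- exact: conditioned_setT.
move=> t /andP[t_gt0 t_le]; rewrite /t0 in t_le.
have := fine_le1 nu mG; have := fine_le1 mu mG.
move: (fine (mu _)) (fine (nu _)) t_le => m n t_le; nra.
Qed.

Lemma massC_eq : fine (mu (~` G : set T)) = (1 - a)%R.
Proof.
by rewrite probability_setC// -mass_eq -[in LHS](fineK (fin_num_measure mu _ mG)).
Qed.

Let C_gt0 : 0 < mu (~` G : set T).
Proof.
rewrite -[mu _]fineK ?fin_num_measure//; last exact: measurableC.
by rewrite massC_eq lte_fin subr_gt0; case/andP: a01.
Qed.

(** Moving mass inside [G] keeps [mu G]. *)
Lemma stationary_on rho nu : conditioned mu (G : set T) rho ->
  finite_energy nu -> cross_energy mu nu < +oo -> nu (G : set T) = 1 ->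
  (slope mu rho <= slope mu nu)%R.
Proof.
move=> hrho fnu emunu nuG.
apply: (@stationary G rho nu a) => //; first by rewrite mass_eq lexx andbT; case/andP:
  a01.
move=> t _; rewrite nuG (conditioned_self mG G_gt0 hrho) subrr mulr0 addr0.
by rewrite mass_eq.
Qed.

(** Moving mass that lies outside [G] can only increase [mu G], whatever its
    destination. *)
Lemma stationary_off rho nu : conditioned mu (~` G : set T) rho ->
  finite_energy nu -> cross_energy mu nu < +oo -> (slope mu rho <= slope mu nu)%R.
Proof.
move=> hrho fnu emunu.
apply: (@stationary (~` G) rho nu (1 - a)%R) => //.
- exact: measurableC.
- by rewrite massC_eq lexx andbT subr_gt0; case/andP: a01.
move=> t /andP[t0 _].
have -> : rho (G : set T) = 0 by have := conditioned_setC hrho; rewrite setCK.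
rewrite /= subr0 mass_eq lerDl mulr_ge0 ?(ltW t0)//.
by have /andP[] := fine_le1 nu mG.
Qed.

Lemma split_integral rho1 rho0 (f : T -> \bar R) :
  conditioned mu (G : set T) rho1 -> conditioned mu (~` G : set T) rho0 ->
  (forall x, 0 <= f x) -> measurable_fun setT f ->
  \int[mu]_x f x = a%:E * \int[rho1]_x f x + (1 - a)%:E * \int[rho0]_x f x.
Proof.
move=> [_ h1] [_ h0] f0 mf; have [a_gt0 a_lt1] := andP a01.
rewrite h1// h0// mass_eq massC_eq !muleA -!EFinM !mulfV ?gt_eqF ?subr_gt0// !mul1e.
rewrite -ge0_integral_setU//; first by rewrite setUv.
- exact: measurableC.
- by rewrite setUv.
- exact/disj_setPCl.
Qed.

(** [mu] is the mean of [rho1] and [rho0], hence so is its slope. If the slope of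
    [rho1] were at most that of [rho0], then [mu] would be stationary in all
    directions. *)
Lemma levels_lt rho1 rho0 : conditioned mu (G : set T) rho1 ->
  conditioned mu (~` G : set T) rho0 -> (slope mu rho0 < slope mu rho1)%R.
Proof.
move=> h1 h0; rewrite ltNge; apply/negP => b10; apply: not_stationary => nu fnu emunu.
apply: le_trans (stationary_off h0 fnu emunu).
have [[q1 _] e1] := conditioned_finite_energy mG fmu h1.
have [[q0 _] e0] := conditioned_finite_energy (measurableC mG) fmu h0.
have [a_gt0 a_lt1] := andP a01.
have mQ : measurable_fun setT (EFin \o Q : T -> \bar R).
  by apply/measurable_EFinP; exact: measurable_Q.
have Q0 (x : T) : 0 <= (EFin \o Q) x by rewrite lee_fin Q_ge0.
have eK nu' : cross_energy mu nu' < +oo -> cross_energy mu nu' =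
  (fine (cross_energy mu nu'))%:E.
  by move=> h; rewrite fineK// ge0_fin_numE ?cross_energy_ge0.
have Ee : (fine (cross_energy mu mu) =
  a * fine (cross_energy mu rho1) + (1 - a) * fine (cross_energy mu rho0))%R.
  have : cross_energy mu mu = a%:E * cross_energy mu rho1 + (1 - a)%:E * cross_energy mu
    rho0.
    exact: (split_integral h1 h0 (weighted_potential_ge0 mu)
      (@measurable_weighted_potential _ _ mu)).
  by rewrite (eK _ e1) (eK _ e0) (eK _ fmu.2) -!EFinM -EFinD => -[].
have Eq : (fine (second_moment mu) =
  a * fine (second_moment rho1) + (1 - a) * fine (second_moment rho0))%R.
  have : second_moment mu = a%:E * second_moment rho1 + (1 - a)%:E * second_moment rho0.
    exact: (split_integral h1 h0 Q0 mQ).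
  by rewrite (second_momentK q1) (second_momentK q0) (second_momentK fmu.1) -!EFinM
    -EFinD => -[].
move: b10; rewrite /slope Ee Eq.
move: (fine _) (fine _) (fine _) (fine _) => A B C D; nra.
Qed.

End minimizer.

(** * Quasi-everywhere comparison with a level *)

Section quasi_everywhere.
Context {R : realType} {d : nat}.
Notation T := (borelRd R d).
Implicit Types (mu nu rho : probRd R d) (W : set T) (beta : R).

(** For [beta = A + 2 * second_moment mu] these are the sets where [2 U + Q] is
    below, respectively above, the level [A]. *)
Definition below mu beta : set T :=
  [set y : T | 2%R%:E * weighted_potential mu y < (beta + Q y)%:E].
Definition above mu beta : set T :=
  [set y : T | (beta + Q y)%:E < 2%R%:E * weighted_potential mu y].

Let measurable_level beta : measurable_fun setT (fun y : T => (beta + Q y)%:E).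
Proof. by apply/measurable_EFinP; apply: measurable_funD => //; exact: measurable_Q. Qed.

Lemma measurable_below mu beta : measurable (below mu beta).
Proof.
rewrite -[X in measurable X]setTI; apply: measurable_lte => //; exact:
  measurable_double_potential.
Qed.

Lemma measurable_above mu beta : measurable (above mu beta).
Proof.
rewrite -[X in measurable X]setTI; apply: measurable_lte => //; exact:
  measurable_double_potential.
Qed.

Definition stationary_on_set mu W beta := forall nu, finite_energy nu ->
  cross_energy mu nu < +oo -> nu W = 1 -> (beta <= slope mu nu)%R.

Let integral_double_potentialD mu nu (c : R) : (0 <= c)%R ->
  \int[nu]_y (2%R%:E * weighted_potential mu y + c%:E) =
    2%R%:E * cross_energy mu nu + c%:E.
Proof.
move=> c0; rewrite ge0_integralD//=.
- by rewrite integral_double_potential integral_cst//= probability_setT mule1.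
- by move=> y _; rewrite mule_ge0 ?weighted_potential_ge0.
- exact: measurable_double_potential.
Qed.

Let integral_levelD nu (c : R) : (0 <= c)%R ->
  \int[nu]_y (c + Q y)%:E = c%:E + second_moment nu.
Proof.
move=> c0; under eq_integral do rewrite EFinD.
rewrite ge0_integralD//=.
- by rewrite integral_cst//= probability_setT mule1.
- by move=> y _; rewrite lee_fin Q_ge0.
- by apply/measurable_EFinP; exact: measurable_Q.
Qed.

(** Integrating [2 V < beta + Q] against [nu] gives [slope mu nu < beta]. The
    constants [`|beta|] and [`|beta| - beta] keep both sides nonnegative. *)
Lemma no_mass_below mu nu W beta (C : set T) : stationary_on_set mu W beta ->
  measurable W -> finite_energy nu -> measurable C -> nu C = 1 ->
  C `<=` W `&` below mu beta -> False.
Proof.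
move=> st mW fnu mC nuC CW.
have c0 : nu (~` C) = 0 by rewrite probability_setC// nuC subee.
have nuW : nu W = 1.
  apply/eqP; rewrite eq_le probability_le1//= -nuC.
  by apply: le_measure; rewrite ?inE// => x /CW[].
pose g y := 2%R%:E * weighted_potential mu y + (`|beta| - beta)%:E.
pose h (y : T) := (`|beta| + Q y)%:E.
have b0 : (0 <= `|beta| - beta)%R by rewrite subr_ge0 ler_norm.
have g0 y : 0 <= g y by rewrite /g adde_ge0 ?lee_fin// mule_ge0 ?weighted_potential_ge0.
have h0 (y : T) : 0 <= h y by rewrite lee_fin addr_ge0 ?Q_ge0.
have mg : measurable_fun setT (g : T -> \bar R).
  by apply: emeasurable_funD => //; exact: measurable_double_potential.
have mh : measurable_fun setT (h : T -> \bar R) by exact: measurable_level.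
have gh y : C y -> g y < h y.
  move=> /CW[_]; rewrite /below /g /h /=.
  case: (2%R%:E * weighted_potential mu y) => [v| |]; rewrite ?ltNyr// -?EFinD ?lte_fin;
    lra.
have hE : \int[nu]_y h y = `|beta|%:E + second_moment nu by exact: integral_levelD.
have hfin : \int[nu]_y h y < +oo by rewrite hE (second_momentK fnu.1) -EFinD ltry.
have gfin : \int[nu]_y g y < +oo.
  apply: le_lt_trans hfin; rewrite (integral_conull mC c0 mg g0)
    (integral_conull mC c0 mh h0).
  apply: ge0_le_integral => //; [exact: measurable_funTS|exact: measurable_funTS|].
  by move=> y Cy; exact/ltW/gh.
have C0 : 0 < nu C by rewrite nuC lte01.
have := integral_lt mC c0 mC (fun _ => id) C0 mg mh g0 h0 gfin
  (fun y Cy => ltW (gh y Cy)) gh.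
move: gfin; rewrite hE /g integral_double_potentialD// => gfin.
have emunu : cross_energy mu nu < +oo.
  move: gfin; case: (cross_energy mu nu) (cross_energy_ge0 mu nu) => [r _ _|_|//];
    first exact: ltry.
  by rewrite gt0_muley ?lte_fin.
have := st nu fnu emunu nuW; rewrite /slope.
have -> : cross_energy mu nu =
  (fine (cross_energy mu nu))%:E by rewrite fineK// ge0_fin_numE ?cross_energy_ge0.
rewrite (second_momentK fnu.1) -EFinM -!EFinD lte_fin /=.
by move: (fine _) (fine _) (`|beta|)%R => A B D; lra.
Qed.

Lemma compact_second_moment nu (C : set 'rV[R]_d) : compact C -> nu (C : set T) = 1 ->
  second_moment nu < +oo.
Proof.
move=> cC nuC.
have mC : measurable (C : set T).
  by apply: measurable_closed; apply: compact_closed => //; exact: norm_hausdorff.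
have c0 : nu (~` C : set T) = 0 by rewrite probability_setC// nuC subee.
have [M [_ hM]] := compact_bounded cC.
pose r := (`|M| + 1)%R.
have r0 : (0 <= r)%R by rewrite addr_ge0.
have Cr y : C y -> (Q y <= d%:R * r ^+ 2)%R.
  move=> Cy; apply: Q_le_coord => i.
  have /(norm_rV _ r0) : (`|y| <= r)%R.
    by apply: hM Cy; rewrite ltr_pwDr// ler_norm.
  exact.
have mQ : measurable_fun setT (EFin \o Q : T -> \bar R).
  by apply/measurable_EFinP; exact: measurable_Q.
have Q0 (x : T) : 0 <= (EFin \o Q) x by rewrite lee_fin Q_ge0.
rewrite /second_moment (integral_conull mC c0 mQ Q0).
apply: (@le_lt_trans _ _ (\int[nu]_(y in C : set T) (d%:R * r ^+ 2)%:E)).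
  apply: ge0_le_integral => //; first exact: measurable_funTS.
rewrite integral_cst; last exact: mC.
by rewrite [X in _ * X]nuC mule1 ltry.
Qed.

(** A compactly carried measure has a finite second moment, so that a finite
    mutual energy is a finite energy, and [no_mass_below] applies. *)
Lemma capacity_below mu W beta : stationary_on_set mu W beta -> measurable W ->
  capacity (W `&` below mu beta) = 0.
Proof.
move=> st mW.
suff roo : robin (W `&` below mu beta) = +oo.
  by rewrite /capacity roo; case: ifP => _; rewrite ?invey.
apply/eqP; rewrite -leye_eq; apply: le_ereal_inf_tmp.
move=> _ [nu [C [cC CW nuC]] <-]; rewrite leye_eq; apply/eqP.
apply: contrapT => noo.
have mC : measurable (C : set T).
  by apply: measurable_closed; apply: compact_closed => //; exact: norm_hausdorff.
have qnu := compact_second_moment cC nuC.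
apply: (@no_mass_below mu nu W beta C st mW _ mC nuC CW); split=> //.
have := mutual_energyE (second_momentK qnu).
case: (cross_energy nu nu) (cross_energy_ge0 nu nu) noo => [r _ _ _|_ + E|//];
  first exact: ltry.
by rewrite E.
Qed.

Lemma null_below mu W beta : finite_energy mu -> stationary_on_set mu W beta ->
  measurable W -> mu (W `&` below mu beta) = 0.
Proof.
move=> fmu st mW; apply/eqP; rewrite eq_le measure_ge0 andbT leNgt.
apply/negP => D0.
have mD : measurable (W `&` below mu beta).
  by apply: measurableI => //; exact: measurable_below.
have [nu hnu] := conditioned_exists mD D0.
apply: (@no_mass_below mu nu W beta _ st mW _ mD (conditioned_self mD D0 hnu)) => //.
by have [] := conditioned_finite_energy mD fmu hnu.
Qed.

(** The mean of [2 V - Q] over [rho] is [slope mu rho], and [2 V - Q] is almost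
    everywhere at least that mean by [null_below]. *)
Lemma null_above mu W rho : finite_energy mu -> measurable W -> 0 < mu W ->
  conditioned mu W rho -> stationary_on_set mu W (slope mu rho) ->
  mu (W `&` above mu (slope mu rho)) = 0.
Proof.
move=> fmu mW W0 hrho st; set beta := slope mu rho.
have [[qrho _] emurho] := conditioned_finite_energy mW fmu hrho.
have nb := null_below fmu st mW.
apply/eqP; rewrite eq_le measure_ge0 andbT leNgt; apply/negP => D0.
have mB := measurable_below mu beta; have mA := measurable_above mu beta.
have mC : measurable (W `\` below mu beta) by exact: measurableD.
have mD : measurable (W `&` above mu beta) by exact: measurableI.
have c_gt0 : 0 < (fine (mu W))^-1%:E.
  by rewrite lte_fin invr_gt0 fine_gt0// W0/= ltey_eq fin_num_measure.
have C0 : rho (~` (W `\` below mu beta)) = 0.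
  rewrite hrho.1 (_ : _ `&` W = W `&` below mu beta) ?nb ?mule0//.
  apply/seteqP; split => x /=; last by move=> [? ?]; split=> // -[].
  by move=> [nx Wx]; split=> //; apply: contrapT => nb'; apply: nx.
have rhoD : 0 < rho (W `&` above mu beta).
  rewrite hrho.1 mule_gt0// (_ : _ `&` W = W `&` above mu beta)//.
  by rewrite setIAC setIid.
pose g (y : T) := (`|beta| + Q y)%:E.
pose h y := 2%R%:E * weighted_potential mu y + (`|beta| - beta)%:E.
have b0 : (0 <= `|beta| - beta)%R by rewrite subr_ge0 ler_norm.
have h0 y : 0 <= h y by rewrite /h adde_ge0 ?lee_fin// mule_ge0 ?weighted_potential_ge0.
have g0 (y : T) : 0 <= g y by rewrite lee_fin addr_ge0 ?Q_ge0.
have mh : measurable_fun setT (h : T -> \bar R).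
  by apply: emeasurable_funD => //; exact: measurable_double_potential.
have mg : measurable_fun setT (g : T -> \bar R) by exact: measurable_level.
have gE : \int[rho]_y g y = `|beta|%:E + second_moment rho by exact: integral_levelD.
have gfin : \int[rho]_y g y < +oo by rewrite gE (second_momentK qrho) -EFinD ltry.
have := @integral_lt R _ T rho (W `\` below mu beta) (W `&` above mu beta) g h
  mC C0 mD _ rhoD mg mh g0 h0 gfin.
rewrite gE /h integral_double_potentialD//.
have -> : cross_energy mu rho =
  (fine (cross_energy mu rho))%:E by rewrite fineK// ge0_fin_numE ?cross_energy_ge0.
rewrite (second_momentK qrho) -EFinM -!EFinD lte_fin => lt.
suff : (`|beta| + fine (second_moment rho) < 2 * fine (cross_energy mu rho) +
  (`|beta| - beta))%R.
  by rewrite /beta /slope; move: (fine _) (fine _) (`|_|)%R => A B D; lra.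
apply: lt.
- move=> x [Wx]; rewrite /above /below /= => ab; split=> //=.
  by apply/negP; rewrite -leNgt ltW.
- move=> x [Wx]; rewrite /below /= => /negP; rewrite -leNgt /g.
  case: (2%R%:E * weighted_potential mu x) => [v| |]; rewrite ?leey// -?EFinD ?lee_fin;
    lra.
- move=> x [Wx]; rewrite /above /= /g.
  case: (2%R%:E * weighted_potential mu x) => [v| |]; rewrite -?EFinD ?lte_fin//;
    first lra.
  by move=> _; rewrite ltry.
Qed.

(** The point is a limit of points of [W] where [2 V - Q] is at most the level,
    and [V] is lower semicontinuous. *)
Lemma le_level mu W rho (x : 'rV[R]_d) : (2 <= d)%N -> finite_energy mu ->
  measurable W -> 0 < mu W ->
  conditioned mu W rho -> stationary_on_set mu W (slope mu rho) ->
  (forall O : set 'rV[R]_d, open O -> O x -> 0 < mu ((O : set T) `&` W)) ->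
  2%R%:E * weighted_potential mu x <= (slope mu rho + Q x)%:E.
Proof.
move=> d2 fmu mW W0 hrho st chx; set beta := slope mu rho.
have nb := null_below fmu st mW; have na := null_above fmu mW W0 hrho st.
have mB := measurable_below mu beta; have mA := measurable_above mu beta.
have ex n : exists y : 'rV[R]_d, ball x (n.+1%:R^-1)%R y /\
    weighted_potential mu y <= ((beta + Q y) / 2)%:E.
  have n0 : (0 < n.+1%:R^-1 :> R)%R by rewrite invr_gt0 ltr0n.
  apply: contrapT => /forallNP h.
  have := chx _ (ball_open x n.+1%:R^-1%R) (ballxx x n0).
  rewrite lt0e => /andP[/eqP + _]; apply.
  apply: (subset_measure0 (B := W `&` above mu beta)) => //.
  - by apply: measurableI => //; apply: measurable_open; exact: ball_open.
  - exact: measurableI.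
  - move=> y [xy Wy]; split => //; rewrite /above /= ltNge; apply/negP => le.
    apply: (h y); split=> //; move: le.
    case: (weighted_potential mu y) (weighted_potential_ge0 mu y) => [v _| _|//];
      last by rewrite gt0_muley ?lte_fin.
    by rewrite -EFinM !lee_fin; lra.
pose y_ n := projT1 (cid (ex n)).
have y_ball n : ball x (n.+1%:R^-1)%R (y_ n) by rewrite /y_; case: cid => ? [].
have y_V n : weighted_potential mu (y_ n) <= ((beta + Q (y_ n)) / 2)%:E by rewrite /y_;
  case: cid => ? [].
have yx : y_ @ \oo --> x.
  apply/cvg_ballP => eps eps0; near=> n.
  apply: (le_ball _ (y_ball n)); apply: ltW; near: n.
  exact: near_infty_natSinv_lt (PosNum eps0).
have Cl : (fun n => ((beta + Q (y_ n)) / 2)%:E) @ \oo --> ((beta + Q x) / 2)%:E.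
  apply: cvg_EFin; first exact: nearW.
  apply: cvgM; last exact: cvg_cst.
  apply: cvgD; first exact: cvg_cst.
  exact: (cvg_comp y_ Q yx (@Q_continuous R d x)).
have := weighted_potential_lsc d2 yx Cl y_V.
case: (weighted_potential mu x) (weighted_potential_ge0 mu x) => [v _| _|//];
  last by rewrite leye_eq.
by rewrite -EFinM !lee_fin; lra.
Unshelve. all: by end_near. Qed.

End quasi_everywhere.

(** * The theorem *)

Unset Implicit Arguments.

Theorem lemma3p2 (R : realType) (d : nat) (d_ge2 : (2 <= d)%N)
    (Gamma : set 'rV[R]_d) (hGamma : admissible_Gamma Gamma)
    (a : R) (a01 : (0 < a < 1)%R)
    (mu : probRd R d)
    (hmu : unique_minimizer weighted_energy (measures_with_mass Gamma a) mu) :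
  let F := fun x : 'rV[R]_d => 2%R%:E * U mu x + (Q x)%:E in
  let A_Gamma := (a^-1)%R%:E * \int[mu]_(x in Gamma) F x in
  let A_0 := ((1 - a)^-1)%R%:E * \int[mu]_(x in ~` Gamma) F x in
  [/\ quasi_everywhere_on (Gamma `&` supp mu) (fun x => F x = A_Gamma),
      quasi_everywhere_on Gamma (fun x => A_Gamma <= F x),
      quasi_everywhere_on (supp mu `\` Gamma) (fun x => F x = A_0),
      quasi_everywhere_on (~` (supp mu `\` Gamma)) (fun x => A_0 <= F x)
    & A_0 < A_Gamma].
Proof.
move=> F A_Gamma A_0.
have [massG hmin _] := hmu.
have mG : measurable (Gamma : set (borelRd R d)).
  by apply: measurable_closed; exact: admissible_closed.
have mC := measurableC mG.
have fmu : finite_energy mu by exact: minimizer_finite_energy (ltnW d_ge2) mG a01 hmu.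
have mass1 := mass_eq d_ge2 hGamma a01 hmin massG fmu.
have mass0 := massC_eq d_ge2 hGamma a01 hmin massG fmu.
have G0 : 0 < mu (Gamma : set (borelRd R d)).
  by rewrite -[mu _]fineK ?fin_num_measure// mass1 lte_fin; case/andP: a01.
have C0 : 0 < mu (~` Gamma : set (borelRd R d)).
  by rewrite -[mu _]fineK ?fin_num_measure// mass0 lte_fin subr_gt0; case/andP: a01.
have [rho1 h1] := conditioned_exists mG G0.
have [rho0 h0] := conditioned_exists mC C0.
have st1 : stationary_on_set mu Gamma (slope mu rho1).
  by move=> nu; exact: (stationary_on d_ge2 hGamma a01 hmin massG fmu h1).
have st0 W : stationary_on_set mu W (slope mu rho0).
  by move=> nu fnu emunu _; exact: (stationary_off d_ge2 hGamma a01 hmin massG fmu h0).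
have lt01 := levels_lt d_ge2 hGamma a01 hmin massG fmu h1 h0.
have qmu := second_momentK fmu.1.
set r := fine (second_moment mu) in qmu.
have A1E : A_Gamma = (slope mu rho1 - 2 * r)%:E.
  by rewrite /A_Gamma -mass1; exact: potential_average.
have A0E : A_0 = (slope mu rho0 - 2 * r)%:E.
  by rewrite /A_0 -mass0; exact: potential_average.
have FE x : F x = 2%R%:E * weighted_potential mu x - (2 * r + Q x)%:E by exact:
  effective_potentialE.
have geP beta x : ~ below mu beta x -> (beta - 2 * r)%:E <= F x.
  rewrite /below /= FE => /negP; rewrite -leNgt.
  by case: (2%R%:E * weighted_potential mu x) => [v| |]//;
    rewrite ?leey// -EFinB !lee_fin; lra.
have leP beta x : 2%R%:E * weighted_potential mu x <= (beta + Q x)%:E -> F x <=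
  (beta - 2 * r)%:E.
  by rewrite FE; case: (2%R%:E * weighted_potential mu x) => [v| |]//;
    rewrite ?leNye// -EFinB !lee_fin; lra.
have mb beta W : measurable W -> measurable (W `&` below mu beta).
  by move=> mW; apply: measurableI => //; exact: measurable_below.
have F1 x : (forall O : set 'rV[R]_d, open O -> O x ->
    0 < mu ((O : set (borelRd R d)) `&` Gamma)) -> F x <= A_Gamma.
  by move=> h; rewrite A1E; apply: leP; exact: le_level fmu mG G0 h1 st1 h.
have F0 x : (forall O : set 'rV[R]_d, open O -> O x ->
    0 < mu ((O : set (borelRd R d)) `&` ~` Gamma)) -> F x <= A_0.
  by move=> h; rewrite A0E; apply: leP; exact: le_level fmu mC C0 h0 (st0 _) h.
have A01 : A_0 < A_Gamma by rewrite A0E A1E lte_fin; lra.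
have cap1 : capacity (Gamma `&` below mu (slope mu rho1)) = 0 by exact: capacity_below.
have cap0 : capacity (setT `&` below mu (slope mu rho0)) = 0.
  by apply: capacity_below => //; exact: st0.
have ge1 x : Gamma x -> ~ (Gamma `&` below mu (slope mu rho1)) x -> A_Gamma <= F x.
  by move=> Gx nx; rewrite A1E; apply: geP => bx; apply: nx.
have ge0 x : ~ (setT `&` below mu (slope mu rho0)) x -> A_0 <= F x.
  by move=> nx; rewrite A0E; apply: geP => bx; apply: nx.
split => //.
- exists (Gamma `&` below mu (slope mu rho1)); split; [exact: mb|exact: cap1|].
  move=> x [Gx sx] nx; apply/eqP; rewrite eq_le ge1// andbT.
  (* Either all the neighbourhoods of x charge Gamma, or all charge its complement. *)
  have [|/existsNP[B1 /not_implyP[oB1 /not_implyP[B1x B1G]]]] := pselect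
    (forall O : set 'rV[R]_d, open O -> O x ->
      0 < mu ((O : set (borelRd R d)) `&` Gamma)); first exact: F1.
  apply: le_trans (ltW A01); apply: F0 => O oO Ox.
  rewrite lt0e measure_ge0 andbT; apply/eqP => OC.
  have := sx (O `&` B1) (openI oO oB1) (conj Ox B1x).
  rewrite lt0e => /andP[/eqP + _]; apply.
  have mO := measurable_open oO; have mB1 := measurable_open oB1.
  have B10 : mu ((B1 : set (borelRd R d)) `&` Gamma) = 0.
    by apply/eqP; rewrite eq_le measure_ge0 andbT leNgt; apply/negP.
  have : mu (((O : set (borelRd R d)) `&` ~` Gamma) `|`
      ((B1 : set (borelRd R d)) `&` Gamma)) = 0.
    apply/eqP; rewrite -measure_le0.
    apply: le_trans (measureU2 _ _ _) _; [exact: measurableI|exact: measurableI|].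
    by rewrite [X in X + _]OC [X in _ + X]B10 adde0.
  apply: subset_measure0.
  + exact: measurableI.
  + by apply: measurableU; exact: measurableI.
  + by move=> y [Oy B1y]; have [Gy|Gy] := pselect (Gamma y); [right|left].
- exists (Gamma `&` below mu (slope mu rho1)); split; [exact: mb|exact: cap1|exact: ge1].
- exists (setT `&` below mu (slope mu rho0)); split; [exact: mb|exact: cap0|].
  move=> x [sx Gx] nx; apply/eqP; rewrite eq_le ge0// andbT; apply: F0 => O oO Ox.
  (* Gamma is closed: x has neighbourhoods that avoid it. *)
  apply: (sx (O `&` ~` Gamma)); last by split.
  apply: openI => //; apply: closed_openC; exact: admissible_closed.
- exists (setT `&` below mu (slope mu rho0)); split; [exact: mb|exact: cap0|].
  by move=> x _; exact: ge0.
Qed.
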